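(* For a given undirected weighted graph $G$ with $n$ vertices, there is an incremental (1-failure) distance sensitivity oracle that can be constructed in $\tilde{O}(n^3)$ time, such that when an edge $e$ is inserted into $G$ the oracle can be maintained in worst-case $\tilde{O}(n^2)$ time. The oracle uses $\tilde{O}(n^2)$ space and answers queries in $\tilde{O}(1)$ time.
   Context: A (1-failure) distance sensitivity oracle (DSO) for a weighted graph $G$ is a data structure that, given any two vertices $u,v$ and any edge $f$, returns the length of the shortest $u$-$v$ path in $G-\{f\}$ (the graph $G$ with edge $f$ removed). An incremental DSO additionally supports insertions of new weighted edges into the current graph, after which queries refer to the updated graph. $\tilde{O}(\cdot)$ hides polylogarithmic factors in $n$. *)

(* Defs.v *)
From HB Require Import structures.
From mathcomp Require Import all_boot all_order all_algebra.
From mathcomp Require Import constructive_ereal.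

Set Implicit Arguments.
Unset Strict Implicit.
Unset Printing Implicit Defensive.

Import Order.TTheory GRing.Theory Num.Theory.

(** * Weighted undirected graphs *)

(* [weight G u v] is meaningful only when [edge G u v]. *)
Record wgraph (R : realDomainType) (n : nat) := WGraph {
  edge : rel 'I_n;
  weight : 'I_n -> 'I_n -> R }.

Definition wgraph_ok (R : realDomainType) (n : nat) (G : wgraph R n) : Prop :=
  [/\ symmetric (edge G), irreflexive (edge G),
      (forall u v, weight G u v = weight G v u) &
      (forall u v, edge G u v -> (0 <= weight G u v)%R)].

Definition same_pair (n : nat) (a b u v : 'I_n) : bool :=
  [set u; v] == [set a; b].

Definition insert_edge (R : realDomainType) (n : nat) (G : wgraph R n)
    (a b : 'I_n) (w : R) : wgraph R n :=
  WGraph (fun u v => edge G u v || same_pair a b u v)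
         (fun u v => if same_pair a b u v then w else weight G u v).

Definition delete_edge (R : realDomainType) (n : nat) (G : wgraph R n)
    (a b : 'I_n) : wgraph R n :=
  WGraph (fun u v => edge G u v && ~~ same_pair a b u v) (weight G).

Definition path_length (R : realDomainType) (n : nat) (G : wgraph R n)
    (u : 'I_n) (p : seq 'I_n) : R :=
  (\sum_(x <- pairmap (weight G) u p) x)%R.

(* [d] is the length of a shortest [u]-[v] path, and [+oo] exactly when [u] and
   [v] are disconnected. *)
Definition is_dist (R : realDomainType) (n : nat) (G : wgraph R n)
    (u v : 'I_n) (d : \bar R) : Prop :=
  (forall p, path (edge G) u p -> last u p = v ->
     (d <= (path_length G u p)%:E)%E) /\
  (d <> +oo%E ->
     exists p, [/\ path (edge G) u p, last u p = v &
                   d = (path_length G u p)%:E]).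

(** * A random access machine

   Integers are bounded machine words.  Weights live in their own registers and
   memory, and can only be added and compared (the comparison-addition model).
   All operations are unit cost. *)

Inductive iexpr : Type :=
| INum of nat
| IReg of nat
| ILoad of iexpr
| IAdd of iexpr & iexpr
| ISub of iexpr & iexpr
| IMul of iexpr & iexpr
| IDiv of iexpr & iexpr
| IMod of iexpr & iexpr.

Inductive wexpr : Type :=
| WZero
| WInf
| WReg of nat
| WLoad of iexpr
| WAdd of wexpr & wexpr.

Inductive bexpr : Type :=
| BILe of iexpr & iexpr
| BWLe of wexpr & wexpr
| BNot of bexpr
| BAnd of bexpr & bexpr.

Inductive cmd : Type :=
| Skip
| ISet of nat & iexpr
| WSet of nat & wexpr
| IStore of iexpr & iexpr
| WStore of iexpr & wexpr
| Seq of cmd & cmd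
| If of bexpr & cmd & cmd
| While of bexpr & cmd.

Record state (R : realDomainType) := State {
  ireg : nat -> nat;
  wreg : nat -> \bar R;
  imem : nat -> nat;
  wmem : nat -> \bar R }.

Fixpoint icost (e : iexpr) : nat :=
  match e with
  | INum _ | IReg _ => 1
  | ILoad e1 => (icost e1).+1
  | IAdd e1 e2 | ISub e1 e2 | IMul e1 e2 | IDiv e1 e2 | IMod e1 e2 =>
      (icost e1 + icost e2).+1
  end.

Fixpoint wcost (e : wexpr) : nat :=
  match e with
  | WZero | WInf | WReg _ => 1
  | WLoad e1 => (icost e1).+1
  | WAdd e1 e2 => (wcost e1 + wcost e2).+1
  end.

Fixpoint bcost (e : bexpr) : nat :=
  match e with
  | BILe e1 e2 => (icost e1 + icost e2).+1
  | BWLe e1 e2 => (wcost e1 + wcost e2).+1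
  | BNot e1 => (bcost e1).+1
  | BAnd e1 e2 => (bcost e1 + bcost e2).+1
  end.

(* Evaluation faults ([None]) when an integer reaches the word capacity [B] or
   an address reaches the memory size [S]. *)
Definition guard (T : Type) (b : bool) (x : T) : option T :=
  if b then Some x else None.

Fixpoint ieval (R : realDomainType) (B S : nat) (s : state R) (e : iexpr) :
    option nat :=
  let arith op e1 e2 :=
    obind (fun x => obind (fun y => guard (op x y < B) (op x y))
      (ieval B S s e2)) (ieval B S s e1) in
  match e with
  | INum k => guard (k < B) k
  | IReg r => Some (ireg s r)
  | ILoad e1 => obind (fun i => guard (i < S) (imem s i)) (ieval B S s e1)
  | IAdd e1 e2 => arith addn e1 e2
  | ISub e1 e2 => arith subn e1 e2
  | IMul e1 e2 => arith muln e1 e2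
  | IDiv e1 e2 => arith divn e1 e2
  | IMod e1 e2 => arith modn e1 e2
  end.

Fixpoint weval (R : realDomainType) (B S : nat) (s : state R) (e : wexpr) :
    option (\bar R) :=
  match e with
  | WZero => Some 0%E
  | WInf => Some +oo%E
  | WReg r => Some (wreg s r)
  | WLoad e1 => obind (fun i => guard (i < S) (wmem s i)) (ieval B S s e1)
  | WAdd e1 e2 =>
      obind (fun x => omap (fun y => (x + y)%E) (weval B S s e2))
        (weval B S s e1)
  end.

Fixpoint beval (R : realDomainType) (B S : nat) (s : state R) (e : bexpr) :
    option bool :=
  match e with
  | BILe e1 e2 =>
      obind (fun x => omap (fun y => x <= y) (ieval B S s e2)) (ieval B S s e1)
  | BWLe e1 e2 =>
      obind (fun x => omap (fun y => (x <= y)%E) (weval B S s e2))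
        (weval B S s e1)
  | BNot e1 => omap negb (beval B S s e1)
  | BAnd e1 e2 =>
      obind (fun x => omap (andb x) (beval B S s e2)) (beval B S s e1)
  end.

(* [exec B S c s s' t]: from [s], the command [c] halts in [s'] after [t] steps
   without faulting. *)
Inductive exec (R : realDomainType) (B S : nat) :
    cmd -> state R -> state R -> nat -> Prop :=
| ExecSkip s : exec B S Skip s s 1
| ExecISet r e x s : ieval B S s e = Some x ->
    exec B S (ISet r e) s
      (State [eta ireg s with r |-> x] (wreg s) (imem s) (wmem s))
      (icost e).+1
| ExecWSet r e x s : weval B S s e = Some x ->
    exec B S (WSet r e) s
      (State (ireg s) [eta wreg s with r |-> x] (imem s) (wmem s))
      (wcost e).+1
| ExecIStore e1 e2 i x s :
    ieval B S s e1 = Some i -> i < S -> ieval B S s e2 = Some x ->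
    exec B S (IStore e1 e2) s
      (State (ireg s) (wreg s) [eta imem s with i |-> x] (wmem s))
      (icost e1 + icost e2).+1
| ExecWStore e1 e2 i x s :
    ieval B S s e1 = Some i -> i < S -> weval B S s e2 = Some x ->
    exec B S (WStore e1 e2) s
      (State (ireg s) (wreg s) (imem s) [eta wmem s with i |-> x])
      (icost e1 + wcost e2).+1
| ExecSeq c1 c2 s1 s2 s3 t1 t2 :
    exec B S c1 s1 s2 t1 -> exec B S c2 s2 s3 t2 ->
    exec B S (Seq c1 c2) s1 s3 (t1 + t2)
| ExecIf b v c1 c2 s s' t :
    beval B S s b = Some v -> exec B S (if v then c1 else c2) s s' t ->
    exec B S (If b c1 c2) s s' (bcost b + t).+1
| ExecWhileF b c s :
    beval B S s b = Some false ->
    exec B S (While b c) s s (bcost b).+1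
| ExecWhileT b c s1 s2 s3 t1 t2 :
    beval B S s1 b = Some true -> exec B S c s1 s2 t1 ->
    exec B S (While b c) s2 s3 t2 ->
    exec B S (While b c) s1 s3 (bcost b + t1 + t2).+1.

(* Words of [a * (1 + floor (log2 n))] bits. *)
Definition word_cap (a n : nat) : nat := 2 ^ (a * (trunc_log 2 n).+1).

(** * Calling conventions *)

Definition no_weights (R : realDomainType) : nat -> \bar R := fun=> 0%E.

(* The row-major adjacency matrix, [+oo] marking the non-edges; the other cells
   are zero. *)
Definition adj_matrix (R : realDomainType) (n : nat) (G : wgraph R n) :
    nat -> \bar R :=
  fun k =>
    match insub (k %/ n), insub (k %% n) with
    | Some u, Some v => if edge G u v then (weight G u v)%:E else +oo%E
    | _, _ => 0%E
    end.

Definition build_input (R : realDomainType) (n : nat) (G : wgraph R n) :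
    state R :=
  State (nth 0 [:: n]) (@no_weights R) (fun=> 0) (adj_matrix G).

(* Between operations only the memory survives; the registers are reinitialised
   with the arguments of the call. *)
Definition insert_input (R : realDomainType) (n : nat) (s : state R)
    (a b : 'I_n) (w : R) : state R :=
  State (nth 0 [:: n; val a; val b]) [eta @no_weights R with 0 |-> w%:E]
        (imem s) (wmem s).

Definition query_input (R : realDomainType) (n : nat) (s : state R)
    (u v a b : 'I_n) : state R :=
  State (nth 0 [:: n; val u; val v; val a; val b]) (@no_weights R)
        (imem s) (wmem s).

(** * Incremental distance sensitivity oracles *)

Record oracle_code := OracleCode {
  build_code : cmd;
  insert_code : cmd;
  query_code : cmd }.

Inductive operation (R : realDomainType) (n : nat) : Type :=
| Insert of 'I_n & 'I_n & R
| Query of 'I_n & 'I_n & 'I_n & 'I_n.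

(* From the memory of [s], representing the current graph [G], the oracle correctly
   serves the operations [ops] one by one, within [S] memory cells and with at
   most [tins] (resp. [tqry]) steps for each insertion (resp. query).
   [Query u v a b] is the [u]-[v] query for the failing edge [{a, b}]; it is
   answered in weight register 0.  Operations that do not apply to the current
   graph carry no obligation. *)
Fixpoint serves (R : realDomainType) (n : nat) (P : oracle_code)
    (B S tins tqry : nat) (G : wgraph R n) (s : state R)
    (ops : seq (operation R n)) : Prop :=
  match ops with
  | [::] => True
  | Insert a b w :: ops' =>
      a != b -> ~~ edge G a b -> (0 <= w)%R ->
      exists (s' : state R) (t : nat),
        [/\ exec B S (insert_code P) (insert_input s a b w) s' t,
            t <= tins &
            serves P B S tins tqry (insert_edge G a b w) s' ops']
  | Query u v a b :: ops' =>
      edge G a b ->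
      exists (s' : state R) (t : nat),
        [/\ exec B S (query_code P) (query_input s u v a b) s' t,
            t <= tqry,
            is_dist (delete_edge G a b) u v (wreg s' 0) &
            serves P B S tins tqry G s' ops']
  end.

Definition softO (g f : nat -> nat) : Prop :=
  exists c k n0 : nat,
    forall n, n0 <= n -> f n <= c * g n * trunc_log 2 n ^ k.

(* Main.v *)
Require Import Defs.
From HB Require Import structures.
From mathcomp Require Import all_boot all_order all_algebra.
From mathcomp Require Import constructive_ereal.
From mathcomp Require Import zify ring lra.

Set Implicit Arguments.
Unset Strict Implicit.
Unset Printing Implicit Defensive.

Import Order.TTheory GRing.Theory Num.Theory.



(** For every pair x, y a canonical shortest path is fixed, so that prefixes and reversals of
    canonical paths are canonical. For a segment I of this path let d(x,y,I) be the distance that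
    avoids all edges of I. The oracle does not store d(x,y,I) but any value between the maximum of
    d(x,y,e) over the edges e of I and d(x,y,I) itself ([sandwich]). For a segment of one edge the
    two bounds agree, so the value is exact; for longer segments the slack is what makes updates
    cheap.

    Only polylogarithmically many segments are stored per pair: those left after cutting 2^i - 1
    edges from the front and 2^j - 1 from the back. A value for an arbitrary segment is assembled
    from four stored ones ([sandwich_lookup]): a path that avoids the segment either avoids a stored
    extension of it as well, or meets the extension and may then follow the canonical path up to a
    vertex from which a stored segment starts exactly where it should ([davoid_left],
    [davoid_right]). Two canonical paths from x share exactly a common prefix, so a segment of the
    x-z path acts on the pair x, y only through that prefix, which binary lifting finds
    ([sandwich_query]).

    When an edge {a,b} is inserted, each avoiding distance becomes the minimum of the old one and of
    the two passages through the edge. A canonical path is replaced only on strict improvement,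
    which preserves the coherence of the canonical paths ([update_good]). Each stored value is
    recomputed from six queries to the old tables ([sandwich_not_via], [sandwich_via]), at
    polylogarithmic cost per entry.

    The construction uses the same update. It starts from the system whose paths have no inner
    vertices, that is, single edges; a degenerate insertion with a = b and weight 0 admits a as an
    inner vertex, as in the Floyd-Warshall algorithm. After n such updates all paths of the graph
    are accounted for ([enable_ok]), whence the cubic bound.

    A failing edge that is not in the tree of canonical paths from u leaves the distance from u
    unchanged. Otherwise it is the last edge of the canonical path from u to one of its ends, a
    one-edge segment, and the query is exact ([answer_sound]).

    The algorithms are written in a small language of bounded loops, verified by weakest
    preconditions ([exec_wp]); the time bounds follow from the nesting of the loops
    ([time_poly]). *)

(** * Abstract distance systems and the avoidance of path segments *)

Definition no_edge : rel nat := fun _ _ => false.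

Definition one_edge (a b : nat) : rel nat := fun u v => (u == a) && (v == b).

(* Edge sets are symmetrized on use, so that any relation denotes a set of
   undirected edges. *)
Definition avoids (I : rel nat) (u v : nat) : bool := I u v || I v u.

(** The intended reading: [davoid I x y] is the distance once the edges of [I] are removed,
    [hops x y] the number of edges of the canonical shortest path, and [vert x y k] its vertex at
    position [k]. Values of [hops] and [vert] at unreachable pairs are junk. *)
Record system (R : realDomainType) := System {
  davoid : rel nat -> nat -> nat -> \bar R;
  hops : nat -> nat -> nat;
  vert : nat -> nat -> nat -> nat }.

Notation dist S := (davoid S no_edge).

(** [K] is the set of vertices that paths may pass through, hence the restricted triangle
    inequality. [davoid_split] expresses, without mentioning paths, that an optimal path avoiding
    [J] either also avoids [I] or passes an end of some edge of [I]. The fields on [vert] make the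
    canonical paths closed under prefix and reversal. *)
Record good (R : realDomainType) (K : pred nat) (S : system R) : Prop := Good {
  davoid_refl : forall I x, davoid S I x x = 0%E;
  davoid_ge0 : forall I x y, (0 <= davoid S I x y)%E;
  davoid_sym : forall I x y, davoid S I x y = davoid S I y x;
  davoid_mono : forall I J x y,
    (forall u v, avoids I u v -> avoids J u v) ->
    (davoid S I x y <= davoid S J x y)%E;
  davoid_tri : forall I x u y, K u ->
    (davoid S I x y <= davoid S I x u + davoid S I u y)%E;
  davoid_split : forall I J x y,
    (davoid S I x y <= davoid S J x y)%E \/
    exists u v, [/\ avoids I u v, ~~ avoids J u v &
      (davoid S J x u + davoid S J u y <= davoid S J x y)%E];
  hops_refl : forall x, hops S x x = 0;
  hops_sym : forall x y, (dist S x y < +oo)%E -> hops S y x = hops S x y;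
  vert0 : forall x y, (dist S x y < +oo)%E -> vert S x y 0 = x;
  vert_sym : forall x y k, (dist S x y < +oo)%E -> k <= hops S x y ->
    vert S y x k = vert S x y (hops S x y - k);
  vert_prefix : forall x y j, (dist S x y < +oo)%E -> j <= hops S x y ->
    [/\ dist S x y = (dist S x (vert S x y j) + dist S (vert S x y j) y)%E,
        hops S x (vert S x y j) = j &
        forall k, k <= j -> vert S x (vert S x y j) k = vert S x y k];
  vert_inner : forall x y k, (dist S x y < +oo)%E -> 0 < k < hops S x y ->
    K (vert S x y k);
  davoid_path : forall I x y, (dist S x y < +oo)%E ->
    (forall k, k < hops S x y ->
       ~~ avoids I (vert S x y k) (vert S x y k.+1)) ->
    (davoid S I x y <= dist S x y)%E }.

Definition segment (R : realDomainType) (S : system R) (x y i j : nat) :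
    rel nat :=
  fun u v => has (fun k => (vert S x y k == u) && (vert S x y k.+1 == v))
                 (iota i (j - i)).

(** The relaxed meaning of a stored value: at least what the failure of any one edge of [I] costs,
    at most what the failure of all of [I] costs. It determines the value when [I] is a single edge,
    and it passes to sums and minima. *)
Definition sandwich (R : realDomainType) (S : system R) (x y : nat)
    (I : rel nat) (w : \bar R) : Prop :=
  [/\ (dist S x y <= w)%E,
      (forall u v, avoids I u v -> (davoid S (one_edge u v) x y <= w)%E) &
      (w <= davoid S I x y)%E].

Ltac ereal_atom :=
  match goal with
  | H : good _ ?S |- context [davoid ?S ?I ?x ?y] =>
      move: (davoid_ge0 H I x y); case: (davoid S I x y) => [?| |] //=
  end.

Ltac ereal_prep :=
  repeat match goal with
  | H : is_true (_ <= _)%E |- _ => move: H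
  | H : is_true (_ < _)%E |- _ => move: H
  | H : @eq (\bar _) _ _ |- _ =>
      let H1 := fresh in let H2 := fresh in
      move/eqP: H; rewrite eq_le => /andP[H1 H2]; move: H1 H2
  end; rewrite ?adde0 ?add0e ?ltNge.

Ltac ereal_end :=
  rewrite -?EFinD ?lee_fin -?ltNge ?lte_fin ?leey;
  try done; try lra.

(** Splits each distance into its finite and infinite cases, nonnegativity excluding minus infinity,
    so that linear arithmetic remains. *)
Ltac ereal := ereal_prep; repeat ereal_atom; ereal_end.

Section Good.
Variables (R : realDomainType) (K : pred nat) (S : system R).
Hypothesis G : good K S.
Notation F := (davoid S).
Notation D := (dist S).
Notation h := (hops S).
Notation p := (vert S).
Notation reach x y := (D x y < +oo)%E.

Lemma davoid_ext I J x y :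
  (forall u v, avoids I u v = avoids J u v) -> F I x y = F J x y.
Proof.
move=> e; apply/eqP; rewrite eq_le !(davoid_mono G) // => u v; by rewrite e.
Qed.

Lemma dist_le I x y : (D x y <= F I x y)%E.
Proof. exact: (davoid_mono G). Qed.

Lemma reach_sym x y : reach x y -> reach y x.
Proof. by rewrite (davoid_sym G). Qed.

Lemma vert_hops x y : reach x y -> p x y (h x y) = y.
Proof.
move=> r; have := vert_sym G r (leqnn _).
rewrite subnn (vert0 G r) => e.
have := vert_sym G (reach_sym r) (leqnn _).
by rewrite subnn (vert0 G (reach_sym r)) (hops_sym G r).
Qed.

Lemma reach_prefix x y j : reach x y -> j <= h x y ->
  reach x (p x y j) /\ reach (p x y j) y.
Proof.
move=> r le_j; have [e _ _] := vert_prefix G r le_j.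
by split; move: r; rewrite e; ereal.
Qed.

(** Suffixes are prefixes of the reversed path. *)
Lemma vert_suffix x y j : reach x y -> j <= h x y ->
  h (p x y j) y = h x y - j /\
  forall k, k <= h x y - j -> p (p x y j) y k = p x y (j + k).
Proof.
move=> r le_j; have r' := reach_sym r; have hs := hops_sym G r.
have [r1 r2] := reach_prefix r le_j.
have ej : p y x (h x y - j) = p x y j.
  by rewrite (vert_sym G r) ?leq_subr // subKn.
have le' : h x y - j <= h y x by rewrite hs leq_subr.
have [_ eh ek] := vert_prefix G r' le'; rewrite ej in eh ek.
have hE : h (p x y j) y = h x y - j by rewrite -eh (hops_sym G (reach_sym r2)).
split=> // k le_k.
rewrite (vert_sym G (reach_sym r2)) eh // ek ?leq_subr //.
rewrite (vert_sym G r); last by rewrite (leq_trans (leq_subr _ _)) ?leq_subr.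
by congr (p x y _); lia.
Qed.

Lemma vert_inj x y i j : reach x y -> i <= h x y -> j <= h x y ->
  p x y i = p x y j -> i = j.
Proof.
move=> r li lj e; have [_ <- _] := vert_prefix G r li.
by rewrite e; have [_ -> _] := vert_prefix G r lj.
Qed.

Lemma vert_sub x y s t : reach x y -> s <= t <= h x y ->
  [/\ reach (p x y s) (p x y t), h (p x y s) (p x y t) = t - s,
      D x y = (D x (p x y s) + D (p x y s) (p x y t) + D (p x y t) y)%E &
      forall k, k <= t - s -> p (p x y s) (p x y t) k = p x y (s + k)].
Proof.
move=> r /andP[le_st le_t].
have [e1 h1 p1] := vert_prefix G r le_t.
have [r1 r2] := reach_prefix r le_t.
have le_s : s <= h x (p x y t) by rewrite h1.
have [e2 h2 p2] := vert_prefix G r1 le_s.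
have [h3 p3] := vert_suffix r1 le_s; have [r3 r4] := reach_prefix r1 le_s.
rewrite p1 // in e2 h2 p2 h3 p3 r3 r4; rewrite h1 in h3 p3.
split=> //; first by rewrite e1 e2.
by move=> k le_k; rewrite p3 // p1 //; lia.
Qed.

(** The ends [x] and [y] need not lie in [K], but there the inequality is trivial; inner vertices do
    lie in [K]. *)
Lemma tri_path I x y k : reach x y -> k <= h x y ->
  (F I x y <= F I x (p x y k) + F I (p x y k) y)%E.
Proof.
move=> r le_k; have [-> |k0] := posnP k.
  by rewrite (vert0 G r) (davoid_refl G) add0r.
move: le_k; rewrite leq_eqVlt => /predU1P[-> |lt_k].
  by rewrite (vert_hops r) (davoid_refl G) addr0.
by apply: (davoid_tri G); apply: (vert_inner G r); rewrite k0.
Qed.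

Lemma segmentP x y i j u v :
  reflect (exists2 k, i <= k < j & u = p x y k /\ v = p x y k.+1)
          (segment S x y i j u v).
Proof.
apply: (iffP hasP) => [[k]|[k lk [-> ->]]].
  rewrite mem_iota => lk /andP[/eqP <- /eqP <-]; exists k => //; lia.
by exists k; rewrite ?eqxx // mem_iota; lia.
Qed.

Lemma avoids_segmentP x y i j u v :
  reflect (exists2 k, i <= k < j &
             (u = p x y k /\ v = p x y k.+1) \/
             (v = p x y k /\ u = p x y k.+1))
          (avoids (segment S x y i j) u v).
Proof.
apply: (iffP orP) => [[]/segmentP[k lk e]|[k lk []e]].
- by exists k => //; left.
- by exists k => //; right.
- by left; apply/segmentP; exists k.
- by right; apply/segmentP; exists k.
Qed.

Lemma avoids_segment_sym x y i j u v : reach x y -> i <= j <= h x y ->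
  avoids (segment S y x (h x y - j) (h x y - i)) u v =
  avoids (segment S x y i j) u v.
Proof.
move=> r lij; apply/avoids_segmentP/avoids_segmentP => -[k lk e];
  exists (h x y - k.+1); try lia.
- move: e; rewrite !(vert_sym G r); try lia.
  have -> : (h x y - k.+1).+1 = h x y - k by lia.
  by case=> e; [right|left]; case: e => -> ->.
- move: e; rewrite !(vert_sym G r); try lia.
  have -> : h x y - (h x y - k.+1) = k.+1 by lia.
  have -> : h x y - (h x y - k.+1).+1 = k by lia.
  by case=> e; [right|left]; case: e => -> ->.
Qed.

Lemma avoids_segment_sub x y s t i j u v : reach x y -> s <= t <= h x y ->
  i <= j <= t - s ->
  avoids (segment S (p x y s) (p x y t) i j) u v =
  avoids (segment S x y (s + i) (s + j)) u v.
Proof.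
move=> r lst lij; have [_ _ _ ek] := vert_sub r lst.
apply/avoids_segmentP/avoids_segmentP => -[k lk e].
- exists (s + k); first lia.
  by move: e; rewrite !ek ?addnS //; lia.
- exists (k - s); first lia.
  rewrite !ek; try lia.
  have -> : s + (k - s) = k by lia.
  by have -> : s + (k - s).+1 = k.+1 by lia.
Qed.

Lemma avoids_segment_mono x y i j i' j' u v : i' <= i -> j <= j' ->
  avoids (segment S x y i j) u v -> avoids (segment S x y i' j') u v.
Proof.
move=> li lj /avoids_segmentP[k lk e]; apply/avoids_segmentP.
by exists k => //; lia.
Qed.

Lemma davoid_free I x y : reach x y ->
  (forall k, k < h x y -> ~~ avoids I (p x y k) (p x y k.+1)) ->
  F I x y = D x y.
Proof.
by move=> r H; apply/eqP; rewrite eq_le dist_le (davoid_path G) ?r.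
Qed.

Lemma davoid_one_edge I u v x y : avoids I u v ->
  (F (one_edge u v) x y <= F I x y)%E.
Proof.
move=> Iuv; apply: (davoid_mono G) => s t /orP[]/andP[/eqP -> /eqP ->] //.
by rewrite /avoids orbC.
Qed.

(* An avoiding path leaves the prefix of [P x y] for good at some vertex; if
   that vertex is beyond position [s], it may as well follow [P x y] up to
   there. *)
Lemma davoid_left x y s i k1 k2 : reach x y -> s <= i -> i <= k1 -> k1 <= k2 ->
  k2 <= h x y ->
  (F (segment S x y i k2) x y <= F (segment S x y k1 k2) x y)%E \/
  (D x (p x y s) + F (segment S x y k1 k2) (p x y s) y
     <= F (segment S x y k1 k2) x y)%E.
Proof.
move=> r l0 l1 l2 l3; set J := segment S x y k1 k2.
have [|[u [v [/avoids_segmentP[k lk e] nJ H]]]] :=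
  davoid_split G (segment S x y i k2) J x y; first by left.
right.
(* The edge used lies in the larger segment but not in [J], hence before position [k1]; whichever
   end [u] is, its position is between [s] and [k1]. *)
have [k' lk' eu] : exists2 k', s <= k' <= k1 & u = p x y k'.
  have lk1 : k < k1.
    rewrite ltnNge; apply/negP => le_k.
    by move/negP: nJ; apply; apply/avoids_segmentP; exists k => //; lia.
  by case: e => [[-> _]|[_ ->]]; [exists k|exists k.+1] => //; lia.
have lsk : s <= k' <= h x y by lia.
have [rk hk dk vk] := vert_sub r lsk.
have ls : s <= h x y by lia.
have [ds _ _] := vert_prefix G r ls.
have [hs ps] := vert_suffix r ls; have [rs1 rs2] := reach_prefix r ls.
have lks : k' - s <= h (p x y s) y by rewrite hs; lia.
have := tri_path J rs2 lks.
have -> : p (p x y s) y (k' - s) = u.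
  by rewrite ps ?eu; [congr p|]; lia.
(* The canonical stretch from position [s] to [u] ends before [J] begins. *)
have -> : F J (p x y s) u = D (p x y s) u.
  rewrite eu; apply: davoid_free => // m; rewrite hk => lm.
  rewrite !vk; try lia; apply/avoids_segmentP => -[m' lm' []] [].
    move=> /(vert_inj r) e1 _; have := e1 _ _; lia.
  move=> /(vert_inj r) e1 /(vert_inj r) e2; have := e1 _ _; have := e2 _ _; lia.
have lk0 : k' <= h x y by lia.
have [dk0 hk0 pk0] := vert_prefix G r lk0.
have [rk1 rk2] := reach_prefix r lk0.
have lsu : s <= h x (p x y k') by rewrite hk0; lia.
have [dsu _ _] := vert_prefix G rk1 lsu.
rewrite pk0 in dsu; last by lia.
rewrite -eu in dsu.
have := dist_le J x u.
rewrite dsu; move=> H1 H2.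
apply: le_trans H; apply: le_trans (leeD2r _ H1); rewrite -addeA leeD2l //.
Qed.

(** The mirror image of [davoid_left], through the reversed path. *)
Lemma davoid_right x y t j k1 k2 : reach x y -> k1 <= k2 -> k2 <= j -> j <= t ->
  t <= h x y ->
  (F (segment S x y k1 j) x y <= F (segment S x y k1 k2) x y)%E \/
  (F (segment S x y k1 k2) x (p x y t) + D (p x y t) y
     <= F (segment S x y k1 k2) x y)%E.
Proof.
move=> r l1 l2 l3 l4; have r' := reach_sym r; have hs := hops_sym G r.
have e a b : a <= b <= h x y ->
    F (segment S y x (h x y - b) (h x y - a)) =2 F (segment S x y a b).
  by move=> lab u v; apply: davoid_ext => z1 z2; rewrite avoids_segment_sym.
have [||||| |] := @davoid_left y x (h x y - t) (h x y - j) (h x y - k2)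
  (h x y - k1); rewrite ?hs //; try lia.
  by rewrite !e; try lia; rewrite !(davoid_sym G _ y x); left.
rewrite (vert_sym G r) ?leq_subr // subKn // !e; try lia.
rewrite addeC !(davoid_sym G _ y) (davoid_sym G _ (p x y t) x).
by right.
Qed.

End Good.


Ltac nlia :=
  repeat match goal with
  | H : is_true (_ <= _)%E |- _ => clear H
  | H : is_true (_ < _)%E |- _ => clear H
  | H : @eq (\bar _) _ _ |- _ => clear H
  | H : forall _, _ |- _ => clear H
  | H : _ \/ _ |- _ => clear H
  | H : is_true (avoids _ _ _) |- _ => clear H
  end; lia.

Definition log2 (k : nat) : nat := trunc_log 2 k.

(** * The stored tables and how a segment query is answered from them *)

Lemma log2P k : 0 < k -> 2 ^ log2 k <= k < 2 * 2 ^ log2 k.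
Proof. by move=> k0; rewrite -expnS; apply: (trunc_log_bounds (ltnSn 1) k0). Qed.

Record store (R : realDomainType) := Store {
  dst : nat -> nat -> \bar R;
  hop : nat -> nat -> nat;
  par : nat -> nat -> nat;
  ent : nat -> nat -> nat -> nat -> \bar R }.

Section Lookup.
Variables (R : realDomainType) (l : nat) (M : store R).

Definition anc (x y k : nat) : nat := iter k (par M x) y.

Definition at_pos (x y k : nat) : nat := anc x y (hop M x y - k).

(** Binary search, by steps of decreasing powers of two, for the last position at which the
    canonical paths from [x] to [y] and to [z] agree. *)
Fixpoint depth_rec (x y z i c : nat) : nat :=
  if i is i'.+1 then
    depth_rec x y z i'
      (if [&& c + 2 ^ i' <= hop M x y, c + 2 ^ i' <= hop M x z &
              at_pos x y (c + 2 ^ i') == at_pos x z (c + 2 ^ i')]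
       then c + 2 ^ i' else c)
  else c.

Definition depth (x y z : nat) : nat := depth_rec x y z l 0.

(** An overlapping cover, as in sparse tables. The exponent [i] satisfies 2^i <= k1 + 1 < 2^(i+1):
    the entry from [x] cuts at most [k1] edges, while the one from [x'] starts its segment exactly
    at [k1]. The exponent [j] and [y'] do the same at the other end. *)
Definition lookup (x y k1 k2 : nat) : \bar R :=
  let i := log2 k1.+1 in
  let j := log2 (hop M x y - k2).+1 in
  let x' := at_pos x y (k1.+1 - 2 ^ i) in
  let y' := at_pos x y (k2 + 2 ^ j).-1 in
  Order.min (Order.min (ent M x y i j) (dst M x x' + ent M x' y i j)%E)
            (Order.min (ent M x y' i j) (dst M x x' + ent M x' y' i j)%E
             + dst M y' y)%E.

(** The failing segment lies on the [x]-[z] path, not on the [x]-[y] path; [c] cuts it to the prefix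
    that the two paths share. *)
Definition query (x y k1 z k2 : nat) : \bar R :=
  let c := minn (depth x y z) k2 in
  if (c <= k1) || (+oo <= dst M x y)%E then dst M x y else lookup x y k1 c.

End Lookup.

Definition trimmed (R : realDomainType) (S : system R) (x y i j : nat) :
    rel nat :=
  segment S x y (2 ^ i).-1 (hops S x y - (2 ^ j).-1).

(** An unreachable vertex is its own parent, so that a parent different from the vertex certifies
    reachability. *)
Record sound (R : realDomainType) (l : nat) (S : system R) (M : store R) :
    Prop := Sound {
  dst_sound : forall x y, dst M x y = dist S x y;
  hop_sound : forall x y, hop M x y = hops S x y;
  hop_small : forall x y, (dist S x y < +oo)%E -> hops S x y < 2 ^ l;
  par_sound : forall x y, (dist S x y < +oo)%E ->
    par M x y = vert S x y (hops S x y).-1;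
  par_unreachable : forall x y, dist S x y = +oo%E -> par M x y = y;
  ent_sound : forall x y i j, (dist S x y < +oo)%E -> i < l -> j < l ->
    (2 ^ i).-1 + (2 ^ j).-1 < hops S x y ->
    sandwich S x y (trimmed S x y i j) (ent M x y i j) }.

Section Sound.
Variables (R : realDomainType) (K : pred nat) (S : system R).
Variables (l : nat) (M : store R).
Hypotheses (G : good K S) (Z : sound l S M).
Notation F := (davoid S).
Notation D := (dist S).
Notation h := (hops S).
Notation p := (vert S).
Notation reach x y := (D x y < +oo)%E.

Lemma ancE x y k : reach x y -> k <= h x y -> anc M x y k = p x y (h x y - k).
Proof.
move=> r; elim: k => [|k IH] lk; first by rewrite subn0 (vert_hops G r).
rewrite /anc iterS -/(anc M x y k) IH 1?ltnW //.
have lk' : h x y - k <= h x y by nlia.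
have [r1 _] := reach_prefix G r lk'; have [_ e1 e2] := vert_prefix G r lk'.
by rewrite (par_sound Z r1) e1 e2; [congr p|]; nlia.
Qed.

Lemma at_posE x y k : reach x y -> k <= h x y -> at_pos M x y k = p x y k.
Proof.
by move=> r lk; rewrite /at_pos (hop_sound Z) ancE ?leq_subr // subKn.
Qed.

(** Lower bounds hold for each of the four candidates, because every stored segment contains the
    requested one and the connecting pieces lie outside it. For the upper bound it suffices that one
    candidate is small, and the left and right dichotomies select it. *)
Lemma sandwich_lookup x y k1 k2 : reach x y -> k1 < k2 -> k2 <= h x y ->
  sandwich S x y (segment S x y k1 k2) (lookup M x y k1 k2).
Proof.
move=> r l1 l2; rewrite /lookup (hop_sound Z).
have hl := hop_small Z r.
set i := log2 _; set j := log2 (_ - _).+1.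
have /andP[i1 i2] : 2 ^ i <= k1.+1 < 2 * 2 ^ i by apply: log2P.
have /andP[j1 j2] : 2 ^ j <= (h x y - k2).+1 < 2 * 2 ^ j by apply: log2P.
have pi0 : 0 < 2 ^ i by rewrite expn_gt0.
have pj0 : 0 < 2 ^ j by rewrite expn_gt0.
have li : i < l by rewrite -(ltn_exp2l _ _ (ltnSn 1)); nlia.
have lj : j < l by rewrite -(ltn_exp2l _ _ (ltnSn 1)); nlia.
set s := k1.+1 - 2 ^ i; set t := (k2 + 2 ^ j).-1.
rewrite !at_posE //; try by rewrite /s /t; nlia.
set I := segment _ _ _ _ _; set x' := p x y s; set y' := p x y t.
rewrite !(dst_sound Z).
have trim s' t' : s' <= s -> t <= t' <= h x y ->
    F (trimmed S (p x y s') (p x y t') i j) =2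
    F (segment S x y (s' + (2 ^ i).-1) (t' - (2 ^ j).-1)).
  move=> ls lt u v; apply: (davoid_ext G) => a b.
  have lst : s' <= t' <= h x y by rewrite /s /t in ls lt *; nlia.
  have [_ eh _ _] := vert_sub G r lst.
  rewrite /trimmed (avoids_segment_sub G) // eh; last first.
    by rewrite /s /t in ls lt *; nlia.
  by congr (avoids (segment _ _ _ _ _)); rewrite /s /t in ls lt *; nlia.
have entP s' t' : s' <= s -> t <= t' <= h x y ->
    let e := (D x (p x y s') + ent M (p x y s') (p x y t') i j
               + D (p x y t') y)%E in
    [/\ (D x y <= e)%E,
        (forall u v, avoids I u v -> (F (one_edge u v) x y <= e)%E) &
        (ent M (p x y s') (p x y t') i j <=
         F (segment S x y (s' + (2 ^ i).-1) (t' - (2 ^ j).-1))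
           (p x y s') (p x y t'))%E].
  move=> ls lt /=.
  have lst : s' <= t' <= h x y by rewrite /s /t in ls lt *; nlia.
  have [rr eh ed ev] := vert_sub G r lst.
  have lij : (2 ^ i).-1 + (2 ^ j).-1 < h (p x y s') (p x y t').
    by rewrite eh /s /t in ls lt *; nlia.
  have [b1 b2 b3] := ent_sound Z rr li lj lij.
  split.
  - by rewrite ed leeD // leeD.
  - move=> u v Iuv.
    have Iuv' : avoids (trimmed S (p x y s') (p x y t') i j) u v.
      rewrite /trimmed (avoids_segment_sub G) // ?eh; last first.
        by rewrite /s /t in ls lt *; nlia.
      by move: Iuv; apply: avoids_segment_mono; rewrite /s /t in ls lt *; nlia.
    have := b2 _ _ Iuv'.
    have les : s' <= h x y by nlia.
    have let' : t' <= h x y by nlia.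
    have [rs _] := reach_prefix G r les.
    have [_ rt] := reach_prefix G r let'.
    have lst' : t' - s' <= h (p x y s') y.
      by have [-> _] := vert_suffix G r les; nlia.
    have [_ rsy] := reach_prefix G r les.
    have t1 := tri_path G (one_edge u v) r les.
    have t2 := tri_path G (one_edge u v) rsy lst'.
    have [_ psy] := vert_suffix G r les.
    rewrite psy in t2; last by nlia.
    rewrite subnKC in t2; last by nlia.
    have [k lk ek] := avoids_segmentP _ _ _ _ _ _ _ Iuv.
    have [_ hs ps] := vert_prefix G r les.
    have [ht pt] := vert_suffix G r let'.
    (* The piece before position [s'] precedes the segment, so the deletion of one of its edges
       leaves that piece intact; likewise below for the piece after [t']. *)
    rewrite (davoid_free G rs) in t1; last first.
      move=> m; rewrite hs => lm; rewrite !ps; try nlia.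
      apply/negP => /orP[]/andP[/eqP e1 /eqP e2]; rewrite -?e1 -?e2 in ek;
      by case: ek => -[/(vert_inj G r) q1 /(vert_inj G r) q2];
        have := q1 _ _; have := q2 _ _; rewrite /s /t in ls lt *; nlia.
    rewrite (davoid_free G rt) in t2; last first.
      move=> m; rewrite ht => lm; rewrite !pt; try nlia.
      apply/negP => /orP[]/andP[/eqP e1 /eqP e2]; rewrite -?e1 -?e2 in ek;
      by case: ek => -[/(vert_inj G r) q1 /(vert_inj G r) q2];
        have := q1 _ _; have := q2 _ _; rewrite /s /t in ls lt *; nlia.
    move=> b4; apply: le_trans t1 _; rewrite -addeA leeD2l //.
    by apply: le_trans t2 _; rewrite leeD2r.
  - by rewrite -trim.
have ls : s <= h x y by rewrite /s; nlia.
have lt : t <= h x y by rewrite /t; nlia.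
have [] := entP 0 (h x y) isT; first by rewrite lt leqnn.
rewrite (vert0 G r) (vert_hops G r) !(davoid_refl G) add0e adde0 add0n.
move=> a1 a2 a3.
have [] := entP s (h x y) (leqnn _); first by rewrite lt leqnn.
rewrite (vert_hops G r) !(davoid_refl G) adde0 -/x' => b1 b2 b3.
have [] := entP 0 t isT; first by rewrite lt leqnn.
rewrite (vert0 G r) !(davoid_refl G) add0e -/y' => c1 c2 c3.
have [] := entP s t (leqnn _); first by rewrite lt leqnn.
rewrite -/x' -/y' => d1 d2 d3.
have minD (u v w : \bar R) :
    (Order.min u v + w = Order.min (u + w) (v + w))%E.
  case: (leP u v) => uv; case: (leP (u + w)%E (v + w)%E) => // uvw; apply/eqP.
    by rewrite eq_le leeD2r //= ltW.
  by rewrite eq_le uvw leeD2r // ltW.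
rewrite minD; split.
- by rewrite !le_min a1 b1 c1 d1.
- by move=> u v Iuv; rewrite !le_min a2 ?b2 ?c2 ?d2.
(* Since k1 + 1 < 2^(i+1), the position of [x'] is at most 2^i - 1, as [davoid_left] demands: an
   optimal path avoids the extended segment too, or may be taken through [x']. *)
have [] : (F (segment S x y (2 ^ i).-1 k2) x y <= F I x y)%E \/
  (D x x' + F I x' y <= F I x y)%E.
- by apply: (davoid_left G) => //; rewrite /s; nlia.
- have [] : (F (segment S x y (2 ^ i).-1 (h x y - (2 ^ j).-1)) x y
     <= F (segment S x y (2 ^ i).-1 k2) x y)%E \/
    (F (segment S x y (2 ^ i).-1 k2) x y' + D y' y
     <= F (segment S x y (2 ^ i).-1 k2) x y)%E.
  + by apply: (davoid_right G) => //; rewrite /t; nlia.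
  + by move=> H1 H2; rewrite !ge_min (le_trans a3 (le_trans H1 H2)).
  + move=> H1 H2; rewrite !ge_min; apply/orP; right; apply/orP; left.
    apply: le_trans (le_trans H1 H2); rewrite leeD2r //; rewrite add0n in c3.
    by have -> : k2 = t - (2 ^ j).-1 by rewrite /t; nlia.
- have [_ rx] := reach_prefix G r ls; have [hx px] := vert_suffix G r ls.
  have ey : y' = p x' y (t - s) by rewrite px ?subnKC // /s /t; nlia.
  have FI a b : a <= b -> s + a <= s + b <= h x y ->
      F (segment S x' y a b) =2 F (segment S x y (s + a) (s + b)).
    move=> lab lsab u v; apply: (davoid_ext G) => z1 z2.
    rewrite -{1}(vert_hops G r) (avoids_segment_sub G) //; first by rewrite ls leqnn.
    nlia.
  have eI : F I =2 F (segment S x' y (k1 - s) (k2 - s)).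
    by move=> u v; rewrite FI ?subnKC // /s; nlia.
  rewrite !eI => H0.
  have [] : (F (segment S x' y (k1 - s) (h x y - s - (2 ^ j).-1)) x' y
     <= F (segment S x' y (k1 - s) (k2 - s)) x' y)%E \/
    (F (segment S x' y (k1 - s) (k2 - s)) x' (p x' y (t - s)) + D (p x' y (t - s)) y
     <= F (segment S x' y (k1 - s) (k2 - s)) x' y)%E.
  + by apply: (davoid_right G rx); rewrite ?hx /s /t; nlia.
  + move=> H1; rewrite !ge_min; apply/orP; left; apply/orP; right.
    apply: le_trans H0; rewrite leeD2l // (le_trans _ H1) //.
    rewrite FI; try by rewrite /s; nlia.
    have <- : s + (2 ^ i).-1 = s + (k1 - s) by rewrite /s; nlia.
    have <- // : h x y - (2 ^ j).-1 = s + (h x y - s - (2 ^ j).-1).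
    by rewrite /s; nlia.
  + rewrite -ey => H1; rewrite !ge_min; apply/orP; right; apply/orP; right.
    apply: le_trans H0; rewrite -addeA leeD2l // (le_trans _ H1) // leeD2r //.
    rewrite FI; try by rewrite /s; nlia.
    have <- : s + (2 ^ i).-1 = s + (k1 - s) by rewrite /s; nlia.
    have <- // : t - (2 ^ j).-1 = s + (k2 - s).
    by rewrite /s /t; nlia.
Qed.

End Sound.

Section Query.
Variables (R : realDomainType) (K : pred nat) (S : system R).
Variables (l : nat) (M : store R).
Hypotheses (G : good K S) (Z : sound l S M).
Notation F := (davoid S).
Notation D := (dist S).
Notation h := (hops S).
Notation p := (vert S).
Notation reach x y := (D x y < +oo)%E.

(** The canonical paths from [x] form a tree: both prefixes up to the common vertex are the
    canonical path to it. *)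
Lemma vert_common x y z i j : reach x y -> reach x z -> i <= h x y ->
  j <= h x z -> p x y i = p x z j ->
  i = j /\ forall k, k <= i -> p x y k = p x z k.
Proof.
move=> ry rz li lj e.
have [_ h1 p1] := vert_prefix G ry li; have [_ h2 p2] := vert_prefix G rz lj.
have eij : i = j by rewrite -h1 e h2.
split=> // k lk; rewrite -p1 // e p2 //; lia.
Qed.

Lemma depthP x y z : reach x y -> reach x z ->
  let c := depth l M x y z in
  [/\ c <= h x y, c <= h x z, p x y c = p x z c &
      forall k, k <= h x y -> k <= h x z -> p x y k = p x z k -> k <= c].
Proof.
move=> ry rz; pose Q c := [&& c <= h x y, c <= h x z & p x y c == p x z c].
(* Common positions are closed downwards, so the search keeps [c] common and all common positions
   below c + 2^i. *)
suff H i c : Q c -> (forall k, Q k -> k < c + 2 ^ i) ->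
    Q (depth_rec M x y z i c) /\ forall k, Q k -> k <= depth_rec M x y z i c.
  have [||/and3P[q1 q2 /eqP q3] q4] := H l 0.
  - by rewrite /Q !leq0n (vert0 G ry) (vert0 G rz) /=.
  - by move=> k /and3P[lk _ _]; rewrite add0n (leq_ltn_trans lk) // (hop_small Z).
  - split=> // k l1 l2 e; apply: q4; apply/and3P; split=> //; exact/eqP.
elim: i c => [|i IH] c Qc Hc /=.
  by split=> // k /Hc; rewrite addn1 ltnS.
rewrite !(hop_sound Z).
have -> : [&& c + 2 ^ i <= h x y, c + 2 ^ i <= h x z &
     at_pos M x y (c + 2 ^ i) == at_pos M x z (c + 2 ^ i)] = Q (c + 2 ^ i).
  rewrite /Q; case: leqP => //= l1; case: leqP => //= l2.
  by rewrite !(at_posE G Z).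
case: ifP => q; apply: IH => //.
  by move=> k /Hc; rewrite expnS mul2n -addnn addnA.
move=> k /and3P[l1 l2 /eqP e]; rewrite ltnNge; apply/negP => lk.
move/negP: q; apply; apply/and3P; split; try exact: leq_trans lk _.
by apply/eqP; apply: (vert_common ry rz l1 l2 e).2.
Qed.

(** Edges of the segment beyond the common prefix are not on the [x]-[y] path, and their failure
    costs nothing; the others form a segment of the [x]-[y] path itself, for which [lookup] applies.
    Its upper bound carries over because it removes fewer edges. *)
Lemma sandwich_query x y z k1 k2 : reach x z ->
  sandwich S x y (segment S x z k1 (minn k2 (h x z))) (query l M x y k1 z k2).
Proof.
move=> rz; set I := segment _ _ _ _ _; rewrite /query (dst_sound Z).
set c := minn _ k2.
have sw_dist : (forall u v, avoids I u v -> (F (one_edge u v) x y <= D x y)%E) ->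
    sandwich S x y I (D x y).
  by move=> H; split=> //; apply: dist_le G _ _ _.
case: (leP +oo%E (D x y)) => [oo|ry].
  by rewrite orbT; apply: sw_dist => u v _; apply: le_trans oo; rewrite leey.
have [c1 c2 ec cmax] := depthP ry rz.
(* An edge at position [k >= c] that lay on the [x]-[y] path would lengthen the common prefix beyond
   [depth]. *)
have off u v k : k1 <= k < minn k2 (h x z) -> c <= k ->
    (u = p x z k /\ v = p x z k.+1) \/ (v = p x z k /\ u = p x z k.+1) ->
    F (one_edge u v) x y = D x y.
  move=> lk lck e; apply: (davoid_free G) => // m lm; apply/negP => a.
  have {e a} ss : (p x y m = p x z k /\ p x y m.+1 = p x z k.+1) \/
     (p x y m = p x z k.+1 /\ p x y m.+1 = p x z k).
    by move: a e => /orP[]/andP[/eqP -> /eqP ->] []; case=> -> ->; auto.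
  have [e1 e2] : p x y m = p x z k /\ p x y m.+1 = p x z k.+1.
    case: ss => // -[e1 e2].
    have [||q1 _] := vert_common ry rz _ _ e1; try lia.
    have [||q2 _] := vert_common ry rz _ _ e2; lia.
  have [||q1 _] := vert_common ry rz _ _ e1; try lia.
  have : m.+1 <= depth l M x y z.
    by apply: cmax; rewrite ?e2 ?q1 //; lia.
  by rewrite /c in lck; lia.
case: leqP => [lc|lc] /=.
  apply: sw_dist => u v /avoids_segmentP[k lk e].
  by rewrite (off u v k) //; lia.
have lcy : c <= h x y by rewrite /c; lia.
have [b1 b2 b3] := sandwich_lookup G Z ry lc lcy.
have pc k : k <= c -> p x y k = p x z k.
  by move=> lk; apply: (vert_common ry rz c1 c2 ec).2; rewrite /c in lk; lia.
split=> //.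
  move=> u v /avoids_segmentP[k lk e]; have [le_ck|lt_kc] := leqP c k.
    by rewrite (off u v k).
  apply: b2; apply/avoids_segmentP; exists k; first lia.
  by rewrite !pc // ltnW.
apply: le_trans b3 _; apply: (davoid_mono G) => u v /avoids_segmentP[k lk e].
apply/avoids_segmentP; exists k; first by rewrite /c in lk lcy *; lia.
by rewrite -!pc //; lia.
Qed.

End Query.

(** * Edge insertion, and the admission of an inner vertex, on distance systems *)

Section UpdateDef.
Variables (R : realDomainType) (S : system R) (a b : nat) (w : R).

(** The cost of crossing the new edge when [I] is removed; with [a = b] there is no edge to
    remove. *)
Definition link (I : rel nat) : \bar R :=
  if (a != b) && avoids I a b then +oo%E else w%:E.

(** The inequality is strict: ties keep the old canonical path, and this keeps the canonical paths
    coherent. *)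
Definition via (x y : nat) : bool :=
  (dist S x a + w%:E + dist S b y < dist S x y)%E.

End UpdateDef.

Section Update.
Variables (R : realDomainType) (S : system R) (a b : nat) (w : R).

(** A new optimal path crosses the new edge at most once, in one of two directions. The summand
    [(a != b)] counts the crossing as a hop, except in the degenerate case, where the two halves are
    glued at [a]. *)
Definition update : system R := System
  (fun I x y => Order.min (davoid S I x y)
     (Order.min (davoid S I x a + link a b w I + davoid S I b y)%E
                (davoid S I x b + link a b w I + davoid S I a y)%E))
  (fun x y =>
     if via S a b w x y then hops S x a + (a != b) + hops S b y
     else if via S b a w x y then hops S x b + (a != b) + hops S a y
     else hops S x y)
  (fun x y k =>
     if via S a b w x y then
       if k <= hops S x a then vert S x a k
       else vert S b y (k - hops S x a - (a != b))
     else if via S b a w x y then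
       if k <= hops S x b then vert S x b k
       else vert S a y (k - hops S x b - (a != b))
     else vert S x y k).

(* Either a new edge joins two vertices that may be passed through, or [a = b]
   becomes such a vertex. *)
Record updatable (K : pred nat) : Prop := Updatable {
  upd_ge0 : (0 <= w)%R;
  upd_eq : a = b -> w = 0%R;
  upd_inner : a <> b -> K a /\ K b;
  upd_fresh : a <> b -> forall x y k, (dist S x y < +oo)%E -> k < hops S x y ->
    ~~ avoids (one_edge a b) (vert S x y k) (vert S x y k.+1) }.

End Update.

Lemma updatable_sym (R : realDomainType) (S : system R) a b w K :
  updatable S a b w K -> updatable S b a w K.
Proof.
case=> w0 we wi wf; split=> //; try by auto.
  by move=> ne; have [] := wi (nesym ne).
move=> ne x y k r lk; apply: contra (wf (nesym ne) x y k r lk).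
by rewrite /avoids /one_edge; case/orP => /andP[-> ->]; rewrite ?orbT.
Qed.

Section UpdateFacts.
Variables (R : realDomainType) (K : pred nat) (S : system R).
Variables (a b : nat) (w : R).
Hypotheses (G : good K S) (U : updatable S a b w K).
Notation F := (davoid S).
Notation D := (dist S).
Notation h := (hops S).
Notation p := (vert S).
Notation reach x y := (D x y < +oo)%E.

Lemma via_reach x y : via S a b w x y -> reach x a /\ reach b y.
Proof. by rewrite /via => H; split; ereal. Qed.

Lemma via_sym x y : via S b a w y x = via S a b w x y.
Proof.
rewrite /via (davoid_sym G _ y b) (davoid_sym G _ y x) (davoid_sym G _ a x).
by rewrite addeAC (addeC (D b y)) addeAC.
Qed.

(** Otherwise the old route through [b], which may be passed through, would already match the
    detour. *)
Lemma via_left x y : via S a b w x y -> (D x a + w%:E <= D x b)%E.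
Proof.
rewrite /via; have := upd_ge0 U; have [e|ne] := eqVneq a b.
  by rewrite -e (upd_eq U e) adde0.
have [_ Kb] := upd_inner U (elimN eqP ne).
by have := davoid_tri G no_edge x y Kb => H1 w0 H2; ereal.
Qed.

Lemma via_right x y : via S a b w x y -> (w%:E + D b y <= D a y)%E.
Proof.
rewrite /via; have := upd_ge0 U; have [e|ne] := eqVneq a b.
  by rewrite -e (upd_eq U e) add0e.
have [Ka _] := upd_inner U (elimN eqP ne).
by have := davoid_tri G no_edge x y Ka => H1 w0 H2; ereal.
Qed.

Lemma via_refl x : ~~ via S a b w x x.
Proof.
rewrite /via (davoid_refl G) -leNgt; have := upd_ge0 U => w0; ereal.
Qed.

Lemma via_excl x y : a <> b -> via S a b w x y -> ~~ via S b a w x y.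
Proof.
move=> ne v; have [Ka Kb] := upd_inner U ne; move: v; rewrite /via -leNgt.
have := upd_ge0 U; have := davoid_tri G no_edge x y Kb.
by have := davoid_tri G no_edge x y Ka => H1 H2 w0 H3; ereal.
Qed.

(* Vertices on the first half of a rerouted path. *)
Lemma via_prefix x y j : via S a b w x y -> j <= h x a ->
  [/\ ~~ via S a b w x (p x a j), ~~ via S b a w x (p x a j) &
      (a <> b) \/ j < h x a -> via S a b w (p x a j) y].
Proof.
move=> v lj; have [ra rb] := via_reach v; have w0 := upd_ge0 U.
have [e _ _] := vert_prefix G ra lj; have vl := via_left v.
have [r1 r2] := reach_prefix G ra lj.
have e' := davoid_sym G no_edge (p x a j) a.
move: e vl r1 r2 e'; set q := p x a j => e vl r1 r2 e'.
split.
- by rewrite /via -leNgt; ereal.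
- by rewrite /via -leNgt -e'; ereal.
- move=> jl; have tri : (D x y <= D x q + D q y)%E.
    rewrite /q; move: jl; have [-> _|j0] := posnP j.
      by rewrite (vert0 G ra) (davoid_refl G) add0e.
    move: lj; rewrite leq_eqVlt => /predU1P[-> |lt_j].
      rewrite ltnn (vert_hops G ra) => -[ne|//].
      exact: (davoid_tri G _ _ _ (upd_inner U ne).1).
    by move=> _; apply: (davoid_tri G); apply: (vert_inner G ra); rewrite j0.
  by move: v; rewrite /via => v; ereal.
Qed.

(** A strict gain towards an intermediate vertex would extend along the rest of the path to a strict
    gain towards [y]. *)
Lemma not_via_prefix x y j : ~~ via S a b w x y -> reach x y -> j <= h x y ->
  ~~ via S a b w x (p x y j).
Proof.
rewrite /via -!leNgt => v r lj; have w0 := upd_ge0 U.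
have [-> |j0] := posnP j.
  by rewrite (vert0 G r) (davoid_refl G); ereal.
move: (lj); rewrite leq_eqVlt => /predU1P[-> |lt_j]; first by rewrite (vert_hops G r).
have := davoid_tri G no_edge b y (vert_inner G r (introT andP (conj j0 lt_j))).
have [e _ _] := vert_prefix G r lj; have [r1 r2] := reach_prefix G r lj.
by move: e r1 r2; set q := p x y j => e r1 r2 t; ereal.
Qed.

End UpdateFacts.

Lemma link_swap (R : realDomainType) a b (w : R) I : link b a w I = link a b w I.
Proof. by rewrite /link eq_sym /avoids orbC. Qed.

Lemma link_no_edge (R : realDomainType) a b (w : R) : link a b w no_edge = w%:E.
Proof. by rewrite /link andbF. Qed.

Lemma link_eq (R : realDomainType) a (w : R) I : link a a w I = w%:E.
Proof. by rewrite /link eqxx. Qed.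

Lemma update_cases (R : realDomainType) (S : system R) a b w I x y :
  [\/ davoid (update S a b w) I x y = davoid S I x y,
      davoid (update S a b w) I x y =
        (davoid S I x a + link a b w I + davoid S I b y)%E |
      davoid (update S a b w) I x y =
        (davoid S I x b + link a b w I + davoid S I a y)%E].
Proof.
rewrite /= /Order.min; case: ifP => _; first by constructor 1.
by case: ifP => _; [constructor 2|constructor 3].
Qed.

Section UpdateGood.
Variables (R : realDomainType) (K : pred nat) (S : system R).
Variables (a b : nat) (w : R).
Hypotheses (G : good K S) (U : updatable S a b w K).
Notation F := (davoid S).
Notation D := (dist S).
Notation h := (hops S).
Notation p := (vert S).
Notation S' := (update S a b w).
Notation F' := (davoid S').
Notation D' := (dist S').
Notation h' := (hops S').
Notation p' := (vert S').

Lemma link_ge I : (w%:E <= link a b w I)%E.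
Proof. by rewrite /link; case: ifP => //; rewrite leey. Qed.

Lemma link_ge0 I : (0 <= link a b w I)%E.
Proof. by apply: le_trans (link_ge I); rewrite lee_fin (upd_ge0 U). Qed.

Lemma update_le I x y : (F' I x y <= F I x y)%E.
Proof. by rewrite /= ge_min lexx. Qed.

Lemma update_le_ab I x y : (F' I x y <= F I x a + link a b w I + F I b y)%E.
Proof. by rewrite /= !ge_min lexx orbT. Qed.

Lemma update_le_ba I x y : (F' I x y <= F I x b + link a b w I + F I a y)%E.
Proof. by rewrite /= !ge_min lexx !orbT. Qed.

(** By [via_left] and [via_right] the passage in the opposite direction is no shorter. *)
Lemma dist_via x y : via S a b w x y -> D' x y = (D x a + w%:E + D b y)%E.
Proof.
move=> v; have vl := via_left G U v; have vr := via_right G U v.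
have w0 := upd_ge0 U; have := update_le_ab no_edge x y.
rewrite link_no_edge => le; apply/eqP; rewrite eq_le le /= link_no_edge.
move: v; rewrite /via !le_min => v; apply/and3P; split; ereal.
Qed.

Lemma dist_not_via x y : ~~ via S a b w x y -> ~~ via S b a w x y ->
  D' x y = D x y.
Proof.
rewrite /via -!leNgt => v1 v2; apply/eqP; rewrite eq_le update_le /=.
by rewrite link_no_edge !le_min lexx v1 v2.
Qed.

Lemma hops_via x y : via S a b w x y -> h' x y = h x a + (a != b) + h b y.
Proof. by rewrite /= => ->. Qed.

Lemma hops_not_via x y : ~~ via S a b w x y -> ~~ via S b a w x y ->
  h' x y = h x y.
Proof. by rewrite /= => /negbTE -> /negbTE ->. Qed.

Lemma vert_not_via x y : ~~ via S a b w x y -> ~~ via S b a w x y ->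
  p' x y = p x y.
Proof. by rewrite /= => /negbTE -> /negbTE ->. Qed.

Lemma vert_via_left x y k : via S a b w x y -> k <= h x a -> p' x y k = p x a k.
Proof. by rewrite /= => -> ->. Qed.

Lemma vert_via_right x y m : via S a b w x y -> m <= h b y ->
  p' x y (h x a + (a != b) + m) = p b y m.
Proof.
move=> v lm; have [ra rb] := via_reach G v; move: v; rewrite /= => -> /=.
(* The first branch is taken here only when [a = b] and [m = 0]: the junction belongs to both
   halves. *)
case: leqP => [le_k|_]; last by rewrite -addnA addKn addKn.
have [ne|] := boolP (a != b); first by move: le_k; rewrite ne; lia.
rewrite negbK => /eqP e; have -> : m = 0 by lia.
rewrite -e in rb *; rewrite !addn0 (vert_hops G ra).
by rewrite (vert0 G rb).
Qed.

(* The positions of a rerouted path, [h x a] counted in the first case only. *)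
Lemma via_pos x y k : via S a b w x y -> k <= h' x y ->
  k <= h x a \/ exists m, [/\ m <= h b y, k = h x a + (a != b) + m &
                            a <> b \/ 0 < m].
Proof.
move=> v; rewrite hops_via // => lk; case: (leqP k (h x a)); first by left.
move=> lt; right; exists (k - h x a - (a != b)).
by have [e|ne] := eqVneq a b; split; try lia; left; apply/eqP.
Qed.

Lemma via_suffix x y m : via S a b w x y -> m <= h b y ->
  [/\ ~~ via S a b w (p b y m) y, ~~ via S b a w (p b y m) y &
      (a <> b) \/ 0 < m -> via S a b w x (p b y m)].
Proof.
move=> v lm; have [ra rb] := via_reach G v.
have v' : via S b a w y x by rewrite (via_sym a b w G).
have hb := hops_sym G rb.
have lm' : h b y - m <= h y b by rewrite hb leq_subr.
have e : p y b (h b y - m) = p b y m.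
  by rewrite (vert_sym G rb) ?leq_subr // subKn.
have [] := via_prefix G (updatable_sym U) v' lm'; rewrite e => c1 c2 c3.
split; first by rewrite (via_sym b a w G).
  by rewrite (via_sym a b w G).
move=> c; rewrite (via_sym b a w G); apply: c3; rewrite hb.
by case: c => c; [left; apply: nesym|right; lia].
Qed.

(** If the path is cut in its first half, the front pair keeps its old path and the remaining pair
    is rerouted in the same way; in its second half, the roles are exchanged. *)
Lemma vert_prefix_via x y j : via S a b w x y -> j <= h' x y ->
  [/\ D' x y = (D' x (p' x y j) + D' (p' x y j) y)%E,
      h' x (p' x y j) = j &
      forall k, k <= j -> p' x (p' x y j) k = p' x y k].
Proof.
move=> v lj; have [ra rb] := via_reach G v.
have [lja|[m [lm -> cm]]] := via_pos v lj.
  rewrite (vert_via_left v lja); have [n1 n2 v2] := via_prefix G U v lja.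
  have [e1 e2 e3] := vert_prefix G ra lja.
  split.
  - rewrite dist_via // dist_not_via // e1.
    have -> : D' (p x a j) y = (D (p x a j) a + w%:E + D b y)%E.
      have [e|ne] := eqVneq a b; last first.
        by apply: dist_via; apply: v2; left; apply/eqP.
      move: lja v2; rewrite leq_eqVlt => /predU1P[ej _|lt v2]; last first.
        by apply: dist_via; apply: v2; right.
      (* With [a = b] and the cut at [a] itself, the remaining path is the unchanged one from [a],
         since a detour of cost 0 is no strict gain. *)
      have w0 : w%:E = 0%E by rewrite (upd_eq U e).
      rewrite ej (vert_hops G ra) w0 (davoid_refl G) !add0e.
      have -> : D b y = D a y by rewrite e.
      by apply: dist_not_via; rewrite /via w0 -e (davoid_refl G) !add0e ltxx.
    by rewrite !addeA.
  - by rewrite hops_not_via.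
  - move=> k lk; rewrite vert_not_via // e3 // vert_via_left //.
    exact: leq_trans lja.
rewrite vert_via_right //; have [n1 n2 v2] := via_suffix v lm.
have {}v2 := v2 cm; have [e1 e2 e3] := vert_prefix G rb lm.
split.
- by rewrite dist_via // (dist_via v2) dist_not_via // e1 !addeA.
- by rewrite hops_via // e2.
- move=> k lk; have lk2 : k <= h' x (p b y m) by rewrite hops_via // e2.
  have [lka|[m' [lm' ek _]]] := via_pos v2 lk2.
    by rewrite !vert_via_left.
  by rewrite ek !vert_via_right // ?e3 //; lia.
Qed.

Lemma vert_inner_via x y k : via S a b w x y -> 0 < k < h' x y ->
  [pred u | (u == a) || K u] (p' x y k).
Proof.
move=> v /andP[k0 lk]; have [ra rb] := via_reach G v.
have [lka|[m [lm ek cm]]] := via_pos v (ltnW lk).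
  rewrite vert_via_left //; move: lka; rewrite leq_eqVlt => /predU1P[->|lka].
    by rewrite (vert_hops G ra) inE eqxx.
  by rewrite inE (vert_inner G ra) ?orbT // k0.
rewrite ek vert_via_right //; have [m0|m0] := posnP m.
  case: cm; rewrite m0 // => ne; rewrite (vert0 G rb) inE.
  by have [_ ->] := upd_inner U ne; rewrite orbT.
rewrite inE (vert_inner G rb) ?orbT // m0 /=.
by move: lk; rewrite hops_via // ek ltn_add2l.
Qed.

Lemma davoid_path_via I x y : via S a b w x y ->
  (forall k, k < h' x y -> ~~ avoids I (p' x y k) (p' x y k.+1)) ->
  (F' I x y <= D' x y)%E.
Proof.
move=> v; rewrite hops_via // => H; have [ra rb] := via_reach G v.
apply: le_trans (update_le_ab I x y) _; rewrite dist_via //.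
rewrite (davoid_free G ra); last first.
  move=> k lk; have := H k; rewrite !vert_via_left ?(ltnW lk) //; apply; lia.
rewrite (davoid_free G rb); last first.
  move=> m lm; have := H (h x a + (a != b) + m).
  rewrite -addnS !vert_via_right ?(ltnW lm) //; apply; lia.
rewrite /link; case: ifP => // /andP[ne aI].
have lt : h x a < h x a + (a != b) + h b y by rewrite ne; lia.
have := H _ lt; rewrite vert_via_left // (vert_hops G ra) -addn1.
have := @vert_via_right x y 0 v isT; rewrite ne addn0 => ->.
by rewrite (vert0 G rb) aI.
Qed.

(** On the optimal walk through [a] and [b], the first edge of [I] to look for is the new edge
    itself; if [I] spares it, one of the two halves is split by the old system, or both halves also
    avoid [I]. *)
Lemma update_split_ab I J x y :
  F' J x y = (F J x a + link a b w J + F J b y)%E ->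
  (F' I x y <= F' J x y)%E \/
  exists u v, [/\ avoids I u v, ~~ avoids J u v &
      (F' J x u + F' J u y <= F' J x y)%E].
Proof.
move=> ->; have [ne|] := boolP ((a != b) && avoids J a b).
  by left; rewrite [X in (_ <= _ + X + _)%E]/link ne; move: (davoid_ge0 G J x a) (davoid_ge0 G J b y);
   case: (davoid S J x a) => [?| |] //; case: (davoid S J b y) => [?| |] // _ _;
   rewrite leey.
move=> nJ; have lJ : link a b w J = w%:E by rewrite /link (negbTE nJ).
have w0 := upd_ge0 U.
have [/andP[ne aI]|nI] := boolP ((a != b) && avoids I a b).
  right; exists a, b; rewrite aI; split=> //; first by move: nJ; rewrite ne.
  have := update_le J x a; have := update_le_ab J a y.
  rewrite lJ (davoid_refl G) add0e -addeA => H1 H2; exact: leeD.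
have lI : link a b w I = w%:E by rewrite /link (negbTE nI).
have [H1|[u [v [q1 q2 q3]]]] := davoid_split G I J x a; last first.
  right; exists u, v; split=> //.
  have := update_le J x u; have := update_le_ab J u y => H1 H2.
  apply: le_trans (leeD H2 H1) _.
  by rewrite !addeA leeD2r // leeD2r.
have [H2|[u [v [q1 q2 q3]]]] := davoid_split G I J b y; last first.
  right; exists u, v; split=> //.
  have := update_le J u y; have := update_le_ab J x u => H2 H3.
  apply: le_trans (leeD H2 H3) _.
  by rewrite -!addeA !leeD2l.
left; apply: le_trans (update_le_ab I x y) _.
by rewrite lI lJ leeD // leeD2r.
Qed.

Lemma update_ge0 I x y : (0 <= F' I x y)%E.
Proof.
by rewrite !le_min !adde_ge0 ?(davoid_ge0 G) // link_ge0.
Qed.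

Lemma update_tri I x u y : [pred u | (u == a) || K u] u ->
  (F' I x y <= F' I x u + F' I u y)%E.
Proof.
rewrite inE => Ku.
have q1 := update_le I x y; have q2 := update_le_ab I x y.
have q3 := update_le_ba I x y; have L0 := link_ge0 I.
have c1 := update_cases S a b w I x u; have c2 := update_cases S a b w I u y.
move: (F' I x y) (F' I x u) (F' I u y) q1 q2 q3 c1 c2 => f f1 f2 q1 q2 q3 c1 c2.
have [e|ne] := eqVneq a b.
  have L1 : link a b w I = 0%E by rewrite -e link_eq (upd_eq U e).
  rewrite L1 -!e !adde0 in q1 q2 q3 c1 c2; case/orP: Ku => [/eqP eu|Ku].
    rewrite eu (davoid_refl G) !adde0 !add0e in c1 c2.
    have {}c1 : f1 = davoid S I x a by case: c1.
    have {}c2 : f2 = davoid S I a y by case: c2.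
    by rewrite c1 c2.
  have t1 := davoid_tri G I x y Ku; have t2 := davoid_tri G I x a Ku.
  have t3 := davoid_tri G I a y Ku.
  have {}c1 : f1 = F I x u \/ f1 = (F I x a + F I a u)%E by case: c1; auto.
  have {}c2 : f2 = F I u y \/ f2 = (F I u a + F I a y)%E by case: c2; auto.
  case: c1 => ->; case: c2 => ->.
  - exact: le_trans q1 t1.
  - by apply: le_trans q2 _; rewrite addeA leeD2r.
  - by apply: le_trans q2 _; rewrite -addeA leeD2l.
  - apply: le_trans q2 _; clear - G; ereal.
have [Ka Kb] := upd_inner U (elimN eqP ne).
have {}Ku : K u by case/predU1P: Ku => [->|].
move: (link a b w I) L0 q1 q2 q3 c1 c2 => L L0 q1 q2 q3.
case=> ->; case=> ->.
- exact: le_trans q1 (davoid_tri G I x y Ku).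
- apply: le_trans q2 _; rewrite !addeA !leeD2r //; exact: (davoid_tri G _ _ _ Ku).
- apply: le_trans q3 _; rewrite !addeA !leeD2r //; exact: (davoid_tri G _ _ _ Ku).
- apply: le_trans q2 _; rewrite -!addeA !leeD2l //; exact: (davoid_tri G _ _ _ Ku).
- apply: le_trans q2 _; clear - G L0; case: L L0 => [L| |] // L0; ereal.
- apply: le_trans q1 (le_trans (davoid_tri G I x y Ka) _).
  clear - G L0; case: L L0 => [L| |] // L0; ereal.
- apply: le_trans q3 _; rewrite -!addeA !leeD2l //; exact: (davoid_tri G _ _ _ Ku).
- apply: le_trans q1 (le_trans (davoid_tri G I x y Kb) _).
  clear - G L0; case: L L0 => [L| |] // L0; ereal.
- apply: le_trans q3 _; clear - G L0; case: L L0 => [L| |] // L0; ereal.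
Qed.

End UpdateGood.

Lemma davoid_swap (R : realDomainType) (S : system R) a b w I x y :
  davoid (update S b a w) I x y = davoid (update S a b w) I x y.
Proof. by rewrite /= !(link_swap a b) (minC (_ + _ + _)%E). Qed.

Section UpdateGood2.
Variables (R : realDomainType) (K : pred nat) (S : system R).
Variables (a b : nat) (w : R).
Hypotheses (G : good K S) (U : updatable S a b w K).
Notation S' := (update S a b w).
Notation S'' := (update S b a w).

(** By [via_excl] the two directions cannot both gain, so the order in which they are tested is
    immaterial. This reduces reroutings from [b] to [a] to those from [a] to [b]. *)
Lemma hops_swap x y : hops S'' x y = hops S' x y.
Proof.
have [-> //|/eqP ne] := eqVneq a b.
rewrite /= (eq_sym b a).
case v2: (via S b a w x y); case v1: (via S a b w x y) => //.
by rewrite (negbTE (via_excl G U ne v1)) in v2.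
Qed.

Lemma vert_swap x y k : vert S'' x y k = vert S' x y k.
Proof.
have [-> //|/eqP ne] := eqVneq a b.
rewrite /= (eq_sym b a).
case v2: (via S b a w x y); case v1: (via S a b w x y) => //.
by rewrite (negbTE (via_excl G U ne v1)) in v2.
Qed.

Lemma sandwich_swap x y I q : sandwich S'' x y I q -> sandwich S' x y I q.
Proof.
by case=> s1 s2 s3; split=> [|u v /s2|]; rewrite -(davoid_swap S a b w).
Qed.

Lemma hops_sym_via x y : via S a b w x y -> hops S' y x = hops S' x y.
Proof.
move=> v; have [ra rb] := via_reach G v; have v' := v.
rewrite -(via_sym a b w G) in v'; rewrite -hops_swap !hops_via //.
by rewrite (hops_sym G ra) (hops_sym G rb) eq_sym; lia.
Qed.

Lemma vert_sym_via x y k : via S a b w x y -> k <= hops S' x y ->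
  vert S' y x k = vert S' x y (hops S' x y - k).
Proof.
move=> v; rewrite -hops_sym_via // -hops_swap -vert_swap.
have [ra rb] := via_reach G v; have v' := v.
rewrite -(via_sym a b w G) in v' => lk.
have [lkb|[m [lm -> cm]]] := via_pos v' lk.
  rewrite (hops_sym G rb) in lkb.
  rewrite vert_via_left ?(hops_sym G rb) // (vert_sym G rb lkb).
  have := vert_via_right G v (leq_subr k (hops S b y)).
  move=> <-; congr (vert _ _ _ _); rewrite hops_via // (hops_sym G rb).
  by rewrite (hops_sym G ra) eq_sym; lia.
rewrite (hops_sym G ra) in lm.
rewrite (vert_via_right G v') ?(hops_sym G ra) // (vert_sym G ra lm).
rewrite -(vert_via_left v (leq_subr m _)); congr (vert _ _ _ _).
by rewrite hops_via // (hops_sym G ra); lia.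
Qed.

Lemma update_reach x y : (dist S' x y < +oo)%E ->
  [\/ via S a b w x y, via S b a w x y |
    [/\ ~~ via S a b w x y, ~~ via S b a w x y & (dist S x y < +oo)%E]].
Proof.
move=> r; case v1: (via S a b w x y); first by constructor 1.
case v2: (via S b a w x y); first by constructor 2.
by constructor 3; rewrite -(dist_not_via (negbT v1) (negbT v2)).
Qed.

Lemma link_mono I J : (forall u v, avoids I u v -> avoids J u v) ->
  (link a b w I <= link a b w J)%E.
Proof.
move=> IJ; rewrite /link; case: ifP => [/andP[-> /IJ ->] //|_].
by case: ifP => _; rewrite ?leey.
Qed.

End UpdateGood2.

(** For the fields on canonical paths there are three kinds of pairs: rerouted from [a] to [b],
    rerouted from [b] to [a] (by symmetry), and unchanged. For the last kind one needs that prefixes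
    and suffixes are unchanged as well. *)
Lemma update_good (R : realDomainType) (K : pred nat) (S : system R) a b w :
  good K S -> updatable S a b w K ->
  good [pred u | (u == a) || K u] (update S a b w).
Proof.
move=> G U; have U' := updatable_sym U.
have nv x y : ~~ via S a b w x y -> ~~ via S b a w x y ->
    ~~ via S a b w y x /\ ~~ via S b a w y x.
  by move=> v1 v2; rewrite (via_sym a b w G) (via_sym b a w G).
split.
- move=> I x /=; rewrite (davoid_refl G); apply/min_idPl; rewrite le_min.
  by rewrite !adde_ge0 ?(davoid_ge0 G) ?(link_ge0 U).
- exact: (update_ge0 G U).
- move=> I x y; rewrite /= (davoid_sym G I y x) (davoid_sym G I y a).
  rewrite (davoid_sym G I y b) (davoid_sym G I a x) (davoid_sym G I b x).
  congr Order.min; rewrite minC; congr Order.min;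
  by rewrite addeC addeA addeAC.
- move=> I J x y IJ; have lm := link_mono a b w IJ.
  have mono s t : (davoid S I s t <= davoid S J s t)%E by apply: (davoid_mono G).
  rewrite /= !le_min !ge_min; apply/and3P; split; first by rewrite mono.
    by apply/orP; right; apply/orP; left; rewrite !leeD.
  by apply/orP; right; apply/orP; right; rewrite !leeD.
- by move=> I x u y; apply: update_tri.
- move=> I J x y; have [e|e|e] := update_cases S a b w J x y.
  + have [H|[u [v [q1 q2 q3]]]] := davoid_split G I J x y.
      by left; rewrite e; apply: le_trans (update_le _ _ _ _ _ _ _) H.
    right; exists u, v; split=> //; rewrite e; apply: le_trans q3.
    exact: leeD (update_le _ _ _ _ _ _ _) (update_le _ _ _ _ _ _ _).
  + exact: (update_split_ab G U I e).
  + have := @update_split_ab _ _ _ _ _ _ G U' I J x y.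
    rewrite !(davoid_swap S a b w) (link_swap a b w) => /(_ e) [|[u [v [q1 q2 q3]]]]; [by left|].
    by right; exists u, v; rewrite !(davoid_swap S a b w) in q3.
- by move=> x; rewrite hops_not_via ?(hops_refl G) // (via_refl G) // .
- move=> x y /update_reach[v|v|[v1 v2 r]]; first exact: (hops_sym_via G U v).
    by rewrite -!(hops_swap G U) (hops_sym_via G U').
  by have [v3 v4] := nv _ _ v1 v2; rewrite !hops_not_via // (hops_sym G).
- move=> x y /update_reach[v|v|[v1 v2 r]].
  + by rewrite vert_via_left // (vert0 G) //; have [] := via_reach G v.
  + rewrite -(vert_swap G U) vert_via_left // (vert0 G) //.
    by have [] := via_reach G v.
  + by rewrite vert_not_via // (vert0 G).
- move=> x y k /update_reach[v|v|[v1 v2 r]].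
  + exact: (vert_sym_via G U v).
  + by rewrite -!(vert_swap G U) -!(hops_swap G U); apply: (vert_sym_via G U').
  + have [v3 v4] := nv _ _ v1 v2; rewrite hops_not_via // !vert_not_via //.
    exact: (vert_sym G r).
- move=> x y j /update_reach[v|v|[v1 v2 r]].
  + exact: (vert_prefix_via G U v).
  + rewrite -!(hops_swap G U) -!(vert_swap G U) => lj.
    have [q1 q2 q3] := vert_prefix_via G U' v lj.
    rewrite !(davoid_swap S a b w) in q1; split=> // k lk.
    by rewrite -!(vert_swap G U) q3.
  + rewrite hops_not_via // vert_not_via // => lj.
    have [q1 q2 q3] := vert_prefix G r lj.
    have n1 := not_via_prefix G U v1 r lj; have n2 := not_via_prefix G U' v2 r lj.
    rewrite hops_not_via // vert_not_via //; split=> //.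
    rewrite (dist_not_via v1 v2) (dist_not_via n1 n2) dist_not_via //.
      have := not_via_prefix G U' (nv _ _ v1 v2).2 (reach_sym G r).
      have lj' : hops S x y - j <= hops S y x by rewrite (hops_sym G r) leq_subr.
      move=> /(_ _ lj'); rewrite (vert_sym G r) ?leq_subr // subKn //.
      by rewrite (via_sym a b w G).
    have := not_via_prefix G U (nv _ _ v1 v2).1 (reach_sym G r).
    have lj' : hops S x y - j <= hops S y x by rewrite (hops_sym G r) leq_subr.
    move=> /(_ _ lj'); rewrite (vert_sym G r) ?leq_subr // subKn //.
    by rewrite (via_sym b a w G).
- move=> x y k /update_reach[v|v|[v1 v2 r]].
  + exact: (vert_inner_via G U v).
  + rewrite -!(hops_swap G U) -!(vert_swap G U) => lk.
    have := vert_inner_via G U' v lk; rewrite !inE.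
    case/orP => [/eqP ->|->]; last by rewrite orbT.
    have [//|/eqP ne] := eqVneq b a.
    by have [-> _] := upd_inner U' ne; rewrite orbT.
  + rewrite hops_not_via // vert_not_via // => lk.
    by rewrite inE (vert_inner G r lk) orbT.
- move=> I x y /update_reach[v|v|[v1 v2 r]].
  + exact: (davoid_path_via G U v).
  + move=> H; rewrite -!(davoid_swap S a b w); apply: (davoid_path_via G U' v) => k.
    by rewrite (hops_swap G U) !(vert_swap G U) => /H.
  + rewrite hops_not_via // vert_not_via // dist_not_via // => H.
    exact: le_trans (update_le _ _ _ _ _ _ _) (davoid_path G r H).
Qed.

(** * Recomputing the tables from queries to the old ones *)

Section NewStore.
Variables (R : realDomainType) (l : nat) (M : store R) (a b : nat) (w : R).

Definition shortcut (c d x y : nat) : bool :=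
  (dst M x c + w%:E + dst M d y < dst M x y)%E.

Definition improved (x y : nat) : bool := shortcut a b x y || shortcut b a x y.

Definition near_end (x y : nat) : nat :=
  if shortcut a b x y then a else if shortcut b a x y then b else a.

Definition far_end (x y : nat) : nat :=
  if shortcut a b x y then b else if shortcut b a x y then a else b.

Definition new_dst (x y : nat) : \bar R :=
  if improved x y
  then (dst M x (near_end x y) + w%:E + dst M (far_end x y) y)%E
  else dst M x y.

Definition new_hop (x y : nat) : nat :=
  if improved x y
  then hop M x (near_end x y) + (a != b) + hop M (far_end x y) y
  else hop M x y.

Definition new_par (x y : nat) : nat :=
  if improved x y
  then if y == far_end x y then near_end x y else par M (far_end x y) y
  else par M x y.

(** If the path is rerouted through [c] and [d], the trimmed segment splits into a part on the
    [x]-[c] path, seen from [x], a part on the [y]-[d] path, seen from [y], and possibly the new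
    edge, in which case [w1] is infinite. The reverse crossing then cannot help, so [w2] is
    infinite. If the path is unchanged, [zx] and [zy] make both views denote the same whole
    segment. *)
Definition new_ent (x y i j : nat) : \bar R :=
  let c := near_end x y in
  let d := far_end x y in
  let zx := if improved x y then c else y in
  let zy := if improved x y then d else x in
  let k1 := (2 ^ i).-1 in
  let k2 := (2 ^ j).-1 in
  let m1 := new_hop x y - k1 in
  let m2 := new_hop x y - k2 in
  let q x y k z m := query l M x y k z m in
  let w1 := if [&& improved x y, a != b, k1 <= hop M x c & hop M x c < m2]
            then +oo%E else w%:E in
  let w2 := if improved x y then +oo%E else w%:E in
  Order.min (Order.max (q x y k1 zx m2) (q y x k2 zy m1))
    (Order.min (q x c k1 zx m2 + w1 + q y d k2 zy m1)%E
               (q x d k1 zx m2 + w2 + q y c k2 zy m1)%E).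

Definition new_store : store R := Store new_dst new_hop new_par new_ent.

End NewStore.

Lemma sandwich_sym (R : realDomainType) K (S : system R) x y I q :
  good K S -> sandwich S y x I q -> sandwich S x y I q.
Proof.
move=> G [s1 s2 s3]; by split=> [|u v /s2|]; rewrite (davoid_sym G _ x y).
Qed.

Lemma sandwich_ext (R : realDomainType) K (S : system R) x y I J q :
  good K S -> (forall u v, avoids I u v = avoids J u v) ->
  sandwich S x y I q -> sandwich S x y J q.
Proof.
move=> G e [s1 s2 s3]; split=> //; last by rewrite -(davoid_ext G _ _ e).
by move=> u v; rewrite -e; apply: s2.
Qed.

Section EntNotVia.
Variables (R : realDomainType) (K : pred nat) (S : system R).
Variables (a b : nat) (w : R).
Hypotheses (G : good K S) (U : updatable S a b w K).
Notation F := (davoid S).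
Notation D := (dist S).
Notation h := (hops S).
Notation p := (vert S).
Notation reach x y := (D x y < +oo)%E.
Notation S' := (update S a b w).
Notation F' := (davoid S').
Notation D' := (dist S').

(** The new edge lies on no old canonical path, so the failure of an edge of such a path does not
    remove it. *)
Lemma link_fresh x y i j u v : reach x y -> j <= h x y ->
  avoids (segment S x y i j) u v -> link a b w (one_edge u v) = w%:E.
Proof.
move=> r lj /avoids_segmentP[k lk e]; rewrite /link; case: ifP => // /andP[ne].
have lk' : k < h x y by lia.
have := upd_fresh U (elimN eqP ne) r lk'; move/negP => nf av; case: nf.
by move: av; case: e => -[-> ->]; rewrite /avoids /one_edge;
  case/orP => /andP[/eqP -> /eqP ->]; rewrite !eqxx ?orbT.
Qed.

(** The segment consists of old edges, so a single failure leaves the crossing at cost [w]; each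
    summand then inherits its bounds from the old system. *)
Lemma sandwich_not_via x y k1 k2 q1 q2 q3 q4 q5 q6 :
  let I := segment S x y k1 k2 in
  reach x y -> k2 <= h x y ->
  sandwich S x y I q1 -> sandwich S x y I q2 ->
  sandwich S x a I q3 -> sandwich S b y I q4 ->
  sandwich S x b I q5 -> sandwich S a y I q6 ->
  sandwich S' x y I (Order.min (Order.max q1 q2)
    (Order.min (q3 + w%:E + q4)%E (q5 + w%:E + q6)%E)).
Proof.
move=> I r lk [s11 s12 s13] [s21 s22 s23] [s31 s32 s33] [s41 s42 s43]
  [s51 s52 s53] [s61 s62 s63].
have l0 := update_le S a b w; have l1 := update_le_ab S a b w.
have l2 := update_le_ba S a b w.
split.
- rewrite !le_min le_max; apply/and3P; split.
  + by rewrite (le_trans (l0 _ _ _) s11).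
  + by apply: le_trans (l1 _ _ _) _; rewrite link_no_edge !leeD.
  + by apply: le_trans (l2 _ _ _) _; rewrite link_no_edge !leeD.
- move=> u v Iuv; have le := link_fresh r lk Iuv.
  rewrite !le_min le_max; apply/and3P; split.
  + by rewrite (le_trans (l0 _ _ _) (s12 _ _ Iuv)).
  + by apply: le_trans (l1 _ _ _) _; rewrite le !leeD ?s32 ?s42.
  + by apply: le_trans (l2 _ _ _) _; rewrite le !leeD ?s52 ?s62.
- have lw := link_ge a b w I.
  have [->|->|->] := update_cases S a b w I x y; rewrite !ge_min.
  + by rewrite ge_max s13 s23.
  + by apply/orP; right; apply/orP; left; rewrite !leeD.
  + by apply/orP; right; apply/orP; right; rewrite !leeD.
Qed.

Lemma segment_edge_free x y z t i j u v : reach x y -> reach z t ->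
  j <= h x y ->
  (forall m k, m <= h z t -> i <= k <= j -> p z t m = p x y k -> False) ->
  avoids (segment S x y i j) u v -> F (one_edge u v) z t = D z t.
Proof.
move=> r rz lj H /avoids_segmentP[k lk e].
apply: (davoid_free G rz) => m lm; apply/negP.
by case/orP => /andP[/eqP e1 /eqP e2]; case: e => -[e3 e4];
  [apply: (H m k)|apply: (H m k.+1)|apply: (H m k.+1)|apply: (H m k)];
  rewrite ?e1 ?e2 ?e3 ?e4 //; lia.
Qed.

End EntNotVia.

Section EntVia.
Variables (R : realDomainType) (K : pred nat) (S : system R).
Variables (a b : nat) (w : R).
Hypotheses (G : good K S) (U : updatable S a b w K).
Notation F := (davoid S).
Notation D := (dist S).
Notation h := (hops S).
Notation p := (vert S).
Notation reach x y := (D x y < +oo)%E.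
Notation S' := (update S a b w).
Notation F' := (davoid S').
Notation D' := (dist S').
Notation h' := (hops S').
Notation p' := (vert S').

Variables (x y k1 k2 : nat).
Hypothesis v : via S a b w x y.
Hypothesis lt_k : k1 + k2 < h' x y.

Let m1 := h' x y - k1.
Let m2 := h' x y - k2.
Let I := segment S' x y k1 m2.
Let J1 := segment S x a k1 (minn m2 (h x a)).
Let J2 := segment S y b k2 (minn m1 (h y b)).
Let crosses := [&& a != b, k1 <= h x a & h x a < m2].

Let ra : reach x a. Proof. by have [] := via_reach G v. Qed.
Let rb : reach b y. Proof. by have [] := via_reach G v. Qed.
Let hyb : h y b = h b y. Proof. exact: (hops_sym G rb). Qed.
Let hE : h' x y = h x a + (a != b) + h b y. Proof. exact: hops_via. Qed.
Let r' : (D' x y < +oo)%E.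
Proof. by rewrite (dist_via G U v) !lte_add_pinfty // ltey. Qed.
Let G' := update_good G U.

Lemma vert_via_y m : m <= h b y -> p y b m = p' x y (h' x y - m).
Proof.
move=> lm; rewrite (vert_sym G rb) // -(vert_via_right G v) ?leq_subr //.
by congr (p' _ _ _); rewrite hE; lia.
Qed.

Lemma avoids_J1 s t : avoids J1 s t -> avoids I s t.
Proof.
move/avoids_segmentP=> [k lk e]; apply/avoids_segmentP; exists k; first lia.
by rewrite !(vert_via_left v) //; lia.
Qed.

Lemma avoids_J2 s t : avoids J2 s t -> avoids I s t.
Proof.
move/avoids_segmentP=> [k lk e]; apply/avoids_segmentP.
have lk' : k < h b y by rewrite -hyb; lia.
exists (h' x y - k.+1); first by rewrite /m2 /m1 hE in lk *; lia.
move: e; rewrite !vert_via_y ?(ltnW lk') //.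
have -> : (h' x y - k.+1).+1 = h' x y - k by rewrite hE; lia.
by case=> -[-> ->]; [right|left].
Qed.

Lemma avoids_crosses : crosses -> avoids I a b.
Proof.
case/and3P=> ne l1 l2; apply/avoids_segmentP; exists (h x a); first by rewrite l1.
left; rewrite (vert_via_left v) // (vert_hops G ra) -addn1.
have := @vert_via_right _ _ _ a b w G x y 0 v isT; rewrite ne addn0 => ->.
by rewrite (vert0 G rb).
Qed.

(** The segment of the rerouted path, cut at the crossing. *)
Lemma avoids_I s t : avoids I s t ->
  [\/ avoids J1 s t, avoids J2 s t | crosses /\ avoids (one_edge a b) s t].
Proof.
move/avoids_segmentP=> [k lk e]; rewrite /m2 in lk.
have [lt_ka|le_ak] := ltnP k (h x a).
  constructor 1; apply/avoids_segmentP; exists k; first by rewrite /m2; lia.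
  by move: e; rewrite !(vert_via_left v) // ltnW.
have [eq_ka|ne_ka] := boolP ((a != b) && (k == h x a)).
  case/andP: eq_ka => ne /eqP ek; constructor 3; split.
    by rewrite /crosses ne /m2 -ek; lia.
  move: e; rewrite ek (vert_via_left v) // (vert_hops G ra) -addn1.
  have := @vert_via_right _ _ _ a b w G x y 0 v isT; rewrite ne addn0 => ->.
  by rewrite (vert0 G rb) /avoids /one_edge => -[] [-> ->]; rewrite !eqxx ?orbT.
have lk2 : h x a + (a != b) <= k by case: (a != b) ne_ka => /=; lia.
constructor 2; apply/avoids_segmentP; exists (h' x y - k.+1).
  by rewrite /m1 hyb hE in lk *; lia.
rewrite !vert_via_y; try by rewrite hE in lk *; lia.
have -> : h' x y - (h' x y - k.+1) = k.+1 by lia.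
have -> : h' x y - (h' x y - k.+1).+1 = k by lia.
by case: e => e; [right|left]; case: e.
Qed.

(** The rerouted path repeats no vertex, so its two halves share no edge. *)
Lemma free_J1 s t : avoids J1 s t -> F (one_edge s t) b y = D b y.
Proof.
move/avoids_segmentP=> [k lk e].
have {}lk : k < h x a by lia.
apply: (davoid_free G rb) => m lm; apply/negP.
have pos i n : i <= h x a -> n <= h b y -> p x a i = p b y n ->
    i = h x a /\ n = 0.
  move=> li ln; rewrite -(vert_via_left v li) -(vert_via_right G v ln).
  by move/(vert_inj G' r'); rewrite hE => /(_ _ _)e0; have := e0 _ _; lia.
by case/orP => /andP[/eqP e1 /eqP e2]; case: e => -[e3 e4];
   rewrite ?e3 ?e4 in e1 e2;
   have := pos _ _ _ _ (esym e1); have := pos _ _ _ _ (esym e2); lia.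
Qed.

Lemma free_J2 s t : avoids J2 s t -> F (one_edge s t) x a = D x a.
Proof.
move/avoids_segmentP=> [k lk e].
have {}lk : k < h b y by rewrite -hyb; lia.
apply: (davoid_free G ra) => m lm; apply/negP.
have pos i n : i <= h x a -> n <= h b y -> p x a i = p y b n ->
    i = h x a /\ n = h b y.
  move=> li ln; rewrite -(vert_via_left v li) vert_via_y //.
  by move/(vert_inj G' r'); rewrite hE => /(_ _ _)e0; have := e0 _ _; lia.
by case/orP => /andP[/eqP e1 /eqP e2]; case: e => -[e3 e4];
   rewrite ?e3 ?e4 in e1 e2;
   have := pos _ _ _ _ e1; have := pos _ _ _ _ e2; lia.
Qed.

Lemma link_J s t : avoids J1 s t \/ avoids J2 s t ->
  link a b w (one_edge s t) = w%:E.
Proof.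
case; first by apply: (link_fresh U ra); rewrite geq_minr.
by apply: (link_fresh U (reach_sym G rb)); rewrite geq_minr.
Qed.

(** The failure of the new edge is harmless to the old path from [x] to [y], which does not contain
    it. *)
Lemma cross_dist s t q : crosses -> avoids (one_edge a b) s t ->
  (D x y <= q)%E -> (F (one_edge s t) x y <= q)%E.
Proof.
case/and3P=> ne _ _ ab; case: (leP +oo%E (D x y)) => [oo le|r le].
  by apply: le_trans (le_trans oo le); rewrite leey.
apply: le_trans le; apply: (davoid_path G r) => k lk.
apply: contra (upd_fresh U (elimN eqP ne) r lk).
by move: ab; rewrite /avoids /one_edge => /orP[]/andP[/eqP -> /eqP ->];
  case/orP => /andP[-> ->]; rewrite ?orbT.
Qed.

(** The maximum of [q1] and [q2] is forced: each bounds the failures on its own side only, while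
    both stay below the distance that avoids everything. Single failures on one side leave the other
    half of the detour at its old length. *)
Lemma sandwich_via q1 q2 q3 q4 q5 q6 :
  sandwich S x y J1 q1 -> sandwich S x y J2 q2 ->
  sandwich S x a J1 q3 -> sandwich S b y J2 q4 ->
  (0 <= q5)%E -> (0 <= q6)%E ->
  let w1 := if crosses then +oo%E else w%:E in
  sandwich S' x y I (Order.min (Order.max q1 q2)
    (Order.min (q3 + w1 + q4)%E (q5 + +oo + q6)%E)).
Proof.
move=> [s11 s12 s13] [s21 s22 s23] [s31 s32 s33] [s41 s42 s43] q50 q60 w1.
have -> : (q5 + +oo + q6 = +oo)%E.
  by case: q5 q50 => [?| |] //; case: q6 q60.
have -> : (Order.min (q3 + w1 + q4) +oo = q3 + w1 + q4)%E.
  by apply/min_idPl; rewrite leey.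
have l0 := update_le S a b w; have l1 := update_le_ab S a b w.
have oo : crosses -> (q3 + w1 + q4 = +oo)%E.
  rewrite /w1 => ->; have := davoid_ge0 G no_edge x a.
  have := davoid_ge0 G no_edge b y => d1 d2.
  have := le_trans d1 s41; have := le_trans d2 s31.
  by case: (q3) => [?| |] //; case: (q4).
split.
- rewrite le_min le_max (le_trans (l0 _ _ _) s11) /=.
  have [/oo ->|nc] := boolP crosses; first by rewrite leey.
  rewrite /w1 (negbTE nc); apply: le_trans (l1 _ _ _) _.
  by rewrite link_no_edge !leeD.
- move=> s t Ist; rewrite le_min le_max; apply/andP; split.
    case/avoids_I: Ist => [j1|j2|[c ab]].
    + by rewrite (le_trans (l0 _ _ _) (s12 _ _ j1)).
    + by rewrite (le_trans (l0 _ _ _) (s22 _ _ j2)) orbT.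
    + by rewrite (le_trans (l0 _ _ _)) // cross_dist.
  have [/oo ->|nc] := boolP crosses; first by rewrite leey.
  rewrite /w1 (negbTE nc); apply: le_trans (l1 _ _ _) _.
  case/avoids_I: Ist => [j1|j2|[c ab]]; last by rewrite c in nc.
  + rewrite link_J; last by left.
    by rewrite !leeD ?s32 // (free_J1 j1).
  + rewrite link_J; last by right.
    by rewrite !leeD ?s42 // (free_J2 j2).
- have m1' : (F J1 x y <= F I x y)%E by apply: (davoid_mono G); apply: avoids_J1.
  have m2' : (F J2 x y <= F I x y)%E by apply: (davoid_mono G); apply: avoids_J2.
  have c0 : (Order.max q1 q2 <= F I x y)%E.
    by rewrite ge_max (le_trans s13) // (le_trans s23).
  have m3 : (q3 <= F I x a)%E.
    by apply: le_trans s33 _; apply: (davoid_mono G); apply: avoids_J1.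
  have m4 : (q4 <= F I b y)%E.
    by apply: le_trans s43 _; apply: (davoid_mono G); apply: avoids_J2.
  have wI : (w1 <= link a b w I)%E.
    rewrite /w1; case: ifP => [c|_]; last exact: link_ge.
    by rewrite /link (avoids_crosses c) andbT; case/and3P: c => ->.
  have cab : (q3 + w1 + q4 <= F I x a + link a b w I + F I b y)%E.
    by rewrite !leeD.
  have [->|->|->] := update_cases S a b w I x y; rewrite ge_min.
  + by rewrite c0.
  + by rewrite cab orbT.
  have [e|ne] := eqVneq a b; first by move: cab; rewrite -e => ->; rewrite orbT.
  have [Ka Kb] := upd_inner U (elimN eqP ne).
  have [c|nc] := boolP crosses.
    rewrite /link ne (avoids_crosses c) /=.
    have := davoid_ge0 G I x b; have := davoid_ge0 G I a y.
    by case: (F I x b) => [?| |] //; case: (F I a y) => [?| |] // _ _;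
      rewrite leey.
  (* The reverse passage, when the new edge is spared: the segment then lies on one side of the
     crossing, and following the intact half of the detour from [b] (or up to [a]) is no worse than
     crossing backwards. *)
  apply/orP; left; apply: le_trans c0 _.
  have w0 := upd_ge0 U; have lI := le_trans (_ : (0 <= w%:E)%E) (link_ge a b w I).
  have {}lI : (0 <= link a b w I)%E by apply: lI; rewrite lee_fin.
  have vl := via_left G U v; have vr := via_right G U v.
  have [lak|lka] := leqP m2 (h x a).
  + (* no edge of I on the far side *)
    have e : F I b y = D b y.
      apply: (davoid_free G rb) => m lm; apply/negP => /avoids_segmentP[k lk].
      rewrite -!(vert_via_right G v) ?(ltnW lm) //.
      by case=> -[/(vert_inj G' r') e1 /(vert_inj G' r') e2];
        move: e1 e2 lk lak lm; rewrite /m2 hE; clear; lia.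
    apply: le_trans (davoid_tri G I x y Kb) _; rewrite e -addeA leeD2l //.
    apply: le_trans (leeDr _ lI); apply: le_trans (dist_le G I a y).
    by apply: le_trans vr; apply: leeDr; rewrite lee_fin.
  + have lk1 : h x a < k1 by move: nc; rewrite /crosses ne lka andbT -ltnNge.
    have e : F I x a = D x a.
      apply: (davoid_free G ra) => m lm; apply/negP => /avoids_segmentP[k lk].
      rewrite -!(vert_via_left v) ?(ltnW lm) //.
      by case=> -[/(vert_inj G' r') e1 /(vert_inj G' r') e2];
        move: e1 e2 lk lk1 lm; rewrite /m2 hE; clear; lia.
    apply: le_trans (davoid_tri G I x y Ka) _; rewrite e leeD2r //.
    apply: le_trans (leeDl _ lI); apply: le_trans (dist_le G I x b).
    by apply: le_trans vl; apply: leeDl; rewrite lee_fin.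
Qed.

End EntVia.

Section SoundUpdate.
Variables (R : realDomainType) (K : pred nat) (S : system R).
Variables (l : nat) (M : store R) (a b : nat) (w : R).
Hypotheses (G : good K S) (Z : sound l S M) (U : updatable S a b w K).
Notation h := (hops S).
Notation S' := (update S a b w).

Lemma shortcut_via c d x y : shortcut M w c d x y = via S c d w x y.
Proof. by rewrite /shortcut !(dst_sound Z). Qed.

Lemma improved_cases x y :
  [\/ [/\ via S a b w x y, improved M a b w x y,
          near_end M a b w x y = a & far_end M a b w x y = b],
      [/\ via S b a w x y, improved M a b w x y,
          near_end M a b w x y = b & far_end M a b w x y = a] |
      [/\ ~~ via S a b w x y, ~~ via S b a w x y, improved M a b w x y = false,
          near_end M a b w x y = a & far_end M a b w x y = b]].
Proof.
rewrite /improved /near_end /far_end !shortcut_via.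
case v1: (via S a b w x y); first by constructor 1.
by case v2: (via S b a w x y); [constructor 2|constructor 3].
Qed.

Lemma new_dst_sound x y : new_dst M a b w x y = dist S' x y.
Proof.
rewrite /new_dst !(dst_sound Z).
case: (improved_cases x y) => [[v -> -> ->]|[v -> -> ->]|[v1 v2 -> _ _]].
- by rewrite (dist_via G U v).
- by rewrite -(davoid_swap S a b w) (dist_via G (updatable_sym U) v).
- by rewrite dist_not_via.
Qed.

Lemma new_hop_sound x y : new_hop M a b w x y = hops S' x y.
Proof.
rewrite /new_hop !(hop_sound Z).
case: (improved_cases x y) => [[v -> -> ->]|[v -> -> ->]|[v1 v2 -> _ _]].
- by rewrite hops_via.
- by rewrite -(hops_swap G U) hops_via // eq_sym.
- by rewrite hops_not_via.
Qed.

Lemma par_via c d x y : updatable S c d w K -> via S c d w x y ->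
  (if y == d then c else par M d y) =
  vert (update S c d w) x y (hops (update S c d w) x y).-1.
Proof.
move=> Uc v; have [rc rd] := via_reach G v; rewrite hops_via //.
have [e|ne] := eqVneq y d.
  have ncd : c != d.
    apply/eqP => ecd; move: v; rewrite /via e ecd (davoid_refl G).
    by rewrite (upd_eq Uc ecd) !adde0 ltxx.
  rewrite e in v *; rewrite ncd (hops_refl G) addn0 addn1 -pred_Sn.
  by rewrite vert_via_left // (vert_hops G rc).
have hd : 0 < h d y.
  rewrite lt0n; apply/eqP => h0; move: ne; rewrite -(vert_hops G rd) h0.
  by rewrite (vert0 G rd) eqxx.
have -> : (h x c + (c != d) + h d y).-1 = h x c + (c != d) + (h d y).-1 by lia.
by rewrite (vert_via_right G v) ?leq_pred // (par_sound Z rd).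
Qed.

Lemma new_par_sound x y : (dist S' x y < +oo)%E ->
  new_par M a b w x y = vert S' x y (hops S' x y).-1.
Proof.
rewrite /new_par => r.
case: (improved_cases x y) => [[v -> -> ->]|[v -> -> ->]|[v1 v2 -> _ _]].
- exact: (par_via U v).
- by rewrite (par_via (updatable_sym U) v) (vert_swap G U) (hops_swap G U).
- rewrite (dist_not_via v1 v2) in r.
  by rewrite vert_not_via // hops_not_via // (par_sound Z r).
Qed.

Lemma new_par_unreachable x y : dist S' x y = +oo%E -> new_par M a b w x y = y.
Proof.
move=> r; rewrite /new_par; have U' := updatable_sym U.
case: (improved_cases x y) => [[v -> -> ->]|[v -> -> ->]|[v1 v2 -> _ _]].
- have [q1 q2] := via_reach G v; move: r; rewrite (dist_via G U v) => e.
  have : (dist S x a + w%:E + dist S b y < +oo)%E.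
    by rewrite !lte_add_pinfty // ltey.
  by rewrite e.
- have [q1 q2] := via_reach G v.
  move: r; rewrite -(davoid_swap S a b w) (dist_via G U' v) => e.
  have : (dist S x b + w%:E + dist S a y < +oo)%E.
    by rewrite !lte_add_pinfty // ltey.
  by rewrite e.
- by apply: (par_unreachable Z); rewrite -(dist_not_via v1 v2).
Qed.

Lemma query_ge0 x y k1 z k2 : (dist S x z < +oo)%E ->
  (0 <= query l M x y k1 z k2)%E.
Proof.
move=> r; have [s _ _] := sandwich_query G Z y k1 k2 r.
exact: le_trans (davoid_ge0 G _ _ _) s.
Qed.

Lemma segment_full c d k1 k2 : (dist S c d < +oo)%E -> k1 + k2 < h c d ->
  (forall u v, avoids (segment S d c k2 (minn (h c d - k1) (h d c))) u v =
     avoids (segment S c d k1 (h c d - k2)) u v) /\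
  minn (h c d - k2) (h c d) = h c d - k2.
Proof.
move=> r lk; have hs := hops_sym G r; split=> [u v|]; last by lia.
have -> : minn (h c d - k1) (h d c) = h c d - k1 by rewrite hs; lia.
rewrite -(avoids_segment_sym G u v r); last by lia.
by rewrite subKn //; lia.
Qed.

Lemma via_ent c d x y k1 k2 :
  let S'' := update S c d w in
  let m1 := hops S'' x y - k1 in
  let m2 := hops S'' x y - k2 in
  let q x y k z m := query l M x y k z m in
  updatable S c d w K -> via S c d w x y -> k1 + k2 < hops S'' x y ->
  sandwich S'' x y (segment S'' x y k1 m2)
    (Order.min (Order.max (q x y k1 c m2) (q y x k2 d m1))
      (Order.min (q x c k1 c m2
                  + (if [&& c != d, k1 <= h x c & h x c < m2]%N
                     then +oo else w%:E) + q y d k2 d m1)%E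
               (q x d k1 c m2 + +oo + q y c k2 d m1)%E)).
Proof.
move=> S'' m1 m2 q Uc v lk; have [rc rd] := via_reach G v.
have rd' := reach_sym G rd.
apply: (sandwich_via G Uc v lk).
- exact: (sandwich_query G Z y k1 m2 rc).
- exact: (sandwich_sym G (sandwich_query G Z x k2 m1 rd')).
- exact: (sandwich_query G Z c k1 m2 rc).
- exact: (sandwich_sym G (sandwich_query G Z d k2 m1 rd')).
- exact: query_ge0.
- exact: query_ge0.
Qed.

(** The three cases of [improved_cases], the second one through the swapped update. *)
Lemma new_ent_sound x y i j : (dist S' x y < +oo)%E ->
  (2 ^ i).-1 + (2 ^ j).-1 < hops S' x y ->
  sandwich S' x y (trimmed S' x y i j) (new_ent l M a b w x y i j).
Proof.
move=> r lk; have U' := updatable_sym U.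
rewrite /new_ent new_hop_sound /trimmed.
case: (improved_cases x y) => [[v -> -> ->]|[v -> -> ->]|[v1 v2 -> -> ->]].
- by rewrite !(hop_sound Z); apply: via_ent.
- apply: sandwich_swap; rewrite -(hops_swap G U) in lk *.
  have := via_ent U' v lk; rewrite !(hop_sound Z) (eq_sym a b).
  apply: (sandwich_ext (update_good G U')) => s t.
  by rewrite /avoids /segment; congr (_ || _); apply: eq_has => k;
    rewrite !(vert_swap G U).
- rewrite hops_not_via // in lk *; rewrite (dist_not_via v1 v2) in r.
  have r' := reach_sym G r.
  have [e1 e2] := segment_full r lk.
  have fwd z := sandwich_query G Z z (2 ^ i).-1 (h x y - (2 ^ j).-1) r.
  rewrite e2 in fwd.
  have bwd z := sandwich_sym G (sandwich_ext G e1
    (sandwich_query G Z z (2 ^ j).-1 (h x y - (2 ^ i).-1) r')).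
  have := @sandwich_not_via _ _ _ _ _ _ U x y (2 ^ i).-1 (h x y - (2 ^ j).-1)
    _ _ _ _ _ _ r (leq_subr _ _) (fwd y) (bwd x) (fwd a) (bwd b) (fwd b) (bwd a).
  rewrite /= ; apply: (sandwich_ext (update_good G U)).
  by move=> s t; rewrite /segment vert_not_via.
Qed.

Lemma sound_update :
  (forall x y, (dist S' x y < +oo)%E -> hops S' x y < 2 ^ l) ->
  sound l S' (new_store l M a b w).
Proof.
move=> small; split=> //=.
- exact: new_dst_sound.
- exact: new_hop_sound.
- exact: new_par_sound.
- exact: new_par_unreachable.
- by move=> x y i j r _ _; apply: new_ent_sound.
Qed.

End SoundUpdate.

(** * Distance systems realised by a graph *)

(** The inner vertices of a canonical path are distinct elements of [K], hence at most [n] of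
    them. *)
Lemma hops_bound (R : realDomainType) (K : pred nat) (S : system R) n x y :
  good K S -> (forall v, K v -> v < n) -> (dist S x y < +oo)%E ->
  hops S x y <= n.+1.
Proof.
move=> G Kn r; pose s := [seq vert S x y k | k <- iota 1 (hops S x y).-1].
have us : uniq s.
  rewrite map_inj_in_uniq ?iota_uniq // => i j.
  rewrite !mem_iota => li lj; apply: (vert_inj G r); lia.
have ss : {subset s <= iota 0 n}.
  move=> v /mapP[k]; rewrite mem_iota => lk ->; rewrite mem_iota /= add0n.
  by apply/Kn/(vert_inner G r); lia.
by have := uniq_leq_size us ss; rewrite size_map !size_iota; lia.
Qed.

Lemma same_pairE n (a b u v : 'I_n) :
  same_pair a b u v = avoids (one_edge a b) u v.
Proof.
rewrite /same_pair /avoids /one_edge !val_eqE.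
apply/eqP/orP => [e|[/andP[/eqP -> /eqP ->] //|/andP[/eqP -> /eqP ->]]].
  have := set21 u v; have := set22 u v; rewrite e !inE.
  have := set21 a b; have := set22 a b; rewrite -e !inE.
  by do 4![case/orP => /eqP ?]; subst; rewrite ?eqxx; auto.
exact: setUC.
Qed.

Lemma path_length_cons (R : realDomainType) n (G : wgraph R n) u v p :
  path_length G u (v :: p) = (weight G u v + path_length G v p)%R.
Proof. by rewrite /path_length /= big_cons. Qed.

Lemma path_length_cat (R : realDomainType) n (G : wgraph R n) u p q :
  path_length G u (p ++ q) = (path_length G u p + path_length G (last u p) q)%R.
Proof.
elim: p u => [|v p IH] u /=; first by rewrite /path_length big_nil add0r.
by rewrite !path_length_cons IH addrA.
Qed.

Definition usable (R : realDomainType) n (G : wgraph R n) (I : rel nat) :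
  rel 'I_n := fun u v => edge G u v && ~~ avoids I u v.

(** [linked_path] says that finite distances are lengths of actual paths; [linked_edge], with the
    triangle inequality over all vertices, gives minimality. The latter is complete only once every
    vertex is in [K]. *)
Record linked (R : realDomainType) (n : nat) (G : wgraph R n) (S : system R) :
    Prop := Linked {
  linked_sym : symmetric (edge G);
  linked_irr : irreflexive (edge G);
  linked_edge : forall I (u v : 'I_n), usable G I u v ->
    (davoid S I u v <= (weight G u v)%:E)%E;
  linked_path : forall I (x y : 'I_n), (davoid S I x y < +oo)%E ->
    exists p, [/\ path (usable G I) x p, last x p = y &
                  davoid S I x y = (path_length G x p)%:E];
  linked_vert : forall x y k, (dist S x y < +oo)%E -> k < hops S x y ->
    exists u v : 'I_n, [/\ edge G u v, vert S x y k = u & vert S x y k.+1 = v] }.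

Section LinkedUpdate.
Variables (R : realDomainType) (n : nat) (G G' : wgraph R n) (S : system R).
Variables (K : pred nat) (a b : 'I_n) (w : R).
Hypotheses (L : linked G S) (gS : good K S) (U : updatable S a b w K).
Hypotheses (sym' : symmetric (edge G')) (irr' : irreflexive (edge G')).
Hypothesis old_edge : forall u v, edge G u v ->
  edge G' u v /\ weight G' u v = weight G u v.
Hypothesis new_edge : a != b -> [/\ edge G' a b, weight G' a b = w &
  weight G' b a = w].
Hypothesis edge_cases : forall u v, edge G' u v ->
  edge G u v \/ a != b /\ same_pair a b u v.
Notation S' := (update S a b w).

Lemma usable_sub I u p : path (usable G I) u p ->
  path (usable G' I) u p /\ path_length G' u p = path_length G u p.
Proof.
elim: p u => [|v p IH] u /=; first by rewrite /path_length !big_nil.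
case/andP=> /andP[e nI] /IH[h1 h2]; have [e1 e2] := old_edge e.
by rewrite !path_length_cons e2 h2 /usable e1 nI h1.
Qed.

Lemma linked_path_join (c d : 'I_n) I (x y : 'I_n) :
  (a : nat) != b -> (c = a /\ d = b) \/ (c = b /\ d = a) ->
  ~~ avoids I a b ->
  (davoid S I x c < +oo)%E -> (davoid S I d y < +oo)%E ->
  exists p, [/\ path (usable G' I) x p, last x p = y &
    (davoid S I x c + w%:E + davoid S I d y)%E = (path_length G' x p)%:E].
Proof.
rewrite val_eqE => ne cd nI /(linked_path L)[p [pp lp ->]] /(linked_path L)[q [pq lq ->]].
have [e1 e2 e3] := new_edge ne.
have [pp' ep] := usable_sub pp; have [pq' eq] := usable_sub pq.
exists (p ++ d :: q); split.
- rewrite cat_path pp' lp /= pq' andbT /usable.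
  case: cd => -[-> ->]; first by rewrite e1.
  by rewrite sym' e1 /avoids orbC.
- by rewrite last_cat.
- rewrite path_length_cat lp path_length_cons ep eq -!EFinD addrA.
  by case: cd => -[-> ->]; rewrite ?e2 ?e3.
Qed.

Lemma linked_path_glue (x y z : 'I_n) I :
  (davoid S I x z < +oo)%E -> (davoid S I z y < +oo)%E ->
  exists p, [/\ path (usable G' I) x p, last x p = y &
    (davoid S I x z + davoid S I z y)%E = (path_length G' x p)%:E].
Proof.
move=> /(linked_path L)[p [pp lp ->]] /(linked_path L)[q [pq lq ->]].
have [pp' ep] := usable_sub pp; have [pq' eq] := usable_sub pq.
exists (p ++ q); split; last by rewrite path_length_cat lp ep eq -EFinD.
- by rewrite cat_path pp' lp.
- by rewrite last_cat lp.
Qed.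

(** The two realising paths are joined by the new edge, or simply concatenated when [a = b]. *)
Lemma linked_path_update I (c d x y : 'I_n) :
  (c = a /\ d = b) \/ (c = b /\ d = a) ->
  (davoid S I x c + link a b w I + davoid S I d y < +oo)%E ->
  exists p, [/\ path (usable G' I) x p, last x p = y &
    (davoid S I x c + link a b w I + davoid S I d y)%E
      = (path_length G' x p)%:E].
Proof.
move=> cd lt; have w0 := link_ge0 U I.
have [r1 r2] : (davoid S I x c < +oo)%E /\ (davoid S I d y < +oo)%E.
  move: (davoid_ge0 gS I x c) (davoid_ge0 gS I d y) w0 lt.
  by case: (davoid S I x c) => [?| |]; case: (davoid S I d y) => [?| |];
    case: (link a b w I) => [?| |] //= *; rewrite ?ltey.
have [e|ne] := eqVneq (a : nat) b.
  have eab : a = b by apply: val_inj.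
  have ecd : c = d by case: cd => -[-> ->].
  have -> : link a b w I = 0%E by rewrite -e link_eq (upd_eq U e).
  by rewrite adde0 -ecd in r2 *; apply: linked_path_glue.
have nI : ~~ avoids I a b.
  apply/negP => aI; move: lt; rewrite /link ne aI /=.
  move: (davoid_ge0 gS I x c) (davoid_ge0 gS I d y).
  by case: (davoid S I x c) => [?| |]; case: (davoid S I d y) => [?| |].
have -> : link a b w I = w%:E by rewrite /link (negbTE nI) andbF.
exact: linked_path_join.
Qed.

Lemma linked_vert_via (c d : 'I_n) x y k :
  (c = a /\ d = b) \/ (c = b /\ d = a) -> via S c d w x y ->
  k < hops (update S c d w) x y ->
  exists u v : 'I_n, [/\ edge G' u v, vert (update S c d w) x y k = u &
                         vert (update S c d w) x y k.+1 = v].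
Proof.
move=> cd v lk; have [rc rd] := via_reach gS v.
have [lt_kc|le_ck] := ltnP k (hops S x c).
  have [s [t [e e1 e2]]] := linked_vert L rc lt_kc.
  by exists s, t; rewrite !vert_via_left ?(ltnW lt_kc) //; have [] := old_edge e.
rewrite hops_via // in lk.
have vr m := @vert_via_right _ _ _ c d w gS x y m v.
have [/andP[ne /eqP ek]|nk] := boolP (((c : nat) != d) && (k == hops S x c)).
  exists c, d; rewrite {1}ek vert_via_left // (vert_hops gS rc).
  have := vr 0 isT; rewrite ne addn0 addn1 -ek => ->; rewrite (vert0 gS rd).
  have nab : a != b.
    by rewrite -val_eqE; case: cd => -[<- <-]; rewrite // eq_sym.
  have [e1 _ _] := new_edge nab.
  by split=> //; case: cd => -[-> ->] //; rewrite sym'.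
have le2 : hops S x c + ((c : nat) != d) <= k.
  by case: ((c : nat) != d) nk => /=; lia.
rewrite -(subnKC le2) -addnS; set m := k - _.
have lm : m < hops S d y by rewrite /m; lia.
have [s [t [e e1 e2]]] := linked_vert L rd lm.
exists s, t; rewrite !vr ?(ltnW lm) //; split=> //.
by have [] := old_edge e.
Qed.

Lemma linked_update : linked G' S'.
Proof.
split=> //.
- move=> I u v /andP[e nI]; case: (edge_cases e) => [eo|[ne]].
    apply: le_trans (update_le _ _ _ _ _ _ _) _; rewrite (old_edge eo).2.
    by apply: (linked_edge L); rewrite /usable eo.
  have [e1 e2 e3] := new_edge ne; rewrite same_pairE.
  case/orP=> /andP[/eqP eu /eqP ev]; rewrite eu ev in nI *.
    have -> : u = a by apply: val_inj.
    have -> : v = b by apply: val_inj.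
    rewrite e2; apply: le_trans (update_le_ab _ _ _ _ _ _ _) _.
    by rewrite !(davoid_refl gS) /link (negbTE nI) andbF add0e adde0.
  have -> : u = b by apply: val_inj.
  have -> : v = a by apply: val_inj.
  rewrite e3; apply: le_trans (update_le_ba _ _ _ _ _ _ _) _.
  rewrite /avoids orbC -/(avoids I a b) in nI.
  by rewrite !(davoid_refl gS) /link (negbTE nI) andbF add0e adde0.
- move=> I x y; have [->|->|->] := update_cases S a b w I x y.
  + case/(linked_path L) => p [pp lp ep]; have [pp' ep'] := usable_sub pp.
    by exists p; rewrite ep'.
  + by apply: linked_path_update; left.
  + by apply: linked_path_update; right.
- move=> x y k /update_reach[v|v|[v1 v2 r]].
  + by apply: linked_vert_via => //; left.
  + rewrite -(hops_swap gS U) -!(vert_swap gS U).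
    by apply: linked_vert_via => //; right.
  + rewrite hops_not_via // vert_not_via // => lk.
    have [s [t [e e1 e2]]] := linked_vert L r lk.
    by exists s, t; have [] := old_edge e.
Qed.

End LinkedUpdate.

(** * The initial system and its completion in the manner of Floyd and Warshall *)

Section Initial.
Variables (R : realDomainType) (n : nat) (G : wgraph R n).
Hypothesis ok : wgraph_ok G.

Definition arc (x y : nat) : \bar R :=
  match insub x : option 'I_n, insub y : option 'I_n with
  | Some u, Some v => if edge G u v then (weight G u v)%:E else +oo%E
  | _, _ => +oo%E
  end.

Lemma arc_sym x y : arc x y = arc y x.
Proof.
rewrite /arc; move: (insub x : option 'I_n) (insub y : option 'I_n).
move=> [u|] [v|] //.
by case: ok => s _ ws _; rewrite s ws.
Qed.

Lemma arc_ge0 x y : (0 <= arc x y)%E.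
Proof.
rewrite /arc; move: (insub x : option 'I_n) (insub y : option 'I_n).
move=> [u|] [v|]; rewrite ?leey //.
by case: ifP => e; rewrite ?leey // lee_fin; case: ok => _ _ _ /(_ _ _ e).
Qed.

Lemma arc_fin x y : (arc x y < +oo)%E ->
  exists u v : 'I_n, [/\ edge G u v, x = u, y = v & arc x y = (weight G u v)%:E].
Proof.
rewrite /arc; case: (@insubP _ _ 'I_n x) => [u _ <-|];
  case: (@insubP _ _ 'I_n y) => [v _ <-|] //.
by case: ifP => // e _; exists u, v.
Qed.

(** Paths without inner vertices: at most one edge. Accordingly [K] is empty in [init_good] and the
    triangle inequality is vacuous. *)
Definition init_system : system R := System
  (fun I x y => if x == y then 0%E else if avoids I x y then +oo%E else arc x y)
  (fun x y => x != y)
  (fun x y k => if k is 0 then x else y).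

Lemma init_good : good (fun k => k < 0) init_system.
Proof.
have z0 (x y : nat) : (x != y) = false -> x = y by move/negbFE/eqP.
split=> //=.
- by move=> I x; rewrite eqxx.
- move=> I x y; case: ifP => _; first by rewrite lexx.
  by case: ifP => _; [exact: leey|exact: arc_ge0].
- by move=> I x y; rewrite eq_sym /avoids orbC arc_sym.
- move=> I J x y IJ; case: ifP => // _.
  case: ifP => [/IJ ->//|_]; case: ifP => // _; exact: leey.
- move=> I J x y; case: eqP => [_|nxy]; first by left.
  case aI: (avoids I x y); case aJ: (avoids J x y); try by left; rewrite ?leey.
  by right; exists x, y; rewrite aI eqxx aJ; case: eqP => // _; rewrite add0e.
- by move=> x; rewrite eqxx.
- by move=> x y _; rewrite eq_sym.
- by move=> x y k _; case: (x =P y) => [->|ne] /=; case: k => [|[|k]].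
- move=> x y [|j] r lj; first by rewrite eqxx add0e; split=> // -[].
  case: (x =P y) r lj => //= ne r; case: j => // _.
  by rewrite eqxx adde0; split=> // -[|[]].
- by move=> x y k r; case: (x =P y) => //=; case: k => [|[]].
- move=> I x y r; case: (x =P y) r => //= ne r /(_ 0 isT) /negbTE -> //.
Qed.

Lemma init_linked : linked G init_system.
Proof.
case: (ok) => s ir ws w0; split=> //=.
- move=> I u v /andP[e /negbTE ->]; case: eqP => [_|_]; first by rewrite lee_fin w0.
  by rewrite /arc !valK e.
- move=> I x y; case: (val x =P val y) => [/val_inj -> _|ne].
    by exists [::]; rewrite /path_length big_nil.
  case: ifP => // nI; rewrite /arc !valK; case: ifP => // e _.
  exists [:: y]; rewrite /= /usable e nI; split=> //.
  by rewrite path_length_cons /path_length big_nil addr0.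
- move=> x y [|k]; case: (x =P y) => //= ne /arc_fin[u [v [e eu ev _]]] _.
  by exists u, v.
Qed.

Definition init_par (x y : nat) : nat :=
  if (+oo <= arc x y)%E then y else x.

(** A reachable pair of distinct vertices has a one-edge path, whose only stored segment is that
    edge; without it the pair is disconnected, hence the infinite entries. *)
Definition init_store : store R :=
  Store (fun x y => if x == y then 0%E else arc x y) (fun x y => x != y)
    (fun x y => if x == y then y else init_par x y)
    (fun _ _ _ _ => +oo%E).

Lemma init_sound l : 0 < l -> sound l init_system init_store.
Proof.
move=> l0; split=> //=.
- move=> x y _; have : 1 < 2 ^ l by rewrite -[1](expn0 2) ltn_exp2l.
  by case: (x != y) => //; lia.
- move=> x y; rewrite /init_par; case: (x =P y) => [-> //|ne] /=.
  by move=> r; rewrite leNgt r.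
- by move=> x y; case: eqP => // _; rewrite /init_par => ->.
- move=> x y i j r _ _; case: (x =P y) r => // ne r /= lij.
  split=> /=; first exact: leey; first by move=> u v _; exact: leey.
  have -> : (x == y) = false by apply/eqP.
  rewrite /trimmed /=; have -> : (x == y) = false by apply/eqP.
  have -> : (2 ^ i).-1 = 0 by lia.
  have -> : (2 ^ j).-1 = 0 by lia.
  by rewrite /avoids /segment /= !eqxx.
Qed.

End Initial.

(** Also required at unreachable pairs, so that the machine never overflows or addresses outside the
    tables on junk values. *)
Definition bounded (R : realDomainType) (n : nat) (M : store R) : Prop :=
  (forall x y, hop M x y <= n.+1) /\
  (forall x y, x < n -> y < n -> par M x y < n).

(** Large enough that 2 to this power exceeds n + 1, the bound on the number of hops. *)
Definition levels (n : nat) : nat := (trunc_log 2 n).+2.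

Lemma levels_bound n : n.+1 < 2 ^ levels n.
Proof.
rewrite /levels expnS mul2n -addnn; case: n => [//|n].
by have /andP[_] := trunc_log_bounds (ltnSn 1) (ltn0Sn n); lia.
Qed.

Definition represents (R : realDomainType) (n : nat) (G : wgraph R n)
    (M : store R) : Prop :=
  bounded n M /\
  exists S, [/\ good (fun v => v < n) S, linked G S & sound (levels n) S M].

Lemma sound_bounded_par (R : realDomainType) K (S : system R) l M n x y :
  good K S -> (forall v, K v -> v < n) -> sound l S M -> x < n -> y < n ->
  par M x y < n.
Proof.
move=> G Kn Z lx ly; have [r|] := ltP (dist S x y) +oo%E; last first.
  by rewrite leye_eq => /eqP /(par_unreachable Z) ->.
rewrite (par_sound Z r); have [h0|h0] := posnP (hops S x y).-1.
  by rewrite h0 (vert0 G r).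
by apply/Kn/(vert_inner G r); lia.
Qed.

Lemma good_ext (R : realDomainType) (K K' : pred nat) (S : system R) :
  K =1 K' -> good K S -> good K' S.
Proof.
move=> e G; case: G => *; split=> //.
- by move=> I x u y; rewrite -e; auto.
- by move=> x y k r lk; rewrite -e; auto.
Qed.

Lemma step_sound (R : realDomainType) (K : pred nat) (S : system R) M n a b w :
  good K S -> sound (levels n) S M -> bounded n M -> updatable S a b w K ->
  (forall v, K v -> v < n) -> a < n ->
  sound (levels n) (update S a b w) (new_store (levels n) M a b w) /\
  bounded n (new_store (levels n) M a b w).
Proof.
move=> G Z [B1 B2] U Kn an; have G' := update_good G U.
have Kn' v : [pred u | (u == a) || K u] v -> v < n.
  by rewrite inE => /predU1P[->|/Kn].
have hb x y := @hops_bound _ _ _ n x y G' Kn'.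
have Z' : sound (levels n) (update S a b w) (new_store (levels n) M a b w).
  apply: (sound_update G Z U) => x y /hb lt.
  exact: leq_ltn_trans lt (levels_bound n).
split=> //; split=> [x y|x y lx ly]; last exact: (sound_bounded_par G' Kn' Z').
have [r|nr] := boolP (dist (update S a b w) x y < +oo)%E.
  by rewrite (hop_sound Z') hb.
(* A pair that stays unreachable keeps its old hop value, which is bounded by assumption; an
   improved pair would be reachable. *)
rewrite /= /new_hop; case: ifP => // im; case/negP: nr.
have U' := updatable_sym U.
case: (improved_cases a b w Z x y) => [[v _ _ _]|[v _ _ _]|[_ _]]; last by rewrite im.
- have [q1 q2] := via_reach G v.
  by rewrite (dist_via G U v) !lte_add_pinfty // ltey.
- have [q1 q2] := via_reach G v.
  by rewrite -(davoid_swap S a b w) (dist_via G U' v) !lte_add_pinfty // ltey.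
Qed.

Definition enable (R : realDomainType) (l k : nat) (M : store R) : store R :=
  iteri k (fun j M' => new_store l M' j j 0%R) M.

Lemma init_bounded (R : realDomainType) n (G : wgraph R n) :
  bounded n (init_store G).
Proof.
split=> [x y|x y lx ly] /=; first by case: (x != y).
by rewrite /init_par; case: ifP => // _; case: ifP.
Qed.

(** The Floyd-Warshall induction: updating with [a = b = k] and weight 0 adds [k] to the admissible
    inner vertices and leaves the graph as it is. *)
Lemma enable_ok (R : realDomainType) n (G : wgraph R n) k :
  wgraph_ok G -> k <= n ->
  let M := enable (levels n) k (init_store G) in
  bounded n M /\
  exists S, [/\ good (fun v => v < k) S, linked G S & sound (levels n) S M].
Proof.
move=> ok; elim: k => [|k IH] lk /=.
  split; first exact: init_bounded.
  exists (init_system G); split; first exact: init_good.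
  - exact: init_linked.
  - exact: init_sound.
have [B [S [gS L Z]]] := IH (ltnW lk).
have U : updatable S k k 0%R (fun v => v < k) by split.
have Kn v : v < k -> v < n by move=> lv; apply: ltn_trans lk.
have [Z' B'] := step_sound gS Z B U Kn lk.
split=> //; exists (update S k k 0%R); split=> //.
  apply: good_ext (update_good gS U) => v /=; lia.
have [s ir _ _] := ok.
apply: (@linked_update _ _ G G S _ (Ordinal lk) (Ordinal lk) _ L gS U) => //.
- by rewrite eqxx.
- by move=> u v; left.
Qed.

Lemma represents_build (R : realDomainType) n (G : wgraph R n) :
  wgraph_ok G -> represents G (enable (levels n) n (init_store G)).
Proof. by move=> ok; apply: enable_ok. Qed.

(** The edge {a,b} is absent from [G], hence from all canonical paths, which consist of edges of
    [G]; this is the freshness that [updatable] demands. *)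
Lemma represents_insert (R : realDomainType) n (G : wgraph R n) M (a b : 'I_n) w :
  represents G M -> a != b -> ~~ edge G a b -> (0 <= w)%R ->
  represents (insert_edge G a b w) (new_store (levels n) M a b w).
Proof.
move=> [B [S [gS L Z]]] ne nab w0.
have nba : ~~ edge G b a by rewrite (linked_sym L).
have old u v : edge G u v -> same_pair a b u v = false.
  move=> e; apply/negP; rewrite same_pairE => /orP[]/andP[/eqP e1 /eqP e2].
    by move/negP: nab; apply; rewrite -(val_inj e1) -(val_inj e2).
  by move/negP: nba; apply; rewrite -(val_inj e1) -(val_inj e2).
have sp u v : same_pair a b u v = same_pair a b v u.
  by rewrite /same_pair setUC.
have U : updatable S a b w (fun v => v < n).
  split=> //; first by move/val_inj/eqP; rewrite (negbTE ne).
  move=> _ x y k r lk; have [u [v [e -> ->]]] := linked_vert L r lk.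
  by have := old _ _ e; rewrite same_pairE => ->.
have [Z' B'] := step_sound gS Z B U (fun _ => id) (ltn_ord a).
split=> //; exists (update S a b w); split=> //.
  by apply: good_ext (update_good gS U) => v /=; case: eqP => [->|] //=; rewrite ltn_ord.
apply: (@linked_update _ _ G _ S _ a b w L gS U) => //=.
- by move=> u v /=; rewrite (linked_sym L) sp.
- move=> u /=; rewrite (linked_irr L) /=; apply/negP; rewrite same_pairE.
  by case/orP => /andP[/eqP e1 /eqP e2]; move: ne; rewrite -(val_inj e1) -(val_inj e2) eqxx.
- by move=> u v e; rewrite e old.
- by rewrite /same_pair eqxx orbT setUC eqxx.
- by move=> u v /orP[|sp']; [left|right].
Qed.

(** * Answering a distance query for a failing edge *)

Section Answer.
Variables (R : realDomainType) (l : nat) (M : store R).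

(** An edge belongs to the tree of canonical paths from [u] exactly when one end is the parent of
    the other; it is then the last edge of the path to the child. *)
Definition answer (u v a b : nat) : \bar R :=
  if par M u b == a then query l M u v (hop M u a) b (hop M u b)
  else if par M u a == b then query l M u v (hop M u b) a (hop M u a)
  else dst M u v.

End Answer.

(** The failing segment is the single edge {a,b}, for which the two bounds of [sandwich]
    coincide. *)
Lemma query_parent (R : realDomainType) K (S : system R) l M u v a b :
  good K S -> sound l S M -> a <> b -> par M u b = a ->
  query l M u v (hop M u a) b (hop M u b) = davoid S (one_edge a b) u v.
Proof.
move=> G Z ne pa; have [r|] := ltP (dist S u b) +oo%E; last first.
  by rewrite leye_eq => /eqP /(par_unreachable Z) e; case: ne; rewrite -pa e.
have pb := par_sound Z r; rewrite pa in pb.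
have h0 : 0 < hops S u b.
  rewrite lt0n; apply/eqP => h0; case: ne.
  by rewrite pb h0 (vert0 G r) -(vert_hops G r) h0 (vert0 G r).
have lh : (hops S u b).-1 <= hops S u b by lia.
have [_ ha _] := vert_prefix G r lh; rewrite -pb in ha.
rewrite !(hop_sound Z) ha.
have := sandwich_query G Z v (hops S u b).-1 (hops S u b) r.
rewrite minnn => sq.
have e s t : avoids (segment S u b (hops S u b).-1 (hops S u b)) s t =
             avoids (one_edge a b) s t.
  have vb : vert S u b (hops S u b).-1.+1 = b.
    by rewrite prednK // (vert_hops G r).
  apply/avoids_segmentP/idP => [[k lk]|].
    have -> : k = (hops S u b).-1 by lia.
    by rewrite vb -pb /avoids /one_edge => -[] [-> ->]; rewrite !eqxx ?orbT.
  move=> ab; exists (hops S u b).-1; first lia.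
  by rewrite vb -pb; case/orP: ab => /andP[/eqP -> /eqP ->]; auto.
have [_ s2 s3] := sandwich_ext G e sq.
apply/eqP; rewrite eq_le s3 /=; apply: s2.
by rewrite /avoids /one_edge !eqxx.
Qed.

Lemma answer_sound (R : realDomainType) K (S : system R) l M u v a b :
  good K S -> sound l S M -> a <> b ->
  answer l M u v a b = davoid S (one_edge a b) u v.
Proof.
move=> G Z ne; rewrite /answer; case: eqP => [pa|na].
  exact: (query_parent v G Z).
case: eqP => [pb|nb].
  rewrite (query_parent v G Z (nesym ne) pb); apply: (davoid_ext G) => s t.
  by rewrite /avoids /one_edge orbC andbC [X in _ || X]andbC.
rewrite (dst_sound Z); apply/esym.
have [r|] := ltP (dist S u v) +oo%E; last first.
  rewrite leye_eq => /eqP e; have := dist_le G (one_edge a b) u v.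
  by rewrite e leye_eq => /eqP.
(* Consecutive vertices on a canonical path from [u] are parent and child, so the path to [v] does
   not use the edge. *)
apply: (davoid_free G r) => k lk.
have lk' : k.+1 <= hops S u v by [].
have [r1 _] := reach_prefix G r lk'; have [_ h1 p1] := vert_prefix G r lk'.
have e : par M u (vert S u v k.+1) = vert S u v k.
  by rewrite (par_sound Z r1) h1 p1.
apply/negP => /orP[]/andP[/eqP e1 /eqP e2]; rewrite e1 e2 in e.
  by case: na; rewrite e.
by case: nb; rewrite e.
Qed.

Lemma answer_dist (R : realDomainType) n (G : wgraph R n) M (u v a b : 'I_n) :
  represents G M -> edge G a b ->
  is_dist (delete_edge G a b) u v (answer (levels n) M u v a b).
Proof.
move=> [_ [S [gS L Z]]] e.
have ne : (a : nat) <> b.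
  by move/val_inj => ab; rewrite ab (linked_irr L) in e.
rewrite (answer_sound _ _ gS Z ne); set I := one_edge a b.
have ue : usable G I =2 edge (delete_edge G a b).
  by move=> s t; rewrite /usable /= same_pairE.
split=> [p|/eqP fin].
  elim: p u => [|x p IH] u /=.
    by move=> _ <-; rewrite (davoid_refl gS) /path_length big_nil.
  case/andP=> ux pp lp; rewrite path_length_cons EFinD.
  apply: le_trans (davoid_tri gS I u v (ltn_ord x)) _; apply: leeD.
    by apply: (linked_edge L); rewrite ue.
  exact: IH.
have := @linked_path _ _ _ _ L I u v; rewrite ltey => /(_ fin)[p [pp lp ep]].
by exists p; split=> //; rewrite -(eq_path ue).
Qed.

(** * A language of bounded loops, its running time and its weakest preconditions *)

(** The only loop bounds, each kept in a fixed register; running times can thus be computed from the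
    syntax. *)
Inductive limit := LimN | LimL | LimN2 | LimN2L | LimN2L2.

Definition limit_reg (k : limit) : nat :=
  match k with
  | LimN => 0 | LimL => 5 | LimN2 => 6 | LimN2L => 7 | LimN2L2 => 8
  end.

Definition limit_val (n l : nat) (k : limit) : nat :=
  match k with
  | LimN => n | LimL => l | LimN2 => n * n | LimN2L => n * n * l
  | LimN2L2 => n * n * l * l
  end.

Inductive prog : Type :=
| PSkip
| PSet of nat & iexpr
| PWSet of nat & wexpr
| PStore of iexpr & iexpr
| PWStore of iexpr & wexpr
| PSeq of prog & prog
| PIf of bexpr & prog & prog
| PFor of nat & limit & prog.

Fixpoint compile (p : prog) : cmd :=
  match p with
  | PSkip => Skip
  | PSet r e => ISet r e
  | PWSet r e => WSet r e
  | PStore e1 e2 => IStore e1 e2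
  | PWStore e1 e2 => WStore e1 e2
  | PSeq p1 p2 => Seq (compile p1) (compile p2)
  | PIf b p1 p2 => If b (compile p1) (compile p2)
  | PFor r k q =>
      Seq (ISet r (INum 0))
        (While (BNot (BILe (IReg (limit_reg k)) (IReg r)))
           (Seq (compile q) (ISet r (IAdd (IReg r) (INum 1)))))
  end.

(** A conditional is charged for both branches, which makes the bound independent of the state. In a
    loop, 7 = 2 + 5 pays for the initialisation and the failing test, and 9 per round for the test
    and the increment. *)
Fixpoint time (n l : nat) (p : prog) : nat :=
  match p with
  | PSkip => 1
  | PSet _ e => (icost e).+1
  | PWSet _ e => (wcost e).+1
  | PStore e1 e2 => (icost e1 + icost e2).+1
  | PWStore e1 e2 => (icost e1 + wcost e2).+1
  | PSeq p1 p2 => time n l p1 + time n l p2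
  | PIf b p1 p2 => (bcost b + (time n l p1 + time n l p2)).+1
  | PFor _ k q => limit_val n l k * (time n l q + 9) + 7
  end.

Fixpoint iwrites (p : prog) : seq nat :=
  match p with
  | PSet r _ => [:: r]
  | PSeq p1 p2 | PIf _ p1 p2 => iwrites p1 ++ iwrites p2
  | PFor r _ q => r :: iwrites q
  | _ => [::]
  end.

Fixpoint wwrites (p : prog) : seq nat :=
  match p with
  | PWSet r _ => [:: r]
  | PSeq p1 p2 | PIf _ p1 p2 => wwrites p1 ++ wwrites p2
  | PFor _ _ q => wwrites q
  | _ => [::]
  end.

Fixpoint istores (p : prog) : bool :=
  match p with
  | PStore _ _ => true
  | PSeq p1 p2 | PIf _ p1 p2 => istores p1 || istores p2
  | PFor _ _ q => istores q
  | _ => false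
  end.

Fixpoint wstores (p : prog) : bool :=
  match p with
  | PWStore _ _ => true
  | PSeq p1 p2 | PIf _ p1 p2 => wstores p1 || wstores p2
  | PFor _ _ q => wstores q
  | _ => false
  end.

(* A bound, as a power of the register capacity [V], on the value of an
   expression; constants are kept below 5. *)
Fixpoint ideg (e : iexpr) : nat :=
  match e with
  | INum k => if k < 5 then 1 else 100
  | IReg _ => 1
  | ILoad e1 => maxn 1 (ideg e1)
  | IAdd e1 e2 => (maxn (ideg e1) (ideg e2)).+1
  | IMul e1 e2 => ideg e1 + ideg e2
  | ISub e1 e2 | IDiv e1 e2 | IMod e1 e2 => maxn (ideg e1) (ideg e2)
  end.

Fixpoint wdeg (e : wexpr) : nat :=
  match e with
  | WLoad e1 => ideg e1
  | WAdd e1 e2 => maxn (wdeg e1) (wdeg e2)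
  | _ => 1
  end.

Fixpoint bdeg (e : bexpr) : nat :=
  match e with
  | BILe e1 e2 => maxn (ideg e1) (ideg e2)
  | BWLe e1 e2 => maxn (wdeg e1) (wdeg e2)
  | BNot e1 => bdeg e1
  | BAnd e1 e2 => maxn (bdeg e1) (bdeg e2)
  end.

(** A loop body may write neither its counter nor its limit, so the number of rounds is fixed on
    entry. *)
Fixpoint well_formed (A : nat) (p : prog) : bool :=
  match p with
  | PSkip => true
  | PSet _ e => ideg e <= A
  | PWSet _ e => wdeg e <= A
  | PStore e1 e2 => maxn (ideg e1) (ideg e2) <= A
  | PWStore e1 e2 => maxn (ideg e1) (wdeg e2) <= A
  | PSeq p1 p2 => well_formed A p1 && well_formed A p2
  | PIf b p1 p2 => [&& bdeg b <= A, well_formed A p1 & well_formed A p2]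
  | PFor r k q => [&& well_formed A q, r \notin iwrites q,
                      limit_reg k \notin iwrites q & r != limit_reg k]
  end.

Section Semantics.
Variables (R : realDomainType) (n l V A S : nat).

Definition set_ireg (r x : nat) (s : state R) : state R :=
  State [eta ireg s with r |-> x] (wreg s) (imem s) (wmem s).

Definition set_wreg (r : nat) (x : \bar R) (s : state R) : state R :=
  State (ireg s) [eta wreg s with r |-> x] (imem s) (wmem s).

Definition set_imem (i x : nat) (s : state R) : state R :=
  State (ireg s) (wreg s) [eta imem s with i |-> x] (wmem s).

Definition set_wmem (i : nat) (x : \bar R) (s : state R) : state R :=
  State (ireg s) (wreg s) (imem s) [eta wmem s with i |-> x].

Fixpoint iden (s : state R) (e : iexpr) : nat :=
  match e with
  | INum k => k
  | IReg r => ireg s r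
  | ILoad e1 => imem s (iden s e1)
  | IAdd e1 e2 => iden s e1 + iden s e2
  | ISub e1 e2 => iden s e1 - iden s e2
  | IMul e1 e2 => iden s e1 * iden s e2
  | IDiv e1 e2 => iden s e1 %/ iden s e2
  | IMod e1 e2 => iden s e1 %% iden s e2
  end.

Fixpoint iadr (s : state R) (e : iexpr) : Prop :=
  match e with
  | INum _ | IReg _ => True
  | ILoad e1 => iadr s e1 /\ iden s e1 < S
  | IAdd e1 e2 | ISub e1 e2 | IMul e1 e2 | IDiv e1 e2 | IMod e1 e2 =>
      iadr s e1 /\ iadr s e2
  end.

Fixpoint wden (s : state R) (e : wexpr) : \bar R :=
  match e with
  | WZero => 0%E
  | WInf => +oo%E
  | WReg r => wreg s r
  | WLoad e1 => wmem s (iden s e1)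
  | WAdd e1 e2 => (wden s e1 + wden s e2)%E
  end.

Fixpoint wadr (s : state R) (e : wexpr) : Prop :=
  match e with
  | WLoad e1 => iadr s e1 /\ iden s e1 < S
  | WAdd e1 e2 => wadr s e1 /\ wadr s e2
  | _ => True
  end.

Fixpoint bden (s : state R) (e : bexpr) : bool :=
  match e with
  | BILe e1 e2 => iden s e1 <= iden s e2
  | BWLe e1 e2 => (wden s e1 <= wden s e2)%E
  | BNot e1 => ~~ bden s e1
  | BAnd e1 e2 => bden s e1 && bden s e2
  end.

Fixpoint badr (s : state R) (e : bexpr) : Prop :=
  match e with
  | BILe e1 e2 => iadr s e1 /\ iadr s e2
  | BWLe e1 e2 => wadr s e1 /\ wadr s e2
  | BNot e1 => badr s e1
  | BAnd e1 e2 => badr s e1 /\ badr s e2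
  end.

Definition frame (p : prog) (s s' : state R) : Prop :=
  [/\ forall r, r \notin iwrites p -> ireg s' r = ireg s r,
      forall r, r \notin wwrites p -> wreg s' r = wreg s r,
      ~~ istores p -> imem s' = imem s &
      ~~ wstores p -> wmem s' = wmem s].

(* Weakest precondition; integer overflow inside expressions is excluded
   separately, by [well_formed]. *)
Fixpoint wp (p : prog) (s : state R) (Q : state R -> Prop) : Prop :=
  match p with
  | PSkip => Q s
  | PSet r e => [/\ iadr s e, iden s e < V & Q (set_ireg r (iden s e) s)]
  | PWSet r e => wadr s e /\ Q (set_wreg r (wden s e) s)
  | PStore e1 e2 =>
      [/\ iadr s e1 /\ iden s e1 < S, iadr s e2, iden s e2 < V &
          Q (set_imem (iden s e1) (iden s e2) s)]
  | PWStore e1 e2 =>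
      [/\ iadr s e1 /\ iden s e1 < S, wadr s e2 &
          Q (set_wmem (iden s e1) (wden s e2) s)]
  | PSeq p1 p2 => wp p1 s (fun s' => wp p2 s' Q)
  | PIf b p1 p2 => badr s b /\ (if bden s b then wp p1 s Q else wp p2 s Q)
  | PFor r k q =>
      ireg s (limit_reg k) = limit_val n l k /\
      exists Inv : nat -> state R -> Prop,
        [/\ Inv 0 (set_ireg r 0 s),
            forall i t, i < limit_val n l k -> frame (PFor r k q) s t ->
              ireg t r = i -> Inv i t ->
              wp q t (fun t' => Inv i.+1 (set_ireg r i.+1 t')) &
            forall t, frame (PFor r k q) s t -> Inv (limit_val n l k) t -> Q t]
  end.

Lemma frame_refl p s : frame p s s.
Proof. by []. Qed.

Lemma frame_trans p s t u : frame p s t -> frame p t u -> frame p s u.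
Proof.
move=> [a1 a2 a3 a4] [b1 b2 b3 b4]; split.
- by move=> r h; rewrite b1 ?a1.
- by move=> r h; rewrite b2 ?a2.
- by move=> h; rewrite b3 ?a3.
- by move=> h; rewrite b4 ?a4.
Qed.

Lemma frame_sub p q s t :
  {subset iwrites p <= iwrites q} -> {subset wwrites p <= wwrites q} ->
  (istores p -> istores q) -> (wstores p -> wstores q) ->
  frame p s t -> frame q s t.
Proof.
move=> s1 s2 s3 s4 [a1 a2 a3 a4]; split.
- by move=> r h; apply: a1; apply: contra h => /s1.
- by move=> r h; apply: a2; apply: contra h => /s2.
- by move=> h; apply: a3; apply: contra h => /s3.
- by move=> h; apply: a4; apply: contra h => /s4.
Qed.

Lemma frame_ireg p r x s : r \in iwrites p -> frame p s (set_ireg r x s).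
Proof.
move=> rp; split=> // r' nr /=; case: eqP => // e.
by move: nr; rewrite e rp.
Qed.

Lemma wp_mono p s (Q Q' : state R -> Prop) :
  (forall t, Q t -> Q' t) -> wp p s Q -> wp p s Q'.
Proof.
elim: p s Q Q' => [|r e|r e|e1 e2|e1 e2|p1 IH1 p2 IH2|b p1 IH1 p2 IH2|r k q IH]
  s Q Q' H /=; try by [case; auto | case=> ? ? ?; split; auto | auto].
- by apply: IH1 => t; apply: IH2.
- by case=> ?; case: (bden s b) => h; split=> //; [apply: IH1 h|apply: IH2 h].
- by case=> h [Inv [h1 h2 h3]]; split=> //; exists Inv; split; auto.
Qed.

(** Postconditions need only mention what changes; everything a program does not syntactically write
    is recovered here. *)
Lemma wp_frame p s Q : wp p s Q -> wp p s (fun t => frame p s t /\ Q t).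
Proof.
elim: p s Q => [|r e|r e|e1 e2|e1 e2|p1 IH1 p2 IH2|b p1 IH1 p2 IH2|r k q IH]
  s Q /=.
- by [].
- by case=> *; do !split=> //; move=> r' /=; rewrite inE => /negbTE ->.
- by case=> *; do !split=> //; move=> r' /=; rewrite inE => /negbTE ->.
- by case=> -[? ?] *; do !split.
- by case=> -[? ?] *; do !split.
- move/IH1; apply: wp_mono => t [f1 /IH2]; apply: wp_mono => u [f2 q].
  split=> //; apply: (frame_trans (t := t)).
    by apply: frame_sub f1 => // [r|r|/=|/=]; rewrite ?mem_cat => ->.
  by apply: frame_sub f2 => // [r|r|/=|/=]; rewrite ?mem_cat => ->; rewrite orbT.
- case=> h; case: (bden s b) => /[dup] h' => [/IH1|/IH2] h2; split=> //.
    apply: wp_mono h2 => t [f q]; split=> //.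
    by apply: frame_sub f => // [r|r|/=|/=]; rewrite ?mem_cat => ->.
  apply: wp_mono h2 => t [f q]; split=> //.
  by apply: frame_sub f => // [r|r|/=|/=]; rewrite ?mem_cat => ->; rewrite orbT.
- by case=> h [Inv [h1 h2 h3]]; split=> //; exists Inv; split; auto.
Qed.

Lemma wp_call p s Q (Q' : state R -> Prop) :
  wp p s Q -> (forall t, frame p s t -> Q t -> Q' t) -> wp p s Q'.
Proof. by move/wp_frame=> h H; apply: wp_mono h => t []; apply: H. Qed.

(** Only stored integers stay below [V]; intermediate values of expressions may grow up to [V ^ A],
    as bounded by [ideg]. *)
Definition in_range (s : state R) : Prop :=
  (forall r, ireg s r < V) /\ (forall i, imem s i < V).

Hypothesis V_gt4 : 4 < V.
Hypothesis A_range : 0 < A < 100.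
Hypothesis limit_lt : forall k, limit_val n l k < V.

Lemma ideg_gt0 e : 0 < ideg e.
Proof.
by elim: e => [k|r|e IH|e1 h1 e2 h2|e1 h1 e2 h2|e1 h1 e2 h2|e1 h1 e2 h2|e1 h1 e2 h2]
  /=; try (case: ifP => _); lia.
Qed.

Lemma iden_lt s e : in_range s -> ideg e <= A -> iden s e < V ^ ideg e.
Proof.
case=> ir im; have V0 : 0 < V by lia.
have mono i j : i <= j -> V ^ i <= V ^ j by move=> ?; rewrite leq_pexp2l.
elim: e => [k|r|e IH|e1 IH1 e2 IH2|e1 IH1 e2 IH2|e1 IH1 e2 IH2|e1 IH1 e2 IH2|e1 IH1 e2 IH2] /= le.
- by move: le; case: ifP => [lk _|_ lt]; rewrite ?expn1; lia.
- by rewrite expn1.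
- apply: leq_trans (im _) _; rewrite -{1}(expn1 V); apply: mono; lia.
- have {}IH1 := IH1 _; have {}IH2 := IH2 _; rewrite expnS.
  have q1 : iden s e1 < V ^ maxn (ideg e1) (ideg e2).
    by apply: leq_trans (IH1 _) (mono _ _ _); lia.
  have q2 : iden s e2 < V ^ maxn (ideg e1) (ideg e2).
    by apply: leq_trans (IH2 _) (mono _ _ _); lia.
  by apply: leq_trans (_ : 2 * V ^ maxn (ideg e1) (ideg e2) <= _);
    [lia|rewrite leq_mul2r; lia].
- by apply: leq_ltn_trans (leq_subr _ _) (leq_trans (IH1 _) (mono _ _ _)); lia.
- rewrite expnD.
  have := IH1 _; have := IH2 _ => h2 h1; apply: ltn_mul; [apply: h1|apply: h2]; lia.
- by apply: leq_ltn_trans (leq_div _ _) (leq_trans (IH1 _) (mono _ _ _)); lia.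
- by apply: leq_ltn_trans (leq_mod _ _) (leq_trans (IH1 _) (mono _ _ _)); lia.
Qed.

Lemma iden_cap s e : in_range s -> ideg e <= A -> iden s e < V ^ A.
Proof.
move=> w le; apply: leq_trans (iden_lt w le) _.
by rewrite leq_pexp2l //; lia.
Qed.

Lemma ievalE s e : in_range s -> ideg e <= A -> iadr s e ->
  ieval (V ^ A) S s e = Some (iden s e).
Proof.
move=> w; elim: e => [k|r|e IH|e1 IH1 e2 IH2|e1 IH1 e2 IH2|e1 IH1 e2 IH2|e1 IH1 e2 IH2|e1 IH1 e2 IH2] le.
- by have := iden_cap w le; rewrite /= /guard => ->.
- by [].
- case=> h1 h2; rewrite /= IH //=; first by rewrite /guard h2.
  by move: le => /=; lia.
all: by move=> -[h1 h2]; have := iden_cap w le;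
  rewrite /= IH1 ?IH2 //=; try (by move: le => /=; have := ideg_gt0 e1; have := ideg_gt0 e2; lia);
  rewrite /guard => ->.
Qed.

Lemma wevalE s e : in_range s -> wdeg e <= A -> wadr s e ->
  weval (V ^ A) S s e = Some (wden s e).
Proof.
move=> w; elim: e => //= [e|e1 IH1 e2 IH2] le [h1 h2].
  by rewrite ievalE //= /guard h2.
by rewrite IH1 ?IH2 //; lia.
Qed.

Lemma bevalE s e : in_range s -> bdeg e <= A -> badr s e ->
  beval (V ^ A) S s e = Some (bden s e).
Proof.
move=> w; elim: e => /= [e1 e2|e1 e2|e IH|e1 IH1 e2 IH2] le.
- by case=> h1 h2; rewrite !ievalE //; lia.
- by case=> h1 h2; rewrite !wevalE //; lia.
- by move=> h; rewrite IH.
- by case=> h1 h2; rewrite IH1 ?IH2 //; lia.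
Qed.

Lemma in_range_ireg r x s : in_range s -> x < V -> in_range (set_ireg r x s).
Proof. by case=> h1 h2 lx; split=> //= r'; case: eqP. Qed.

(** Soundness of [wp]: the degree bounds rule out overflow, the preconditions rule out bad
    addresses, and the counters bound the time. *)
Lemma exec_wp p s Q : well_formed A p -> in_range s -> wp p s Q ->
  exists s' t, [/\ exec (V ^ A) S (compile p) s s' t, t <= time n l p,
                   in_range s' & Q s'].
Proof.
elim: p s Q => [|r e|r e|e1 e2|e1 e2|p1 IH1 p2 IH2|b p1 IH1 p2 IH2|r k q IH]
  s Q /= wf w.
- by move=> h; exists s, 1; split=> //; constructor.
- case=> h1 h2 h3; exists (set_ireg r (iden s e) s), (icost e).+1; split=> //.
    by apply: ExecISet; rewrite ievalE.
  exact: in_range_ireg.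
- case=> h1 h2; exists (set_wreg r (wden s e) s), (wcost e).+1; split=> //.
  by apply: ExecWSet; rewrite wevalE.
- case=> -[h1 h2] h3 h4 h5; exists (set_imem (iden s e1) (iden s e2) s), (icost e1 + icost e2).+1.
  split=> //; first by apply: ExecIStore; rewrite ?ievalE //; lia.
  by case: w => w1 w2; split=> //= i; case: eqP.
- case=> -[h1 h2] h3 h4; exists (set_wmem (iden s e1) (wden s e2) s), (icost e1 + wcost e2).+1.
  by split=> //; apply: ExecWStore; rewrite ?ievalE ?wevalE //; lia.
- case/andP: wf => wf1 wf2 /(IH1 _ _ wf1 w)[s1 [t1 [x1 l1 w1]]].
  move/(IH2 _ _ wf2 w1)=> [s2 [t2 [x2 l2 w2 q]]].
  exists s2, (t1 + t2); split=> //; last exact: leq_add.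
  exact: ExecSeq x1 x2.
- case/and3P: wf => wb wf1 wf2 [hb]; case eb: (bden s b) => h.
    have [s1 [t1 [x1 l1 w1 q]]] := IH1 _ _ wf1 w h.
    exists s1, (bcost b + t1).+1; split=> //; last by lia.
    by apply: (@ExecIf _ _ _ b true); rewrite ?bevalE ?eb.
  have [s1 [t1 [x1 l1 w1 q]]] := IH2 _ _ wf2 w h.
  exists s1, (bcost b + t1).+1; split=> //; last by lia.
  by apply: (@ExecIf _ _ _ b false); rewrite ?bevalE ?eb.
case/and4P: wf => wf nr nk rk [lim [Inv [I0 Istep Iend]]].
set N := limit_val n l k in lim Istep Iend *.
have NV : N < V := limit_lt k.
have VA : V <= V ^ A by rewrite -{1}(expn1 V) leq_pexp2l //; lia.
set body := Seq (compile q) _; set cond := BNot _.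
(* Induction on the number [m] of remaining rounds; the frame guarantees that the limit register
   still holds [N]. *)
have loop m i t : m + i = N -> frame (PFor r k q) s t -> in_range t ->
    ireg t r = i -> Inv i t ->
    exists s' u, [/\ exec (V ^ A) S (While cond body) t s' u,
      u <= m * (time n l q + 9) + 5, in_range s' & Q s'].
  elim: m i t => [|m IHm] i t mi f wt tr It.
    have tk : ireg t (limit_reg k) = N.
      have [f1 _ _ _] := f; rewrite f1 //= inE negb_or nk andbT eq_sym.
      by [].
    exists t, 5; split=> //; last by apply: Iend => //; rewrite -mi add0n.
    by apply: ExecWhileF; rewrite /= tk tr -mi leqnn.
  have tk : ireg t (limit_reg k) = N.
    have [f1 _ _ _] := f; rewrite f1 //= inE negb_or nk andbT eq_sym.
    by [].
  have iN : i < N by lia.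
  have := Istep i t iN f tr It => /wp_frame /(IH _ _ wf wt)[t' [u [x lu wt' [f' I']]]].
  have r' : ireg t' r = i by case: f' => f1 _ _ _; rewrite f1.
  set t2 := set_ireg r i.+1 t'.
  have w2 : in_range t2 by apply: in_range_ireg => //; lia.
  have f2 : frame (PFor r k q) s t2.
    apply: (frame_trans f); apply: (frame_trans (t := t')).
      by apply: frame_sub f' => // z zq; rewrite inE zq orbT.
    by apply: frame_ireg; rewrite inE eqxx.
  have [||s' [u' [x' lu' ws' q']]] := IHm i.+1 t2 _ f2 w2 _ I'; first by lia.
    by rewrite /= eqxx.
  exists s', (4 + (u + 4) + u').+1; split=> //; last by lia.
  apply: (ExecWhileT (s2 := t2) (t1 := u + 4)) => //.
    by rewrite /= tk tr leqNgt iN.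
  apply: ExecSeq x _.
  have ev : ieval (V ^ A) S t' (IAdd (IReg r) (INum 1)) = Some i.+1.
    rewrite /= /guard; have -> : 1 < V ^ A by lia.
    by rewrite /= r' addn1; have -> : i.+1 < V ^ A by lia.
  exact: (ExecISet r ev).
have w0 : in_range (set_ireg r 0 s) by apply: in_range_ireg => //; lia.
have f0 : frame (PFor r k q) s (set_ireg r 0 s).
  by apply: frame_ireg; rewrite inE eqxx.
have r0 : ireg (set_ireg r 0 s) r = 0 by rewrite /= eqxx.
have [s' [u [x lu ws q']]] := loop N 0 _ (addn0 N) f0 w0 r0 I0.
exists s', (2 + u); split=> //; last by lia.
apply: ExecSeq x; apply: (@ExecISet _ _ _ r (INum 0)).
by rewrite /= /guard expn_gt0; have -> : 0 < V by lia.
Qed.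

End Semantics.

(** * The code of the table operations *)

(** Memory layout, with N = n^2 and l levels. Integers: [l] at 0, hops from 1, scratch for new
    parents from 1 + N and for new hops from 1 + 2N, jump tables from 1 + 3N. Weights: distances
    from 0, their scratch from N, entries from 2N, their scratch from 2N + N l^2. Registers 0, 5, 6,
    7, 8 hold n, l, N, N l, N l^2. *)
Definition cell (x y : iexpr) : iexpr := IAdd (IMul x (IReg 0)) y.

Definition load_dst (x y : iexpr) : wexpr := WLoad (cell x y).

Definition load_hop (x y : iexpr) : iexpr := ILoad (IAdd (INum 1) (cell x y)).

Notation jump_base := (IAdd (INum 1) (IMul (INum 3) (IReg 6))).

Definition load_jump (i x y : iexpr) : iexpr :=
  ILoad (IAdd jump_base (IAdd (IMul i (IReg 6)) (cell x y))).

Definition load_ent (x y i j : iexpr) : wexpr :=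
  WLoad (IAdd (IMul (INum 2) (IReg 6))
           (IAdd (IMul (IAdd (IMul i (IReg 5)) j) (IReg 6)) (cell x y))).


Definition seqs (ps : seq prog) (p : prog) : prog := foldr PSeq p ps.

(** Binary lifting: the digits of the distance in register 12 are consumed from the lowest, each 1
    triggering a jump of the vertex in register 11. *)
Definition anc_code : prog :=
  PFor 13 LimL
    (PSeq (PIf (BILe (INum 1) (IMod (IReg 12) (INum 2)))
             (PSet 11 (load_jump (IReg 13) (IReg 10) (IReg 11))) PSkip)
          (PSet 12 (IDiv (IReg 12) (INum 2)))).

Definition at_pos_code : prog :=
  PSeq (PSet 12 (ISub (load_hop (IReg 10) (IReg 11)) (IReg 12))) anc_code.

Definition at_pos_call (x y : nat) (k : iexpr) (out : nat) : prog :=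
  seqs [:: PSet 12 k; PSet 10 (IReg x); PSet 11 (IReg y); at_pos_code]
       (PSet out (IReg 11)).

Definition depth_code : prog :=
  seqs [:: PSet 24 (INum 1);
           PFor 27 LimL (PSet 24 (IAdd (IReg 24) (IReg 24)));
           PSet 23 (INum 0)]
    (PFor 27 LimL
      (seqs [:: PSet 24 (IDiv (IReg 24) (INum 2));
                PSet 25 (IAdd (IReg 23) (IReg 24))]
        (PIf (BAnd (BILe (IReg 25) (load_hop (IReg 20) (IReg 21)))
                   (BILe (IReg 25) (load_hop (IReg 20) (IReg 22))))
          (seqs [:: at_pos_call 20 21 (IReg 25) 26;
                    at_pos_call 20 22 (IReg 25) 28]
            (PIf (BAnd (BILe (IReg 26) (IReg 28)) (BILe (IReg 28) (IReg 26)))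
               (PSet 23 (IReg 25)) PSkip))
          PSkip))).

Definition log2_code : prog :=
  seqs [:: PSet 29 (INum 0); PSet 30 (INum 1)]
    (PFor 31 LimL
      (PIf (BILe (IAdd (IReg 30) (IReg 30)) (IReg 28))
         (PSeq (PSet 29 (IAdd (IReg 29) (INum 1)))
               (PSet 30 (IAdd (IReg 30) (IReg 30))))
         PSkip)).

Definition pow2_code : prog :=
  PSeq (PSet 33 (INum 1))
    (PFor 34 LimL
      (PIf (BILe (IAdd (IReg 34) (INum 1)) (IReg 32))
         (PSet 33 (IAdd (IReg 33) (IReg 33))) PSkip)).

Definition min_code (r t : nat) : prog :=
  PIf (BWLe (WReg r) (WReg t)) PSkip (PWSet r (WReg t)).

Definition max_code (r t : nat) : prog :=
  PIf (BWLe (WReg t) (WReg r)) PSkip (PWSet r (WReg t)).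

Definition lookup_code : prog :=
  let x := IReg 40 in let y := IReg 41 in
  let x' := IReg 48 in let y' := IReg 49 in
  let i := IReg 44 in let j := IReg 46 in
  seqs [:: PSet 28 (IAdd (IReg 42) (INum 1));
           log2_code;
           PSet 44 (IReg 29);
           PSet 45 (IReg 30);
           PSet 28 (IAdd (ISub (load_hop x y) (IReg 43)) (INum 1));
           log2_code;
           PSet 46 (IReg 29);
           PSet 47 (IReg 30);
           at_pos_call 40 41 (ISub (IAdd (IReg 42) (INum 1)) (IReg 45)) 48;
           at_pos_call 40 41 (ISub (IAdd (IReg 43) (IReg 47)) (INum 1)) 49;
           PWSet 1 (load_ent x y i j);
           PWSet 2 (WAdd (load_dst x x') (load_ent x' y i j));
           min_code 1 2;
           PWSet 2 (load_ent x y' i j);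
           PWSet 3 (WAdd (load_dst x x') (load_ent x' y' i j));
           min_code 2 3;
           PWSet 2 (WAdd (WReg 2) (load_dst y' y))]
    (min_code 1 2).

Definition query_code : prog :=
  seqs [:: PSet 20 (IReg 50); PSet 21 (IReg 51); PSet 22 (IReg 53);
           depth_code;
           PIf (BILe (IReg 23) (IReg 54)) PSkip (PSet 23 (IReg 54))]
    (PIf (BAnd (BNot (BILe (IReg 23) (IReg 52)))
               (BNot (BWLe WInf (load_dst (IReg 50) (IReg 51)))))
       (seqs [:: PSet 40 (IReg 50); PSet 41 (IReg 51); PSet 42 (IReg 52);
                 PSet 43 (IReg 23)] lookup_code)
       (PWSet 1 (load_dst (IReg 50) (IReg 51)))).

Definition query_call (x y k z m out : nat) : prog :=
  seqs [:: PSet 50 (IReg x); PSet 51 (IReg y); PSet 52 (IReg k);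
           PSet 53 (IReg z); PSet 54 (IReg m); query_code]
    (PWSet out (WReg 1)).

(** For [x], [y] in registers 66, 67: register 70 tells whether the pair improves, 71 and 72 receive
    the near and far ends, 73 the new hop count. Register 60 holds the truth value of [a != b]. *)
Definition dir_code : prog :=
  let x := IReg 66 in let y := IReg 67 in let a := IReg 1 in let b := IReg 2 in
  let through c d := WAdd (WAdd (load_dst x c) (WReg 0)) (load_dst d y) in
  seqs [:: PSet 70 (INum 0); PSet 71 a; PSet 72 b;
           PIf (BNot (BWLe (load_dst x y) (through a b)))
             (PSet 70 (INum 1))
             (PIf (BNot (BWLe (load_dst x y) (through b a)))
                (seqs [:: PSet 70 (INum 1); PSet 71 b] (PSet 72 a))
                PSkip)]
    (PIf (BILe (INum 1) (IReg 70))
       (PSet 73 (IAdd (IAdd (load_hop x (IReg 71)) (IReg 60))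
                      (load_hop (IReg 72) y)))
       (PSet 73 (load_hop x y))).

Definition ent_prepare : prog :=
  seqs [:: PSet 62 (IDiv (IReg 61) (IReg 6)); PSet 63 (IMod (IReg 61) (IReg 6));
           PSet 64 (IDiv (IReg 62) (IReg 5)); PSet 65 (IMod (IReg 62) (IReg 5));
           PSet 66 (IDiv (IReg 63) (IReg 0)); PSet 67 (IMod (IReg 63) (IReg 0));
           dir_code;
           PSet 32 (IReg 64); pow2_code; PSet 74 (ISub (IReg 33) (INum 1));
           PSet 32 (IReg 65); pow2_code; PSet 75 (ISub (IReg 33) (INum 1));
           PSet 76 (ISub (IReg 73) (IReg 74)); PSet 77 (ISub (IReg 73) (IReg 75))]
    (PIf (BILe (INum 1) (IReg 70))
       (PSeq (PSet 78 (IReg 71)) (PSet 79 (IReg 72)))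
       (PSeq (PSet 78 (IReg 67)) (PSet 79 (IReg 66)))).

Definition ent_combine : prog :=
  let hc := load_hop (IReg 66) (IReg 71) in
  seqs [:: query_call 66 67 74 78 77 10;
           query_call 67 66 75 79 76 11;
           query_call 66 71 74 78 77 12;
           query_call 67 72 75 79 76 13;
           query_call 66 72 74 78 77 14;
           query_call 67 71 75 79 76 15;
           PIf (BAnd (BAnd (BILe (INum 1) (IReg 70)) (BILe (INum 1) (IReg 60)))
                     (BAnd (BILe (IReg 74) hc)
                           (BILe (IAdd hc (INum 1)) (IReg 77))))
             (PWSet 16 WInf) (PWSet 16 (WReg 0));
           PIf (BILe (INum 1) (IReg 70)) (PWSet 17 WInf) (PWSet 17 (WReg 0));
           max_code 10 11;
           PWSet 12 (WAdd (WAdd (WReg 12) (WReg 16)) (WReg 13));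
           PWSet 14 (WAdd (WAdd (WReg 14) (WReg 17)) (WReg 15));
           min_code 12 14]
    (min_code 10 12).

Notation ent_base := (IAdd (IMul (INum 2) (IReg 6)) (IReg 8)).

(** Results go to a scratch area, since every entry is computed from the old tables. *)
Definition ent_code : prog :=
  PFor 61 LimN2L2
    (seqs [:: ent_prepare; ent_combine]
       (PWStore (IAdd ent_base (IReg 61)) (WReg 10))).

Definition vert_code : prog :=
  let x := IReg 66 in let y := IReg 67 in
  let c := IReg 71 in let d := IReg 72 in
  PFor 61 LimN2
    (seqs [:: PSet 66 (IDiv (IReg 61) (IReg 0)); PSet 67 (IMod (IReg 61) (IReg 0));
              dir_code;
              PIf (BILe (INum 1) (IReg 70))
                (PSeq (PWSet 10 (WAdd (WAdd (load_dst x c) (WReg 0)) (load_dst d y)))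
                   (PIf (BAnd (BILe y d) (BILe d y)) (PSet 80 c)
                      (PSet 80 (load_jump (INum 0) d y))))
                (PSeq (PWSet 10 (load_dst x y))
                   (PSet 80 (load_jump (INum 0) x y)));
              PWStore (IAdd (IReg 6) (IReg 61)) (WReg 10);
              PStore (IAdd (IAdd (INum 1) (IReg 6)) (IReg 61)) (IReg 80)]
       (PStore (IAdd (IAdd (INum 1) (IMul (INum 2) (IReg 6))) (IReg 61)) (IReg 73))).

(** Copies the scratch areas over the tables and rebuilds the jumps by doubling, level 0 being the
    new parents. *)
Definition commit_code : prog :=
  let k := IReg 61 in let n2 := IReg 6 in
  seqs [:: PFor 61 LimN2
             (PSeq (PWStore k (WLoad (IAdd n2 k)))
                (PStore (IAdd (INum 1) k)
                   (ILoad (IAdd (IAdd (INum 1) (IMul (INum 2) n2)) k))));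
           PFor 61 LimN2L2
             (PWStore (IAdd (IMul (INum 2) n2) k) (WLoad (IAdd ent_base k)))]
    (PFor 61 LimN2L
       (seqs [:: PSet 62 (IDiv k n2); PSet 63 (IMod k n2);
                 PIf (BILe (IReg 62) (INum 0))
                   (PSet 80 (ILoad (IAdd (IAdd (INum 1) n2) (IReg 63))))
                   (seqs [:: PSet 62 (ISub (IReg 62) (INum 1));
                             PSet 66 (IDiv (IReg 63) (IReg 0));
                             PSet 64 (ILoad (IAdd jump_base
                                        (IAdd (IMul (IReg 62) n2) (IReg 63))))]
                      (PSet 80 (load_jump (IReg 62) (IReg 66) (IReg 64))))]
          (PStore (IAdd jump_base k) (IReg 80)))).

Lemma frameI (R : realDomainType) p (s t : state R) r :
  frame p s t -> r \notin iwrites p -> ireg t r = ireg s r.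
Proof. by case=> + _ _ _ => H /H. Qed.

Lemma frameW (R : realDomainType) p (s t : state R) r :
  frame p s t -> r \notin wwrites p -> wreg t r = wreg s r.
Proof. by case=> _ + _ _ => H /H. Qed.

Definition reserved : seq nat := [:: 0; 5; 6; 7; 8].

Definition pure (p : prog) : bool :=
  [&& all (fun r => r \notin iwrites p) reserved, ~~ istores p & ~~ wstores p].

(** * Correctness of the code on a memory that holds the tables *)

Section Memory.
Variables (R : realDomainType) (n : nat).
Let l := levels n.
Implicit Types (s t u : state R) (Q : state R -> Prop).

Definition regs (s : state R) : Prop :=
  [/\ ireg s 0 = n, ireg s 5 = l, ireg s 6 = n * n, ireg s 7 = n * n * l &
      ireg s 8 = n * n * l * l].

Record stored (s : state R) (M : store R) : Prop := Stored {
  stored_hop : forall x y, x < n -> y < n ->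
    imem s (1 + (x * n + y)) = hop M x y;
  stored_jump : forall i x y, i < l -> x < n -> y < n ->
    imem s (1 + 3 * (n * n) + (i * (n * n) + (x * n + y))) =
    anc M x y (2 ^ i);
  stored_dst : forall x y, x < n -> y < n -> wmem s (x * n + y) = dst M x y;
  stored_ent : forall x y i j, x < n -> y < n -> i < l -> j < l ->
    wmem s (2 * (n * n) + ((i * l + j) * (n * n) + (x * n + y))) =
    ent M x y i j }.

Definition ctx (s : state R) (M : store R) : Prop := regs s /\ stored s M.

Lemma regs_set r v s : r \notin reserved -> regs s -> regs (set_ireg r v s).
Proof.
rewrite !inE !negb_or => /and5P[h0 h5 h6 h7 h8] [r0 r5 r6 r7 r8].
by split; rewrite /= eq_sym ?(negbTE h0) ?(negbTE h5) ?(negbTE h6)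
  ?(negbTE h7) ?(negbTE h8).
Qed.

Lemma ctx_set r v s M : r \notin reserved -> ctx s M -> ctx (set_ireg r v s) M.
Proof. by move=> h [rs [s1 s2 s3 s4]]; split; [exact: regs_set|split]. Qed.

Lemma ctx_wset r v s M : ctx s M -> ctx (set_wreg r v s) M.
Proof. by case=> [rs [s1 s2 s3 s4]]; split=> //; split. Qed.

Lemma ctx_frame p s t M : frame p s t -> pure p -> ctx s M -> ctx t M.
Proof.
case=> f1 f2 f3 f4 /and3P[/allP q1 q2 q3] [[r0 r5 r6 r7 r8] [s1 s2 s3 s4]].
by split; split; rewrite ?(f3 q2) ?(f4 q3) // f1 //; apply: q1.
Qed.

(** Exceeds every address of the layout and, being at least 8n + 8, every value the programs keep in
    registers. *)
Definition capacity : nat := 8 * (n * n * l * l) + 8.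

Lemma levels_gt1 : 1 < l. Proof. by []. Qed.

Lemma prod_chain : [/\ n <= n * n, n * n <= n * n * l & n * n * l <= n * n * l * l].
Proof.
have l0 := levels_gt1; split; try by rewrite leq_pmulr //; lia.
by case: (n) => // m; rewrite leq_pmulr.
Qed.

Lemma cell_lt x y : x < n -> y < n -> x * n + y < n * n.
Proof. by move=> lx ly; apply: leq_trans (_ : x.+1 * n <= _); [lia|rewrite leq_mul2r lx orbT]. Qed.

Lemma level_lt i k : i < l -> k < n * n -> i * (n * n) + k < n * n * l.
Proof.
move=> li lk; rewrite [n * n * l]mulnC.
by apply: leq_trans (_ : i.+1 * (n * n) <= _); [lia|rewrite leq_mul2r li orbT].
Qed.

Lemma level2_lt i j k : i < l -> j < l -> k < n * n ->
  (i * l + j) * (n * n) + k < n * n * l * l.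
Proof.
move=> li lj lk.
have h : i * l + j < l * l.
  by apply: leq_trans (_ : i.+1 * l <= _); [lia|rewrite leq_mul2r li orbT].
rewrite -mulnA [n * n * (l * l)]mulnC.
apply: leq_trans (_ : (i * l + j).+1 * (n * n) <= _); first lia.
by rewrite leq_mul2r h orbT.
Qed.

Lemma lev_bound : n.+1 < 2 ^ l. Proof. exact: levels_bound. Qed.

Lemma pow_levels : 2 ^ l <= 4 * n + 4.
Proof.
rewrite /l /levels !expnS; case: (n) => [//|m].
by have /andP[h _] := trunc_log_bounds (ltnSn 1) (ltn0Sn m); lia.
Qed.

Lemma lev_lt : l < 4 * n + 4.
Proof. by apply: leq_trans pow_levels; apply: ltn_expl. Qed.

Lemma pow_lt i : i < l -> 2 ^ i < 4 * n + 4.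
Proof. by move=> li; apply: leq_trans pow_levels; rewrite ltn_exp2l. Qed.

Lemma capacity_ge : 8 * n + 8 <= capacity.
Proof. by rewrite /capacity; have [h1 h2 h3] := prod_chain; lia. Qed.

Variables (V S : nat) (M : store R).
Hypotheses (leV : capacity <= V) (leS : capacity <= S) (B : bounded n M).
Notation wp := (wp n l V S).

Let V8 : 8 * n + 8 <= V. Proof. exact: leq_trans capacity_ge leV. Qed.
Let hop_le x y : hop M x y <= n.+1. Proof. by case: B. Qed.

Lemma anc_lt x y k : x < n -> y < n -> anc M x y k < n.
Proof. by move=> lx ly; elim: k => // k IH; rewrite /anc iterS; apply: B.2. Qed.

(** Value and absence of bad addresses together, so that [ev_tac] can evaluate code symbolically. *)
Definition ev (s : state R) (e : iexpr) (v : nat) : Prop :=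
  iadr S s e /\ iden s e = v.

Definition evw (s : state R) (e : wexpr) (v : \bar R) : Prop :=
  wadr S s e /\ wden s e = v.

Definition evb (s : state R) (b : bexpr) (v : bool) : Prop :=
  badr S s b /\ bden s b = v.

Lemma ev_num s k : ev s (INum k) k. Proof. by []. Qed.

Lemma ev_reg s r v : ireg s r = v -> ev s (IReg r) v. Proof. by []. Qed.

Lemma ev_add s e1 e2 v1 v2 : ev s e1 v1 -> ev s e2 v2 ->
  ev s (IAdd e1 e2) (v1 + v2).
Proof. by move=> [a1 <-] [a2 <-]. Qed.

Lemma ev_sub s e1 e2 v1 v2 : ev s e1 v1 -> ev s e2 v2 ->
  ev s (ISub e1 e2) (v1 - v2).
Proof. by move=> [a1 <-] [a2 <-]. Qed.

Lemma ev_mul s e1 e2 v1 v2 : ev s e1 v1 -> ev s e2 v2 ->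
  ev s (IMul e1 e2) (v1 * v2).
Proof. by move=> [a1 <-] [a2 <-]. Qed.

Lemma ev_div s e1 e2 v1 v2 : ev s e1 v1 -> ev s e2 v2 ->
  ev s (IDiv e1 e2) (v1 %/ v2).
Proof. by move=> [a1 <-] [a2 <-]. Qed.

Lemma ev_mod s e1 e2 v1 v2 : ev s e1 v1 -> ev s e2 v2 ->
  ev s (IMod e1 e2) (v1 %% v2).
Proof. by move=> [a1 <-] [a2 <-]. Qed.

Lemma ev_load s e a v : ev s e a -> a < S -> imem s a = v -> ev s (ILoad e) v.
Proof. by move=> [h <-] la <-. Qed.

Lemma evw_reg s r v : wreg s r = v -> evw s (WReg r) v. Proof. by []. Qed.

Lemma evw_inf s : evw s WInf +oo%E. Proof. by []. Qed.

Lemma evw_zero s : evw s WZero 0%E. Proof. by []. Qed.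

Lemma evw_add s e1 e2 (v1 v2 : \bar R) : evw s e1 v1 -> evw s e2 v2 ->
  evw s (WAdd e1 e2) (v1 + v2)%E.
Proof. by move=> [a1 <-] [a2 <-]. Qed.

Lemma evw_load s e a v : ev s e a -> a < S -> wmem s a = v -> evw s (WLoad e) v.
Proof. by move=> [h <-] la <-. Qed.

Lemma evb_le s e1 e2 v1 v2 : ev s e1 v1 -> ev s e2 v2 ->
  evb s (BILe e1 e2) (v1 <= v2).
Proof. by move=> [a1 <-] [a2 <-]. Qed.

Lemma evb_wle s e1 e2 (v1 v2 : \bar R) : evw s e1 v1 -> evw s e2 v2 ->
  evb s (BWLe e1 e2) (v1 <= v2)%E.
Proof. by move=> [a1 <-] [a2 <-]. Qed.

Lemma evb_not s b v : evb s b v -> evb s (BNot b) (~~ v).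
Proof. by move=> [a1 <-]. Qed.

Lemma evb_and s b1 b2 v1 v2 : evb s b1 v1 -> evb s b2 v2 ->
  evb s (BAnd b1 b2) (v1 && v2).
Proof. by move=> [a1 <-] [a2 <-]. Qed.

Lemma evb_flag s r (v : bool) : ireg s r = v -> evb s (BILe (INum 1) (IReg r)) v.
Proof. by move=> h; split=> //=; rewrite h; case: v {h}. Qed.

Lemma wp_set r e s Q v : ev s e v -> v < V -> Q (set_ireg r v s) ->
  wp (PSet r e) s Q.
Proof. by move=> [a <-]. Qed.

Lemma wp_wset r e s Q v : evw s e v -> Q (set_wreg r v s) -> wp (PWSet r e) s Q.
Proof. by move=> [a <-]. Qed.

Lemma wp_store e1 e2 s Q a v : ev s e1 a -> a < S -> ev s e2 v -> v < V ->
  Q (set_imem a v s) -> wp (PStore e1 e2) s Q.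
Proof. by move=> [h1 <-] la [h2 <-]. Qed.

Lemma wp_wstore e1 e2 s Q a v : ev s e1 a -> a < S -> evw s e2 v ->
  Q (set_wmem a v s) -> wp (PWStore e1 e2) s Q.
Proof. by move=> [h1 <-] la [h2 <-]. Qed.

Lemma wp_seq p1 p2 s Q : wp p1 s (fun t => wp p2 t Q) -> wp (PSeq p1 p2) s Q.
Proof. by []. Qed.

Lemma wp_then p1 p2 s P Q : wp p1 s P ->
  (forall t, frame p1 s t -> P t -> wp p2 t Q) -> wp (PSeq p1 p2) s Q.
Proof. exact: wp_call. Qed.

Lemma wp_if b p1 p2 s Q v : evb s b v -> (v -> wp p1 s Q) ->
  (~~ v -> wp p2 s Q) -> wp (PIf b p1 p2) s Q.
Proof.
by move=> [a e] h1 h2; split=> //; rewrite e; case: v h1 h2 {e}; auto.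
Qed.

Lemma limit_regE s k : regs s -> ireg s (limit_reg k) = limit_val n l k.
Proof. by case=> r0 r5 r6 r7 r8; case: k. Qed.

Lemma wp_for (Inv : nat -> state R -> Prop) r k q s Q : regs s ->
  Inv 0 (set_ireg r 0 s) ->
  (forall i t, i < limit_val n l k -> frame (PFor r k q) s t -> ireg t r = i ->
     Inv i t -> wp q t (fun t' => Inv i.+1 (set_ireg r i.+1 t'))) ->
  (forall t, frame (PFor r k q) s t -> Inv (limit_val n l k) t -> Q t) ->
  wp (PFor r k q) s Q.
Proof.
by move=> rs h0 h1 h2; split; [exact: limit_regE|exists Inv; split].
Qed.

Lemma ev_cell s x y vx vy : regs s -> ev s x vx -> ev s y vy ->
  ev s (cell x y) (vx * n + vy).
Proof. by case=> r0 _ _ _ _ hx hy; apply: ev_add => //; apply: ev_mul. Qed.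

Lemma evw_dst s x y vx vy : ctx s M -> ev s x vx -> ev s y vy -> vx < n ->
  vy < n -> evw s (load_dst x y) (dst M vx vy).
Proof.
move=> [rs st] hx hy lx ly; apply: evw_load (ev_cell rs hx hy) _ _.
  have := cell_lt lx ly; have [h1 h2 h3] := prod_chain.
  by move: leS; rewrite /capacity => h4 h5; lia.
exact: (stored_dst st).
Qed.

Lemma ev_hop s x y vx vy : ctx s M -> ev s x vx -> ev s y vy -> vx < n ->
  vy < n -> ev s (load_hop x y) (hop M vx vy).
Proof.
move=> [rs st] hx hy lx ly.
apply: ev_load (ev_add (ev_num _ _) (ev_cell rs hx hy)) _ _.
  have := cell_lt lx ly; have [h1 h2 h3] := prod_chain.
  by move: leS; rewrite /capacity => h4 h5; lia.
exact: (stored_hop st).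
Qed.

Lemma ev_jump s i x y vi vx vy : ctx s M -> ev s i vi -> ev s x vx ->
  ev s y vy -> vi < l -> vx < n -> vy < n ->
  ev s (load_jump i x y) (anc M vx vy (2 ^ vi)).
Proof.
move=> [rs st] hi hx hy li lx ly; have [_ _ r6 _ _] := rs.
have h6 : ev s (IReg 6) (n * n) by [].
apply: ev_load (ev_add (ev_add (ev_num _ _) (ev_mul (ev_num _ _) h6))
  (ev_add (ev_mul hi h6) (ev_cell rs hx hy))) _ _.
  have := level_lt li (cell_lt lx ly); have [h1 h2 h3] := prod_chain.
  by move: leS; rewrite /capacity => h4 h5; lia.
exact: (stored_jump st).
Qed.

Lemma evw_ent s x y i j vx vy vi vj : ctx s M -> ev s x vx -> ev s y vy ->
  ev s i vi -> ev s j vj -> vx < n -> vy < n -> vi < l -> vj < l ->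
  evw s (load_ent x y i j) (ent M vx vy vi vj).
Proof.
move=> [rs st] hx hy hi hj lx ly li lj; have [_ r5 r6 _ _] := rs.
have h6 : ev s (IReg 6) (n * n) by [].
have h5 : ev s (IReg 5) l by [].
apply: evw_load (ev_add (ev_mul (ev_num _ _) h6)
  (ev_add (ev_mul (ev_add (ev_mul hi h5) hj) h6) (ev_cell rs hx hy))) _ _.
  have := level2_lt li lj (cell_lt lx ly); have [h1 h2 h3] := prod_chain.
  by move: leS; rewrite /capacity => h4; lia.
exact: (stored_ent st).
Qed.

Ltac ctx_tac := repeat first
  [assumption | apply: ctx_wset | apply: ctx_set; first by []].

Ltac ev_tac := repeat first
  [ assumption
  | simple eapply ev_num | simple eapply ev_add | simple eapply ev_sub
  | simple eapply ev_mul | simple eapply ev_div | simple eapply ev_mod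
  | simple eapply evw_inf | simple eapply evw_zero | simple eapply evw_add
  | simple eapply evb_le | simple eapply evb_wle | simple eapply evb_not
  | simple eapply evb_and
  | eapply ev_hop; [by ctx_tac| | | |]
  | eapply ev_jump; [by ctx_tac| | | | | |]
  | eapply evw_dst; [by ctx_tac| | | |]
  | eapply evw_ent; [by ctx_tac| | | | | | | |]
  | simple eapply ev_reg; simpl; first [eassumption | reflexivity]
  | simple eapply evw_reg; simpl; first [eassumption | reflexivity] ].

Ltac step_set := apply: wp_seq; eapply wp_set; [ev_tac| |].
Ltac step_wset := apply: wp_seq; eapply wp_wset; [ev_tac|].

Lemma wp_anc s x y k : ctx s M -> ireg s 10 = x -> ireg s 11 = y ->
  ireg s 12 = k -> x < n -> y < n -> k < 2 ^ l ->
  wp anc_code s (fun t => ireg t 11 = anc M x y k).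
Proof.
move=> c sx sy sk lx ly lk.
apply: (wp_for (Inv := fun i t =>
  ireg t 12 = k %/ 2 ^ i /\ ireg t 11 = anc M x y (k %% 2 ^ i))).
- exact: c.1.
- by rewrite /= expn0 divn1 modn1.
- move=> i t li f ti [h12 h11]; rewrite /= in li.
  have ct : ctx t M by apply: ctx_frame f _ c.
  have tx : ireg t 10 = x by rewrite (frameI f).
  have la := anc_lt (k %% 2 ^ i) lx ly.
  (* The next binary digit of [k] decides whether to jump 2^i further. *)
  have ek : k %% 2 ^ i.+1 = (k %/ 2 ^ i %% 2) * 2 ^ i + k %% 2 ^ i.
    rewrite {1}(divn_eq k (2 ^ i)) {1}(divn_eq (k %/ 2 ^ i) 2) mulnDl -mulnA -expnS.
    rewrite -addnA modnMDl modn_small // expnS.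
    have := ltn_pmod k (_ : 0 < 2 ^ i); rewrite expn_gt0 => /(_ isT).
    by have := ltn_pmod (k %/ 2 ^ i) (isT : 0 < 2); nia.
  have q2 : k %/ 2 ^ i %/ 2 = k %/ 2 ^ i.+1 by rewrite expnS mulnC divnMA.
  have lkV : k %/ 2 ^ i.+1 < V.
    apply: leq_ltn_trans (leq_div _ _) _.
    by have := pow_levels; lia.
  apply: (wp_then (P := fun u => ireg u 11 = anc M x y (k %% 2 ^ i.+1))).
    eapply wp_if; first by ev_tac.
      move=> odd_k; eapply wp_set; first by ev_tac.
        by have := anc_lt (2 ^ i) lx la; lia.
      rewrite /= -[anc M x _ (2 ^ i)]iterD ek.
      by congr (iter _ _ _); have := ltn_pmod (k %/ 2 ^ i) (isT : 0 < 2); nia.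
    move=> even_k; rewrite /= h11 ek.
    by have -> : k %/ 2 ^ i %% 2 = 0 by lia.
  move=> u g u11; have u12 : ireg u 12 = k %/ 2 ^ i by rewrite (frameI g).
  eapply wp_set; [by ev_tac|by rewrite q2|].
  by rewrite /= q2.
- by move=> t f [_ ->]; rewrite modn_small.
Qed.

Lemma ireg_set_ne r v s r' : r' != r -> ireg (set_ireg r v s) r' = ireg s r'.
Proof. by rewrite /= => /negbTE ->. Qed.

Lemma wp_at_pos s x y k : ctx s M -> ireg s 10 = x -> ireg s 11 = y ->
  ireg s 12 = k -> x < n -> y < n ->
  wp at_pos_code s (fun t => ireg t 11 = at_pos M x y k).
Proof.
move=> c sx sy sk lx ly; have h := hop_le x y.
step_set; try done; first by lia.
apply: wp_anc => //; first by ctx_tac.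
by have := lev_bound; lia.
Qed.

Lemma wp_at_pos_call s rx ry e out x y k : ctx s M -> 13 < rx -> 13 < ry ->
  ireg s rx = x -> ireg s ry = y -> ev s e k -> k < V -> x < n -> y < n ->
  wp (at_pos_call rx ry e out) s (fun t => ireg t out = at_pos M x y k).
Proof.
move=> c hrx hry sx sy he lk lx ly.
have [n1 n2 n3] : [/\ rx != 12, ry != 12 & ry != 10] by split; lia.
apply: wp_seq; apply: (wp_set he lk).
apply: wp_seq; apply: (wp_set (v := x)); last 1 first.
- apply: wp_seq; apply: (wp_set (v := y)); last 1 first.
  + apply: (wp_then (P := fun t => ireg t 11 = at_pos M x y k)).
      by apply: wp_at_pos => //; ctx_tac.
    move=> t _ t11; eapply wp_set; first by ev_tac.
      have := anc_lt (hop M x y - k) lx ly; rewrite -/(at_pos M x y k).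
      by lia.
    by rewrite /= eqxx.
  + by apply: ev_reg; rewrite !ireg_set_ne.
  + by lia.
- by apply: ev_reg; rewrite ireg_set_ne.
- by lia.
Qed.

Lemma wp_depth s x y z : ctx s M -> ireg s 20 = x -> ireg s 21 = y ->
  ireg s 22 = z -> x < n -> y < n -> z < n ->
  wp depth_code s (fun t => ireg t 23 = depth l M x y z).
Proof.
move=> c sx sy sz lx ly lz; have pl := pow_levels.
have hy := hop_le x y; have hz := hop_le x z.
step_set; [by lia|].
apply: wp_seq; apply: (wp_for (Inv := fun i t => ireg t 24 = 2 ^ i)).
- by apply: regs_set => //; exact: c.1.
- by [].
- move=> i t li f ti h; rewrite /= in li; eapply wp_set; first by ev_tac.
    by have := pow_lt li; lia.
  by rewrite /= expnS mul2n -addnn.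
move=> t f t24; have ct : ctx t M.
  by apply: (ctx_frame f) => //; ctx_tac.
have [tx ty tz] : [/\ ireg t 20 = x, ireg t 21 = y & ireg t 22 = z].
  by split; rewrite (frameI f).
rewrite /= in t24; step_set; [by lia|].
(* After [i] rounds, [depth_rec] with [l - i] levels left still has the final value; the bound on
   register 23 prevents overflow. *)
apply: (wp_for (Inv := fun i u => ireg u 24 = 2 ^ (l - i) /\
   ireg u 23 <= n.+1 /\
   depth_rec M x y z (l - i) (ireg u 23) = depth l M x y z)).
- by apply: regs_set => //; exact: ct.1.
- by rewrite /= subn0.
- move=> i u li g ui [u24 [lc0 ud]]; rewrite /= in li; have cu : ctx u M.
    by apply: (ctx_frame g) => //; ctx_tac.
  have [ux uy uz] : [/\ ireg u 20 = x, ireg u 21 = y & ireg u 22 = z].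
    by split; rewrite (frameI g).
  have li' : l - i = (l - i.+1).+1 by lia.
  have e2 : 2 ^ (l - i) %/ 2 = 2 ^ (l - i.+1) by rewrite li' expnS mulKn.
  have lp : 2 ^ (l - i.+1) < 4 * n + 4 by apply: pow_lt; lia.
  have [c0 u23] : exists c0, ireg u 23 = c0 by exists (ireg u 23).
  rewrite li' /= u23 in ud; rewrite u23 in lc0.
  move: {li'} (2 ^ (l - i.+1)) lp e2 ud => pw lp e2 ud.
  step_set; [by rewrite e2; lia|]; rewrite e2.
  step_set; [by lia|].
  set u2 := set_ireg 25 _ _.
  have cu2 : ctx u2 M by rewrite /u2; ctx_tac.
  have [v20 v21 v22] : [/\ ireg u2 20 = x, ireg u2 21 = y & ireg u2 22 = z].
    by rewrite /u2.
  have v23 : ireg u2 23 = c0 by rewrite /u2.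
  have v24 : ireg u2 24 = pw by rewrite /u2.
  have v25 : ireg u2 25 = c0 + pw by rewrite /u2.
  apply: (wp_call (Q := fun v => ireg v 23 =
      if [&& c0 + pw <= hop M x y, c0 + pw <= hop M x z &
             at_pos M x y (c0 + pw) == at_pos M x z (c0 + pw)]
      then c0 + pw else c0)); last first.
    move=> v fv v23'; have v24' : ireg v 24 = pw by rewrite (frameI fv).
    split; first exact: v24'.
    rewrite /= v23' ud; split=> //; case: ifP => // /and3P[h1 _ _]; lia.
  eapply wp_if; first by ev_tac.
    case/andP=> h1 h2; rewrite h1 h2 !andTb.
    apply: (wp_then (P := fun v => ireg v 26 = at_pos M x y (c0 + pw))).
      by apply: wp_at_pos_call => //; lia.
    move=> v fv v26; have cv : ctx v M by apply: (ctx_frame fv).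
    apply: (wp_then (P := fun v' => ireg v' 28 = at_pos M x z (c0 + pw))).
      by apply: wp_at_pos_call => //; try lia; rewrite ?(frameI fv) //;
        apply: ev_reg; rewrite (frameI fv).
    move=> v' fv' v28; have v26' : ireg v' 26 = at_pos M x y (c0 + pw).
      by rewrite (frameI fv').
    have v25' : ireg v' 25 = c0 + pw by rewrite (frameI fv') // (frameI fv).
    have v23' : ireg v' 23 = c0 by rewrite (frameI fv') // (frameI fv).
    eapply wp_if; first by ev_tac.
      move=> h; rewrite eqn_leq h; eapply wp_set; [by ev_tac|by lia|by []].
    by move=> /negbTE h; rewrite eqn_leq h.
  by case/nandP=> /negbTE -> //=; rewrite ?andbF.
- by move=> u g [_ [_ <-]]; rewrite /= subnn.
Qed.

Lemma wp_log2 s k : ctx s M -> ireg s 28 = k -> 0 < k -> k < 2 ^ l ->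
  wp log2_code s (fun t => ireg t 29 = log2 k /\ ireg t 30 = 2 ^ log2 k).
Proof.
move=> c sk k0 lk; have pl := pow_levels.
have /andP[k1 k2] := log2P k0.
have lt_l : log2 k < l by rewrite -(ltn_exp2l _ _ (ltnSn 1)); lia.
step_set; [by lia|]; step_set; [by lia|].
apply: (wp_for (Inv := fun i t => ireg t 29 = minn i (log2 k) /\
   ireg t 30 = 2 ^ minn i (log2 k))).
- by do 2![apply: regs_set => //]; exact: c.1.
- by rewrite /= min0n.
- move=> i t li f ti [t29 t30]; rewrite /= in li.
  have tk : ireg t 28 = k by rewrite (frameI f).
  eapply wp_if; first by ev_tac.
    move=> le; have lt : i < log2 k.
      rewrite ltnNge; apply/negP => lei; move: le.
      by rewrite (minn_idPr lei); lia.
    have mi : minn i (log2 k) = i by lia.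
    have mi1 : minn i.+1 (log2 k) = i.+1 by lia.
    step_set; [by have := lev_lt; lia|]; eapply wp_set; [by ev_tac| |].
      by rewrite mi; have := pow_lt (ltn_trans lt lt_l); lia.
    by rewrite /= mi mi1 addn1 expnS mul2n addnn.
  move=> nle; have lei : log2 k <= i.
    rewrite leqNgt; apply/negP => lt; case/negP: nle.
    have -> : minn i (log2 k) = i by lia.
    rewrite addnn -mul2n -expnS; apply: leq_trans k1.
    by rewrite leq_exp2l.
  rewrite /= t29 t30; have -> : minn i.+1 (log2 k) = minn i (log2 k) by lia.
  by [].
- by move=> t f /= []; have -> : minn l (log2 k) = log2 k by lia.
Qed.

Lemma wp_pow2 s i : ctx s M -> ireg s 32 = i -> i < l ->
  wp pow2_code s (fun t => ireg t 33 = 2 ^ i).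
Proof.
move=> c si li; step_set; [by lia|].
apply: (wp_for (Inv := fun m t => ireg t 33 = 2 ^ minn m i)).
- by apply: regs_set => //; exact: c.1.
- by rewrite /= min0n.
- move=> m t lm f tm t33; rewrite /= in lm; have ti : ireg t 32 = i by rewrite (frameI f).
  eapply wp_if; first by ev_tac.
    move=> le; have [e1 e2] : minn m i = m /\ minn m.+1 i = m.+1 by lia.
    eapply wp_set; [by ev_tac| |]; rewrite e1.
      by have := pow_lt lm; lia.
    by rewrite /= e2 expnS mul2n addnn.
  by move=> nle; rewrite /= t33; congr (2 ^ _); lia.
- by move=> t f /= ->; congr (2 ^ _); lia.
Qed.

Lemma wp_min s r r' a b : wreg s r = a -> wreg s r' = b ->
  wp (min_code r r') s (fun t => wreg t r = Order.min a b).
Proof.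
move=> ha hb; eapply wp_if; first by ev_tac.
  by move=> le /=; rewrite ha min_l.
rewrite -ltNge => lt; eapply wp_wset; first by ev_tac.
by rewrite /= eqxx min_r // ltW.
Qed.

Lemma wp_max s r r' a b : wreg s r = a -> wreg s r' = b ->
  wp (max_code r r') s (fun t => wreg t r = Order.max a b).
Proof.
move=> ha hb; eapply wp_if; first by ev_tac.
  by move=> le /=; rewrite ha max_l.
rewrite -ltNge => lt; eapply wp_wset; first by ev_tac.
by rewrite /= eqxx max_r // ltW.
Qed.

Lemma wp_lookup s x y k1 k2 : ctx s M -> ireg s 40 = x -> ireg s 41 = y ->
  ireg s 42 = k1 -> ireg s 43 = k2 -> x < n -> y < n -> k1 < k2 ->
  k2 <= hop M x y ->
  wp lookup_code s (fun t => wreg t 1 = lookup M x y k1 k2).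
Proof.
move=> c s40 s41 s42 s43 lx ly l1 l2.
have h := hop_le x y; have lv := lev_bound; have ll := lev_lt; have pl := pow_levels.
rewrite /lookup; set i := log2 k1.+1; set j := log2 (hop M x y - k2).+1.
have /andP[i1 i2] : 2 ^ i <= k1.+1 < 2 * 2 ^ i by apply: log2P.
have /andP[j1 j2] : 2 ^ j <= (hop M x y - k2).+1 < 2 * 2 ^ j by apply: log2P.
have li : i < l by rewrite -(ltn_exp2l _ _ (ltnSn 1)); lia.
have lj : j < l by rewrite -(ltn_exp2l _ _ (ltnSn 1)); lia.
step_set; [by lia|]; rewrite addn1.
apply: (wp_then (P := fun t => ireg t 29 = i /\ ireg t 30 = 2 ^ i)).
  by apply: wp_log2 => //; [ctx_tac|lia].
move=> t1 f1 [t29 t30]; have c1 : ctx t1 M by apply: (ctx_frame f1) => //; ctx_tac.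
have [a40 a41 a42 a43] :
  [/\ ireg t1 40 = x, ireg t1 41 = y, ireg t1 42 = k1 & ireg t1 43 = k2].
  by split; rewrite (frameI f1).
step_set; [by lia|]; step_set; [by lia|]; step_set; try by []; try by lia.
rewrite addn1.
apply: (wp_then (P := fun t => ireg t 29 = j /\ ireg t 30 = 2 ^ j)).
  by apply: wp_log2 => //; [ctx_tac|lia].
move=> t2 f2 [u29 u30]; have c2 : ctx t2 M by apply: (ctx_frame f2) => //; ctx_tac.
have [b40 b41 b42 b43] :
  [/\ ireg t2 40 = x, ireg t2 41 = y, ireg t2 42 = k1 & ireg t2 43 = k2].
  by split; rewrite (frameI f2).
have [b44 b45] : ireg t2 44 = i /\ ireg t2 45 = 2 ^ i.
  by split; rewrite (frameI f2).
step_set; [by lia|]; step_set; [by lia|].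
set x' := at_pos M x y (k1.+1 - 2 ^ i).
apply: (wp_then (P := fun t => ireg t 48 = x')).
  by apply: wp_at_pos_call => //; [ctx_tac|rewrite -[k1.+1]addn1; ev_tac|lia].
move=> t3 f3 d48; have c3 : ctx t3 M by apply: (ctx_frame f3) => //; ctx_tac.
have [d40 d41 d42 d43] :
  [/\ ireg t3 40 = x, ireg t3 41 = y, ireg t3 42 = k1 & ireg t3 43 = k2].
  by split; rewrite (frameI f3).
have [d44 d46 d47] : [/\ ireg t3 44 = i, ireg t3 46 = j & ireg t3 47 = 2 ^ j].
  by split; rewrite (frameI f3).
set y' := at_pos M x y (k2 + 2 ^ j).-1.
apply: (wp_then (P := fun t => ireg t 49 = y')).
  by apply: wp_at_pos_call => //; [rewrite -[(k2 + 2 ^ j).-1]subn1; ev_tac|lia].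
move=> t4 f4 e49; have c4 : ctx t4 M by apply: (ctx_frame f4).
have [e40 e41] : ireg t4 40 = x /\ ireg t4 41 = y by split; rewrite (frameI f4).
have [e44 e46 e48] : [/\ ireg t4 44 = i, ireg t4 46 = j & ireg t4 48 = x'].
  by split; rewrite (frameI f4).
have lx' : x' < n by apply: anc_lt.
have ly' : y' < n by apply: anc_lt.
step_wset; try by []; step_wset; try by [].
apply: (wp_then (P := fun t => wreg t 1 = Order.min (ent M x y i j)
    (dst M x x' + ent M x' y i j)%E)); first exact: wp_min.
move=> t5 f5 w1; have c5 : ctx t5 M by apply: (ctx_frame f5) => //; ctx_tac.
have [g40 g41] : ireg t5 40 = x /\ ireg t5 41 = y by split; rewrite (frameI f5).
have [g44 g46 g48 g49] :
  [/\ ireg t5 44 = i, ireg t5 46 = j, ireg t5 48 = x' & ireg t5 49 = y'].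
  by split; rewrite (frameI f5).
step_wset; try by []; step_wset; try by [].
apply: (wp_then (P := fun t => wreg t 2 = Order.min (ent M x y' i j)
    (dst M x x' + ent M x' y' i j)%E)); first exact: wp_min.
move=> t6 f6 w2; have c6 : ctx t6 M by apply: (ctx_frame f6) => //; ctx_tac.
have [k41 k49] : ireg t6 41 = y /\ ireg t6 49 = y' by split; rewrite (frameI f6).
have w1' : wreg t6 1 = Order.min (ent M x y i j)
    (dst M x x' + ent M x' y i j)%E by rewrite (frameW f6).
step_wset; try by [].
exact: wp_min.
Qed.

Lemma depth_le x y z : depth l M x y z <= hop M x y.
Proof.
rewrite /depth; elim: {1}l 0 (leq0n (hop M x y)) => //= i IH c lc.
by apply: IH; case: ifP => // /and3P[].
Qed.

Lemma wp_query s x y k z m : ctx s M -> ireg s 50 = x -> ireg s 51 = y ->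
  ireg s 52 = k -> ireg s 53 = z -> ireg s 54 = m -> x < n -> y < n -> z < n ->
  m < V -> wp query_code s (fun t => wreg t 1 = query l M x y k z m).
Proof.
move=> c s50 s51 s52 s53 s54 lx ly lz lm; have h := hop_le x y.
have dl := depth_le x y z; have ld : depth l M x y z < V by lia.
step_set; [by lia|]; step_set; [by lia|]; step_set; [by lia|].
apply: (wp_then (P := fun t => ireg t 23 = depth l M x y z)).
  by apply: wp_depth => //; ctx_tac.
move=> t f t23; have ct : ctx t M by apply: (ctx_frame f) => //; ctx_tac.
have [t50 t51 t52] : [/\ ireg t 50 = x, ireg t 51 = y & ireg t 52 = k].
  by split; rewrite (frameI f).
have t54 : ireg t 54 = m by rewrite (frameI f).
set d := minn (depth l M x y z) m.
apply: (wp_then (P := fun u => ireg u 23 = d)).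
  eapply wp_if; first by ev_tac.
    by move=> le /=; rewrite t23 /d (minn_idPl le).
  rewrite -ltnNge => lt; eapply wp_set; [by ev_tac|by []|].
  by rewrite /= /d (minn_idPr (ltnW lt)).
move=> u g u23; have cu : ctx u M by apply: (ctx_frame g).
have [u50 u51 u52] : [/\ ireg u 50 = x, ireg u 51 = y & ireg u 52 = k].
  by split; rewrite (frameI g).
rewrite /query -/d.
have dh : d <= hop M x y by apply: leq_trans (geq_minl _ _) dl.
apply: (wp_if (v := ~~ (d <= k) && ~~ (+oo <= dst M x y)%E)).
- by ev_tac.
- case/andP=> /negbTE ndk /negbTE noo; rewrite ndk noo.
  have kd : k < d by rewrite ltnNge ndk.
  step_set; [by lia|]; step_set; [by lia|]; step_set; [by lia|].
  step_set; [by lia|].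
  by apply: wp_lookup => //; ctx_tac.
- rewrite -negb_or negbK => ->; eapply wp_wset; first by ev_tac.
  by [].
Qed.

Lemma wp_query_call s rx ry rk rz rm out x y k z m : ctx s M ->
  [/\ 54 < rx, 54 < ry, 54 < rk, 54 < rz & 54 < rm] ->
  ireg s rx = x -> ireg s ry = y -> ireg s rk = k -> ireg s rz = z ->
  ireg s rm = m -> x < n -> y < n -> z < n -> k < V -> m < V ->
  wp (query_call rx ry rk rz rm out) s
    (fun t => wreg t out = query l M x y k z m).
Proof.
move=> c [hx hy hk hz hm] sx sy sk sz sm lx ly lz lk lm.
apply: wp_seq; apply: (wp_set (v := x)); [exact: ev_reg|lia|].
apply: wp_seq; apply: (wp_set (v := y)); [|lia|].
  by apply: ev_reg; rewrite !ireg_set_ne //; lia.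
apply: wp_seq; apply: (wp_set (v := k)); [|lia|].
  by apply: ev_reg; rewrite !ireg_set_ne //; lia.
apply: wp_seq; apply: (wp_set (v := z)); [|lia|].
  by apply: ev_reg; rewrite !ireg_set_ne //; lia.
apply: wp_seq; apply: (wp_set (v := m)); [|lia|].
  by apply: ev_reg; rewrite !ireg_set_ne //; lia.
apply: (wp_then (P := fun t => wreg t 1 = query l M x y k z m)).
  by apply: wp_query => //; ctx_tac.
move=> t _ t1; eapply wp_wset; first by ev_tac.
by rewrite /= eqxx.
Qed.

Lemma frame_high p s t : frame p s t -> all (fun r => r < 55) (iwrites p) ->
  forall r, 55 <= r -> ireg t r = ireg s r.
Proof.
move=> f /allP h r hr; apply: (frameI f); apply/negP => /h.
by rewrite ltnNge hr.
Qed.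

(** * Computing the new tables into scratch memory *)

Section Rewire.
Variables (a b : nat) (w : R).
Hypotheses (la : a < n) (lb : b < n).

Definition args s : Prop :=
  [/\ ireg s 1 = a, ireg s 2 = b, ireg s 60 = (a != b) & wreg s 0 = w%:E].

Definition rewired s x y : Prop :=
  [/\ ireg s 70 = improved M a b w x y, ireg s 71 = near_end M a b w x y,
      ireg s 72 = far_end M a b w x y & ireg s 73 = new_hop M a b w x y].

Lemma near_end_lt x y : near_end M a b w x y < n.
Proof. by rewrite /near_end; case: ifP => // _; case: ifP. Qed.

Lemma far_end_lt x y : far_end M a b w x y < n.
Proof. by rewrite /far_end; case: ifP => // _; case: ifP. Qed.

Lemma new_hop_le x y : new_hop M a b w x y <= 2 * n + 3.
Proof.
rewrite /new_hop; have h1 := hop_le x (near_end M a b w x y).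
have h2 := hop_le (far_end M a b w x y) y; have h3 := hop_le x y.
by case: ifP => _; case: (a != b) => /=; lia.
Qed.

Lemma wp_dir s x y : ctx s M -> args s -> ireg s 66 = x -> ireg s 67 = y ->
  x < n -> y < n -> wp dir_code s (fun t => rewired t x y).
Proof.
move=> c [s1 s2 s60 w0] sx sy lx ly; have l8 := V8.
step_set; [by lia|]; step_set; [by lia|]; step_set; [by lia|].
apply: (wp_then (P := fun t => [/\ ireg t 70 = improved M a b w x y,
    ireg t 71 = near_end M a b w x y & ireg t 72 = far_end M a b w x y])).
  rewrite /improved /near_end /far_end.
  apply: (wp_if (v := shortcut M w a b x y)).
  - by rewrite /shortcut ltNge; ev_tac.
  - by move=> ->; eapply wp_set; [ev_tac|lia|].
  move/negbTE=> ->; apply: (wp_if (v := shortcut M w b a x y)).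
  - by rewrite /shortcut ltNge; ev_tac.
  - move=> ->; step_set; [by lia|]; step_set; [by lia|].
    by eapply wp_set; [ev_tac|lia|].
  - by move/negbTE=> ->.
move=> t f [t70 t71 t72]; have ct : ctx t M.
  by apply: (ctx_frame f) => //; ctx_tac.
have [tx ty t60] : [/\ ireg t 66 = x, ireg t 67 = y & ireg t 60 = (a != b)].
  by split; rewrite (frameI f).
have lc := near_end_lt x y; have ld := far_end_lt x y.
have hl := new_hop_le x y; rewrite /rewired; rewrite /new_hop in hl *.
apply: (wp_if (v := improved M a b w x y)).
- exact: evb_flag.
- move=> im; rewrite im in t70 hl *; eapply wp_set; [by ev_tac|by lia|by []].
- move/negbTE=> im; rewrite im in t70 hl *; eapply wp_set; [by ev_tac|by lia|by []].
Qed.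

Definition prepared s x y i j : Prop :=
  let k1 := (2 ^ i).-1 in let k2 := (2 ^ j).-1 in
  [/\ rewired s x y, ireg s 66 = x /\ ireg s 67 = y,
      ireg s 74 = k1 /\ ireg s 75 = k2,
      ireg s 76 = new_hop M a b w x y - k1 /\
      ireg s 77 = new_hop M a b w x y - k2 &
      ireg s 78 = (if improved M a b w x y then near_end M a b w x y else y) /\
      ireg s 79 = (if improved M a b w x y then far_end M a b w x y else x)].

Lemma wp_ent_prepare s k : ctx s M -> args s -> ireg s 61 = k ->
  k < n * n * l * l ->
  wp ent_prepare s (fun t => prepared t (k %% (n * n) %/ n) (k %% (n * n) %% n)
                               (k %/ (n * n) %/ l) (k %/ (n * n) %% l)).
Proof.
move=> c ar sk lk; have l8 := V8; have lv := lev_lt.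
have [r0 r5 r6 _ _] := c.1; have [s1 s2 s60 w0] := ar.
have n0 : 0 < n by case: (n) lk; rewrite ?mul0n.
have n20 : 0 < n * n by rewrite muln_gt0 n0.
have l0 : 0 < l by [].
have ly : k %% (n * n) %% n < n by rewrite ltn_mod.
have lx : k %% (n * n) %/ n < n by rewrite ltn_divLR // ltn_mod.
have lj : k %/ (n * n) %% l < l by rewrite ltn_mod.
have li : k %/ (n * n) %/ l < l.
  by rewrite !ltn_divLR //; apply: leq_trans lk _; rewrite !mulnA; lia.
have pc := prod_chain; have lV : 8 * (n * n * l * l) + 8 <= V by exact: leV.
have h1 : k %/ (n * n) < V by apply: leq_ltn_trans (leq_div _ _) _; lia.
have h2 : k %% (n * n) < V by apply: leq_ltn_trans (leq_mod _ _) _; lia.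
have [ij e1] : exists ij, k %/ (n * n) = ij by exists (k %/ (n * n)).
have [xy e2] : exists xy, k %% (n * n) = xy by exists (k %% (n * n)).
rewrite e1 in h1 li lj *; rewrite e2 in h2 lx ly *.
set x := xy %/ n in lx *; set y := xy %% n in ly *.
set i := ij %/ l in li *; set j := ij %% l in lj *.
step_set; [by rewrite e1|]; rewrite e1; step_set; [by rewrite e2|]; rewrite e2.
step_set; [by lia|]; step_set; [by lia|]; step_set; [by lia|]; step_set; [by lia|].
apply: (wp_then (P := fun t => rewired t x y)).
  by apply: wp_dir => //; ctx_tac.
move=> t f [t70 t71 t72 t73]; have ct : ctx t M.
  by apply: (ctx_frame f) => //; ctx_tac.
have [tx ty] : ireg t 66 = x /\ ireg t 67 = y by split; rewrite (frameI f).
have [ti tj] : ireg t 64 = i /\ ireg t 65 = j by split; rewrite (frameI f).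
have hl := new_hop_le x y; have pi := pow_lt li; have pj := pow_lt lj.
have lc := near_end_lt x y; have ld := far_end_lt x y.
step_set; [by lia|].
apply: (wp_then (P := fun t => ireg t 33 = 2 ^ i)).
  by apply: wp_pow2 => //; ctx_tac.
move=> u g u33; have cu : ctx u M by apply: (ctx_frame g) => //; ctx_tac.
have [ux uy uj] : [/\ ireg u 66 = x, ireg u 67 = y & ireg u 65 = j].
  by split; rewrite (frameI g).
have [u70 u71 u72 u73] : rewired u x y by split; rewrite (frameI g).
step_set; [by lia|]; rewrite subn1; step_set; [by lia|].
apply: (wp_then (P := fun t => ireg t 33 = 2 ^ j)).
  by apply: wp_pow2 => //; ctx_tac.
move=> v q v33; have cv : ctx v M by apply: (ctx_frame q) => //; ctx_tac.
have [vx vy v74] : [/\ ireg v 66 = x, ireg v 67 = y & ireg v 74 = (2 ^ i).-1].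
  by split; rewrite (frameI q).
have [v70 v71 v72 v73] : rewired v x y by split; rewrite (frameI q).
step_set; [by lia|]; rewrite subn1; step_set; [by lia|]; step_set; [by lia|].
eapply wp_if; first by apply: evb_flag; exact: v70.
  move=> im; step_set; [by lia|]; eapply wp_set; [by ev_tac|by lia|].
  by rewrite /prepared im.
move=> /negbTE im; step_set; [by lia|]; eapply wp_set; [by ev_tac|by lia|].
by rewrite /prepared im.
Qed.

Lemma wp_ent_combine s x y i j : ctx s M -> args s -> prepared s x y i j ->
  x < n -> y < n -> i < l -> j < l ->
  wp ent_combine s (fun t => wreg t 10 = new_ent l M a b w x y i j).
Proof.
move=> c [s1 s2 s60 w0] [[s70 s71 s72 s73] [s66 s67] [s74 s75] [s76 s77] [s78 s79]].
move=> lx ly li lj; rewrite /new_ent.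
have hl := new_hop_le x y; have pi := pow_lt li; have pj := pow_lt lj.
have lc := near_end_lt x y; have ld := far_end_lt x y; have l8 := V8.
move: (near_end M a b w x y) (far_end M a b w x y) s71 s72 s78 s79 lc ld.
move=> e1 e2 s71 s72 s78 s79 lc ld.
set k1 := (2 ^ i).-1 in s74 s76 *; set k2 := (2 ^ j).-1 in s75 s77 *.
set m1 := new_hop M a b w x y - k1 in s76 *.
set m2 := new_hop M a b w x y - k2 in s77 *.
set zx := if _ then e1 else y in s78 *; set zy := if _ then e2 else x in s79 *.
have lzx : zx < n by rewrite /zx; case: ifP.
have lzy : zy < n by rewrite /zy; case: ifP.
have [b1 b2] : k1 < V /\ k2 < V by rewrite /k1 /k2; lia.
have [b3 b4] : m1 < V /\ m2 < V by rewrite /m1 /m2; lia.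
have call t rx ry rk rz rm out vx vy vk vz vm :
    ctx t M -> (forall r, 55 <= r -> ireg t r = ireg s r) ->
    [&& 54 < rx, 54 < ry, 54 < rk, 54 < rz & 54 < rm] ->
    ireg s rx = vx -> ireg s ry = vy -> ireg s rk = vk -> ireg s rz = vz ->
    ireg s rm = vm -> vx < n -> vy < n -> vz < n -> vk < V -> vm < V ->
    wp (query_call rx ry rk rz rm out) t
      (fun u => wreg u out = query l M vx vy vk vz vm).
  move=> ct ht /and5P[h1 h2 h3 h4 h5] q1 q2 q3 q4 q5 q6 q7 q8 q9 q10.
  by apply: wp_query_call => //; rewrite ht.
have next p t u : ctx t M -> (forall r, 55 <= r -> ireg t r = ireg s r) ->
    frame p t u -> pure p -> all (fun r => r < 55) (iwrites p) ->
    ctx u M /\ forall r, 55 <= r -> ireg u r = ireg s r.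
  move=> ct ht f pp hp; split; first exact: ctx_frame f pp ct.
  by move=> r hr; rewrite (frame_high f hp) ?ht.
have h0 r : 55 <= r -> ireg s r = ireg s r by [].
apply: (wp_then (call s 66 67 74 78 77 10 _ _ _ _ _ c h0 isT s66 s67 s74 s78 s77
  lx ly lzx b1 b4)) => t1 f1 g10.
have [c1 h1] := next _ _ _ c h0 f1 isT isT; have q0 := frameW f1 (isT : 0 \notin wwrites (query_call 66 67 74 78 77 10)).
apply: (wp_then (call t1 67 66 75 79 76 11 _ _ _ _ _ c1 h1 isT s67 s66 s75 s79 s76
  ly lx lzy b2 b3)) => t2 f2 g11.
have [c2 h2] := next _ _ _ c1 h1 f2 isT isT.
apply: (wp_then (call t2 66 71 74 78 77 12 _ _ _ _ _ c2 h2 isT s66 s71 s74 s78 s77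
  lx lc lzx b1 b4)) => t3 f3 g12.
have [c3 h3] := next _ _ _ c2 h2 f3 isT isT.
apply: (wp_then (call t3 67 72 75 79 76 13 _ _ _ _ _ c3 h3 isT s67 s72 s75 s79 s76
  ly ld lzy b2 b3)) => t4 f4 g13.
have [c4 h4] := next _ _ _ c3 h3 f4 isT isT.
apply: (wp_then (call t4 66 72 74 78 77 14 _ _ _ _ _ c4 h4 isT s66 s72 s74 s78 s77
  lx ld lzx b1 b4)) => t5 f5 g14.
have [c5 h5] := next _ _ _ c4 h4 f5 isT isT.
apply: (wp_then (call t5 67 71 75 79 76 15 _ _ _ _ _ c5 h5 isT s67 s71 s75 s79 s76
  ly lc lzy b2 b3)) => t6 f6 g15.
have [c6 h6] := next _ _ _ c5 h5 f6 isT isT.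
have k10 : wreg t6 10 = query l M x y k1 zx m2.
  by rewrite (frameW f6) // (frameW f5) // (frameW f4) // (frameW f3) // (frameW f2).
have k11 : wreg t6 11 = query l M y x k2 zy m1.
  by rewrite (frameW f6) // (frameW f5) // (frameW f4) // (frameW f3).
have k12 : wreg t6 12 = query l M x e1 k1 zx m2.
  by rewrite (frameW f6) // (frameW f5) // (frameW f4).
have k13 : wreg t6 13 = query l M y e2 k2 zy m1.
  by rewrite (frameW f6) // (frameW f5).
have k14 : wreg t6 14 = query l M x e2 k1 zx m2 by rewrite (frameW f6).
have kw0 : wreg t6 0 = w%:E.
  by rewrite (frameW f6) // (frameW f5) // (frameW f4) // (frameW f3) //
     (frameW f2) // q0.
have [k60 k70 k71] : [/\ ireg t6 60 = (a != b),
   ireg t6 70 = improved M a b w x y & ireg t6 71 = e1] by split; rewrite h6.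
have [k66 k74 k77] : [/\ ireg t6 66 = x, ireg t6 74 = k1 & ireg t6 77 = m2].
  by split; rewrite h6.
set w1 := if [&& _, _, _ & _] then _ else _.
apply: (wp_then (P := fun t => wreg t 16 = w1)).
  apply: (wp_if (v := [&& improved M a b w x y, a != b, k1 <= hop M x e1 &
                          hop M x e1 < m2])).
  - rewrite andbA; apply: evb_and; first by apply: evb_and; exact: evb_flag.
    by rewrite -[hop M x e1 < m2]/((hop M x e1).+1 <= m2) -[(hop M x e1).+1]addn1; ev_tac.
  - by move=> h; eapply wp_wset; [ev_tac|]; rewrite /= /w1 h.
  - by move=> /negbTE h; eapply wp_wset; [ev_tac|]; rewrite /= /w1 h.
move=> t7 f7 k16; set w2 := if improved _ _ _ _ _ _ then _ else _.
have k0' : wreg t7 0 = w%:E by rewrite (frameW f7).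
apply: (wp_then (P := fun t => wreg t 17 = w2)).
  apply: (wp_if (v := improved M a b w x y)).
  - by apply: evb_flag; rewrite (frameI f7).
  - by move=> h; eapply wp_wset; [ev_tac|]; rewrite /= /w2 h.
  - by move=> /negbTE h; eapply wp_wset; [ev_tac|]; rewrite /= /w2 h.
move=> t8 f8 k17.
have [m10 m11] : wreg t8 10 = query l M x y k1 zx m2 /\
    wreg t8 11 = query l M y x k2 zy m1.
  by split; rewrite (frameW f8) // (frameW f7).
apply: (wp_then (wp_max m10 m11)) => t9 f9 n10.
have n12 : wreg t9 12 = query l M x e1 k1 zx m2.
  by rewrite (frameW f9) // (frameW f8) // (frameW f7).
have n13 : wreg t9 13 = query l M y e2 k2 zy m1.
  by rewrite (frameW f9) // (frameW f8) // (frameW f7).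
have n14 : wreg t9 14 = query l M x e2 k1 zx m2.
  by rewrite (frameW f9) // (frameW f8) // (frameW f7).
have n15 : wreg t9 15 = query l M y e1 k2 zy m1.
  by rewrite (frameW f9) // (frameW f8) // (frameW f7).
have n16 : wreg t9 16 = w1 by rewrite (frameW f9) // (frameW f8).
have n17 : wreg t9 17 = w2 by rewrite (frameW f9).
step_wset; step_wset.
apply: (wp_then (P := fun t => wreg t 12 = Order.min
   (query l M x e1 k1 zx m2 + w1 + query l M y e2 k2 zy m1)%E
   (query l M x e2 k1 zx m2 + w2 + query l M y e1 k2 zy m1)%E)).
  exact: wp_min.
move=> t10 fa p12; apply: wp_min => //.
by rewrite (frameW fa).
Qed.

(** The live tables are untouched while scratch memory is being filled, so [ctx] for the old store
    persists through the loops. *)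
Definition keeps s t : Prop :=
  (forall c, c < 1 + n * n \/ 1 + 3 * (n * n) <= c -> imem t c = imem s c) /\
  (forall c, c < n * n \/ 2 * (n * n) <= c < 2 * (n * n) + n * n * l * l ->
     wmem t c = wmem s c).

Lemma ctx_keeps s t : ctx s M -> regs t -> keeps s t -> ctx t M.
Proof.
move=> [_ [h1 h2 h3 h4]] rt [k1 k2]; split=> //; split.
- by move=> x y lx ly; rewrite k1 ?h1 //; left; rewrite ltn_add2l cell_lt.
- by move=> i x y li lx ly; rewrite k1 ?h2 //; right; rewrite leq_addr.
- by move=> x y lx ly; rewrite k2 ?h3 //; left; rewrite cell_lt.
- move=> x y i j lx ly li lj; rewrite k2 ?h4 //; right.
  by have := level2_lt li lj (cell_lt lx ly); lia.
Qed.

Lemma regs_frame p s t : frame p s t ->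
  all (fun r => r \notin iwrites p) reserved -> regs s -> regs t.
Proof.
case=> f1 _ _ _ /allP q [r0 r5 r6 r7 r8].
by split; rewrite f1 //; apply: q.
Qed.

Lemma args_frame p s t : frame p s t ->
  all (fun r => r \notin iwrites p) [:: 1; 2; 60] -> 0 \notin wwrites p ->
  args s -> args t.
Proof.
case=> f1 f2 _ _ /allP q q0 [s1 s2 s60 w0].
by split; rewrite ?f2 // f1 //; apply: q.
Qed.

Lemma frame_imem p s t : frame p s t -> ~~ istores p -> imem t = imem s.
Proof. by case. Qed.

Lemma frame_wmem p s t : frame p s t -> ~~ wstores p -> wmem t = wmem s.
Proof. by case. Qed.

Definition ent_at (k : nat) : \bar R :=
  new_ent l M a b w (k %% (n * n) %/ n) (k %% (n * n) %% n)
    (k %/ (n * n) %/ l) (k %/ (n * n) %% l).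

Lemma ent_index k : k < n * n * l * l ->
  [/\ k %% (n * n) %/ n < n, k %% (n * n) %% n < n,
      k %/ (n * n) %/ l < l & k %/ (n * n) %% l < l].
Proof.
move=> lk; have n0 : 0 < n by case: (n) lk; rewrite ?mul0n.
have n20 : 0 < n * n by rewrite muln_gt0 n0.
have l0 : 0 < l by [].
split; rewrite ?ltn_mod //; first by rewrite ltn_divLR // ltn_mod.
by rewrite !ltn_divLR //; apply: leq_trans lk _; rewrite !mulnA; lia.
Qed.

Lemma wp_ent s : ctx s M -> args s ->
  wp ent_code s (fun t => keeps s t /\
    forall k, k < n * n * l * l ->
      wmem t (2 * (n * n) + n * n * l * l + k) = ent_at k).
Proof.
move=> c ar; have [p1 p2 p3] := prod_chain.
apply: (wp_for (Inv := fun i t => keeps s t /\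
    forall k, k < i ->
      wmem t (2 * (n * n) + n * n * l * l + k) = ent_at k)).
- exact: c.1.
- by [].
- move=> i t li f ti [kt et]; rewrite /= in li.
  have ct : ctx t M by apply: ctx_keeps kt => //; apply: regs_frame f _ c.1.
  have at_ : args t by apply: (args_frame f).
  have [lx ly lp lq] := ent_index li.
  apply: (wp_then (wp_ent_prepare ct at_ ti li)) => u fu pu.
  have cu : ctx u M by apply: (ctx_frame fu).
  have au : args u by apply: (args_frame fu).
  apply: (wp_then (wp_ent_combine cu au pu lx ly lp lq)) => v fv v10.
  have [_ _ v6 _ v8] : regs v by apply: (regs_frame fv) => //; exact: cu.1.
  have v61 : ireg v 61 = i by rewrite (frameI fv) // (frameI fu).
  have lS : 8 * (n * n * l * l) + 8 <= S by exact: leS.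
  eapply wp_wstore; [by ev_tac|by lia|by ev_tac|].
  have ei : imem v = imem t by rewrite (frame_imem fv) // (frame_imem fu).
  have ew : wmem v = wmem t by rewrite (frame_wmem fv) // (frame_wmem fu).
  case: kt => k1 k2; split; first split.
  + by move=> d hd; rewrite /= ei k1.
  + by move=> d hd; rewrite /= ew; case: eqP => [e|_]; [lia|rewrite k2].
  + move=> k lk; rewrite /= ew; case: eqP => [e|ne].
      by have -> : k = i by lia.
    by apply: et; lia.
- by [].
Qed.

(** The middle clause protects the new entries, which [ent_code] has already left in scratch
    memory. *)
Lemma wp_vert s : ctx s M -> args s ->
  wp vert_code s (fun t => [/\ keeps s t,
    forall c, 2 * (n * n) <= c -> wmem t c = wmem s c &
    forall k, k < n * n ->
    [/\ wmem t (n * n + k) = new_dst M a b w (k %/ n) (k %% n),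
        imem t (1 + n * n + k) = new_par M a b w (k %/ n) (k %% n) &
        imem t (1 + 2 * (n * n) + k) = new_hop M a b w (k %/ n) (k %% n)]]).
Proof.
move=> c ar; have [p1 p2 p3] := prod_chain; have l8 := V8.
apply: (wp_for (Inv := fun i t => [/\ keeps s t,
    forall c, 2 * (n * n) <= c -> wmem t c = wmem s c &
    forall k, k < i ->
    [/\ wmem t (n * n + k) = new_dst M a b w (k %/ n) (k %% n),
        imem t (1 + n * n + k) = new_par M a b w (k %/ n) (k %% n) &
        imem t (1 + 2 * (n * n) + k) = new_hop M a b w (k %/ n) (k %% n)]])).
- exact: c.1.
- by [].
- move=> i t li f ti [kt wt et]; rewrite /= in li.
  have ct : ctx t M by apply: ctx_keeps kt => //; apply: regs_frame f _ c.1.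
  have at_ : args t by apply: (args_frame f).
  have [r0 _ _ _ _] := ct.1.
  have n0 : 0 < n by case: (n) li; rewrite ?mul0n.
  have lx : i %/ n < n by rewrite ltn_divLR.
  have ly : i %% n < n by rewrite ltn_mod.
  have [t1 t2 t60 tw0] := at_.
  step_set; [by lia|]; step_set; [by lia|].
  set x := i %/ n in lx *; set y := i %% n in ly *.
  apply: (wp_then (P := fun u => rewired u x y)).
    by apply: wp_dir => //; ctx_tac.
  move=> u fu [u70 u71 u72 u73]; have cu : ctx u M.
    by apply: (ctx_frame fu) => //; ctx_tac.
  have [u66 u67] : ireg u 66 = x /\ ireg u 67 = y by split; rewrite (frameI fu).
  have uw0 : wreg u 0 = w%:E by rewrite (frameW fu).
  have lc := near_end_lt x y; have ld := far_end_lt x y.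
  have hl := new_hop_le x y.
  have np : new_par M a b w x y < n.
    rewrite /new_par; case: ifP => _; last exact: B.2.
    by case: ifP => // _; apply: B.2.
  apply: (wp_then (P := fun v => wreg v 10 = new_dst M a b w x y /\
                                 ireg v 80 = new_par M a b w x y)).
    rewrite /new_dst /new_par in np *.
    eapply wp_if; first by apply: evb_flag; exact: u70.
      move=> im; rewrite im in np *; step_wset; try by [].
      apply: (wp_if (v := y == far_end M a b w x y)).
      + by rewrite eqn_leq; ev_tac.
      + by move=> e; rewrite e in np *; eapply wp_set; [ev_tac|lia|].
      + move=> /negbTE e; rewrite e in np *; eapply wp_set; [by ev_tac| |by []].
        by move: np; rewrite /anc /=; lia.
    move=> /negbTE im; rewrite im in np *; step_wset; try by [].
    eapply wp_set; [by ev_tac| |by []].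
    by move: np; rewrite /anc /=; lia.
  move=> v fv [v10 v80]; have cv : ctx v M by apply: (ctx_frame fv).
  have [_ _ v6 _ _] := cv.1.
  have v61 : ireg v 61 = i by rewrite (frameI fv) // (frameI fu).
  have v73 : ireg v 73 = new_hop M a b w x y by rewrite (frameI fv).
  have lS : 8 * (n * n * l * l) + 8 <= S by exact: leS.
  have ei : imem v = imem t by rewrite (frame_imem fv) // (frame_imem fu).
  have ew : wmem v = wmem t by rewrite (frame_wmem fv) // (frame_wmem fu).
  apply: wp_seq; eapply wp_wstore; [by ev_tac|by lia|by ev_tac|].
  apply: wp_seq; eapply wp_store; [by ev_tac|by lia|by ev_tac|by lia|].
  eapply wp_store; [by ev_tac|by lia|by ev_tac|by lia|].
  case: kt => k1 k2; split; first split.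
  + by move=> d hd; rewrite /= ei; do 2 (case: eqP => [e|_]; first lia); rewrite k1.
  + by move=> d hd; rewrite /= ew; case: eqP => [e|_]; [lia|rewrite k2].
  + by move=> d hd; rewrite /= ew; case: eqP => [e|_]; [lia|rewrite wt].
  + move=> k lk; rewrite /= ei ew; have [->|ne] := eqVneq k i.
      rewrite !eqxx; split=> //; case: eqP => // e; lia.
    have [q1 q2 q3] : [/\ wmem t (n * n + k) = new_dst M a b w (k %/ n) (k %% n),
        imem t (1 + n * n + k) = new_par M a b w (k %/ n) (k %% n) &
        imem t (1 + 2 * (n * n) + k) = new_hop M a b w (k %/ n) (k %% n)].
      by apply: et; move/eqP: ne; lia.
    move/eqP: ne => ne; split.
    * by case: eqP => // e; lia.
    * by do 2 (case: eqP => [e|_]; first by lia).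
    * by do 2 (case: eqP => [e|_]; first by lia).
- by [].
Qed.

End Rewire.

(** * Installing the new tables *)

Section Commit.
Variable M' : store R.
Hypothesis B' : bounded n M'.

Record pending s : Prop := Pending {
  pending_dst : forall k, k < n * n ->
    wmem s (n * n + k) = dst M' (k %/ n) (k %% n);
  pending_par : forall k, k < n * n ->
    imem s (1 + n * n + k) = par M' (k %/ n) (k %% n);
  pending_hop : forall k, k < n * n ->
    imem s (1 + 2 * (n * n) + k) = hop M' (k %/ n) (k %% n);
  pending_ent : forall k, k < n * n * l * l ->
    wmem s (2 * (n * n) + n * n * l * l + k) =
    ent M' (k %% (n * n) %/ n) (k %% (n * n) %% n)
      (k %/ (n * n) %/ l) (k %/ (n * n) %% l) }.

Lemma divmod_add d i k : k < d -> (i * d + k) %/ d = i /\ (i * d + k) %% d = k.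
Proof.
move=> lk; have d0 : 0 < d by lia.
by rewrite divnMDl // divn_small // addn0 modnMDl modn_small.
Qed.

Lemma wp_commit s : regs s -> pending s -> wp commit_code s (fun t => ctx t M').
Proof.
move=> rs [pD pP pH pE]; have [p1 p2 p3] := prod_chain; have l8 := V8.
have lS : 8 * (n * n * l * l) + 8 <= S by exact: leS.
have lV : 8 * (n * n * l * l) + 8 <= V by exact: leV.
apply: (wp_then (P := fun t => [/\
    forall k, k < n * n -> wmem t k = wmem s (n * n + k) /\
                            imem t (1 + k) = imem s (1 + 2 * (n * n) + k),
    forall c, n * n <= c -> wmem t c = wmem s c &
    forall c, 1 + n * n <= c -> imem t c = imem s c])).
  apply: (wp_for (Inv := fun i t => [/\
    forall k, k < i -> wmem t k = wmem s (n * n + k) /\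
                        imem t (1 + k) = imem s (1 + 2 * (n * n) + k),
    forall c, n * n <= c -> wmem t c = wmem s c &
    forall c, 1 + n * n <= c -> imem t c = imem s c])) => //.
  move=> i t li f ti [h1 h2 h3]; rewrite /= in li.
  have [_ _ t6 _ _] : regs t by apply: (regs_frame f).
  have n0 : 0 < n by case: (n) li; rewrite ?mul0n.
  have hb : hop M' (i %/ n) (i %% n) <= n.+1 by case: B'.
  apply: wp_seq; eapply wp_wstore; [by ev_tac|by lia| |].
    by eapply evw_load; [ev_tac|lia|apply: h2; lia].
  eapply wp_store; [by ev_tac|by lia| | |].
  + by eapply ev_load; [ev_tac|lia|apply: h3; lia].
  + by rewrite pH //; lia.
  split.
  + move=> k lk; rewrite /=; have [->|/eqP ne] := eqVneq k i; first by rewrite eqxx.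
    by case: eqP => [e|_]; [lia|apply: h1; lia].
  + by move=> d hd; rewrite /=; case: eqP => [e|_]; [lia|apply: h2].
  + by move=> d hd; rewrite /=; case: eqP => [e|_]; [lia|apply: h3].
move=> t f [t1 t2 t3]; have rt : regs t by apply: (regs_frame f).
apply: (wp_then (P := fun u =>
    (forall k, k < n * n * l * l ->
       wmem u (2 * (n * n) + k) = wmem t (2 * (n * n) + n * n * l * l + k)) /\
    (forall c, c < 2 * (n * n) -> wmem u c = wmem t c))).
  apply: (wp_for (Inv := fun i u =>
    (forall k, k < i ->
       wmem u (2 * (n * n) + k) = wmem t (2 * (n * n) + n * n * l * l + k)) /\
    (forall c, c < 2 * (n * n) \/ 2 * (n * n) + n * n * l * l <= c ->
       wmem u c = wmem t c))) => //.
    move=> i u li g ui [h1 h2]; rewrite /= in li.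
    have [_ _ u6 _ u8] : regs u by apply: (regs_frame g).
    eapply wp_wstore; [by ev_tac|by lia| |].
      by eapply evw_load; [ev_tac|lia|apply: h2; right; lia].
    split=> [k lk|d hd] /=; last by case: eqP => [e|_]; [lia|apply: h2].
    by case: eqP => [e|ne]; [have -> : k = i by lia|apply: h1; lia].
  by move=> u g [h1 h2]; split=> // d hd; apply: h2; left.
move=> u g [u1 u2]; have ru : regs u by apply: (regs_frame g).
have eu : imem u = imem t by rewrite (frame_imem g).
apply: (wp_for (Inv := fun i v =>
    (forall k, k < i -> imem v (1 + 3 * (n * n) + k) =
       anc M' (k %% (n * n) %/ n) (k %% (n * n) %% n) (2 ^ (k %/ (n * n)))) /\
    (forall c, c < 1 + 3 * (n * n) -> imem v c = imem u c))) => //.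
  move=> i v li q vi [h1 h2]; rewrite /= in li.
  have [r0 _ v6 _ _] : regs v by apply: (regs_frame q).
  have n0 : 0 < n by case: (n) li; rewrite ?mul0n.
  have n20 : 0 < n * n by rewrite muln_gt0 n0.
  have di := divn_eq i (n * n); have lxy : i %% (n * n) < n * n by rewrite ltn_mod.
  have [m em] : exists m, i %/ (n * n) = m by exists (i %/ (n * n)).
  have [xy exy] : exists xy, i %% (n * n) = xy by exists (i %% (n * n)).
  rewrite em exy in di lxy *.
  have lx : xy %/ n < n by rewrite ltn_divLR.
  have ly : xy %% n < n by rewrite ltn_mod.
  have la k' : anc M' (xy %/ n) (xy %% n) k' < n.
    by elim: k' => // k' IH; rewrite /anc iterS; apply: B'.2.
  step_set; [by rewrite em; nia|]; rewrite em.
  step_set; [by rewrite exy; lia|]; rewrite exy.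
  apply: (wp_then (P := fun z => ireg z 80 =
      anc M' (xy %/ n) (xy %% n) (2 ^ m))).
    eapply wp_if; first by ev_tac.
      rewrite leqn0 => /eqP m0; have pxy := pP xy lxy.
      have lp : par M' (xy %/ n) (xy %% n) < n := la 1.
      apply: (wp_set (v := par M' (xy %/ n) (xy %% n))); [|lia|by rewrite m0].
      eapply ev_load; [by ev_tac|by lia|].
      by rewrite /= h2 ?eu ?t3 ?pxy //; lia.
    (* At level m > 0 the jump is two jumps of level m - 1, whose indices are below [i]: both were
       already written by this loop. *)
    rewrite -ltnNge => m0.
    have lz := la (2 ^ m.-1).
    step_set; [by nia|]; rewrite subn1; step_set; [by lia|].
    have nn : n * n <= i by rewrite di; nia.
    have e1 : i = m.-1 * (n * n) + n * n + xy by rewrite di; nia.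
    apply: wp_seq; eapply wp_set.
    + eapply ev_load; [by ev_tac| |].
        by rewrite /=; lia.
      rewrite /= h1; last by lia.
      by have [-> ->] := divmod_add m.-1 lxy.
    + by lia.
    set z := anc _ _ _ _ in lz *.
    have lc := cell_lt lx lz.
    eapply wp_set.
    + eapply ev_load.
        by apply: ev_add; [|apply: ev_add; [|apply: ev_add; [apply: ev_mul|]]];
          ev_tac.
        by rewrite /=; lia.
      rewrite /= h1; last by lia.
      have [-> ->] := divmod_add m.-1 lc.
      have [-> ->] := divmod_add (xy %/ n) lz.
      rewrite /z /anc -iterD addnn -mul2n -expnS prednK //.
    + by have := la (2 ^ m); rewrite /anc; lia.
    + by [].
  move=> z fz z80; have z61 : ireg z 61 = i by rewrite (frameI fz).
  have z6 : ireg z 6 = n * n by rewrite (frameI fz).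
  have ez : imem z = imem v by rewrite (frame_imem fz).
  eapply wp_store; [by ev_tac|by lia|by ev_tac|by have := la (2 ^ m); lia|].
  split=> [k lk|d hd]; rewrite /= ez; last by case: eqP => [e|_]; [lia|apply: h2].
  case: eqP => [e|ne]; last by apply: h1; lia.
  have ki : k = i by lia.
  by rewrite ki em exy.
move=> v q [v1 v2]; split; first by apply: (regs_frame q).
have ew : wmem v = wmem u by rewrite (frame_wmem q).
split.
- move=> x y lx ly; have lc := cell_lt lx ly.
  rewrite v2 ?eu; last by lia.
  by rewrite (t1 _ lc).2 pH //; have [-> ->] := divmod_add x ly.
- move=> i x y li lx ly; have lc := cell_lt lx ly.
  rewrite v1; last exact: level_lt.
  by have [-> ->] := divmod_add i lc; have [-> ->] := divmod_add x ly.
- move=> x y lx ly; have lc := cell_lt lx ly.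
  rewrite ew u2; last by lia.
  by rewrite (t1 _ lc).1 pD //; have [-> ->] := divmod_add x ly.
- move=> x y i j lx ly li lj; have lc := cell_lt lx ly.
  have ll := level2_lt li lj lc.
  rewrite ew u1 // t2; last by lia.
  rewrite pE //; have [-> ->] := divmod_add (i * l + j) lc.
  by have [-> ->] := divmod_add x ly; have [-> ->] := divmod_add i lj.
Qed.

End Commit.

End Memory.

Arguments wp_set {R n V S r e s Q v} _ _ _.
Arguments wp_wset {R n V S r e s Q v} _ _.
Arguments wp_store {R n V S e1 e2 s Q a v} _ _ _ _ _.
Arguments wp_wstore {R n V S e1 e2 s Q a v} _ _ _ _.
Arguments ev_reg {R S s r v} _.
Arguments evw_reg {R S s r v} _.

(** * The three operations of the oracle as programs *)

Definition setup_code : prog :=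
  seqs [:: PSet 6 (IMul (IReg 0) (IReg 0)); PSet 7 (IMul (IReg 6) (IReg 5))]
    (PSet 8 (IMul (IReg 7) (IReg 5))).

Definition save_code : prog := PStore (INum 0) (IReg 5).

Definition update_code : prog :=
  seqs [:: PIf (BAnd (BILe (IReg 1) (IReg 2)) (BILe (IReg 2) (IReg 1)))
             (PSet 60 (INum 0)) (PSet 60 (INum 1));
           ent_code; vert_code; commit_code] save_code.

Definition insert_prog : prog :=
  seqs [:: PSet 5 (ILoad (INum 0)); setup_code] update_code.

Definition bridge_query (a b : nat) : prog :=
  seqs [:: PSet 50 (IReg 1); PSet 51 (IReg 2);
           PSet 52 (load_hop (IReg 1) (IReg a)); PSet 53 (IReg b);
           PSet 54 (load_hop (IReg 1) (IReg b))] query_code.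

Definition if_parent (a b : nat) (p q : prog) : prog :=
  let e := load_jump (INum 0) (IReg 1) (IReg b) in
  PIf (BAnd (BILe e (IReg a)) (BILe (IReg a) e)) p q.

Definition query_prog : prog :=
  seqs [:: PSet 5 (ILoad (INum 0)); setup_code;
           if_parent 3 4 (bridge_query 3 4)
             (if_parent 4 3 (bridge_query 4 3)
                (PWSet 1 (load_dst (IReg 1) (IReg 2))))]
    (PWSet 0 (WReg 1)).

(** Starting from 2, counts the doublings of register 9 that stay within [n]; [n] rounds suffice
    since the logarithm of [n] is at most [n]. *)
Definition level_code : prog :=
  seqs [:: PSet 5 (INum 2); PSet 9 (INum 2)]
    (PFor 61 LimN
      (PIf (BILe (IReg 9) (IReg 0))
         (PSeq (PSet 5 (IAdd (IReg 5) (INum 1)))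
               (PSet 9 (IAdd (IReg 9) (IReg 9))))
         PSkip)).

Definition init_code : prog :=
  let x := IReg 66 in let y := IReg 67 in
  PSeq
    (PFor 61 LimN2
      (seqs [:: PSet 66 (IDiv (IReg 61) (IReg 0)); PSet 67 (IMod (IReg 61) (IReg 0));
                PIf (BAnd (BILe x y) (BILe y x))
                  (seqs [:: PWSet 10 WZero; PSet 73 (INum 0)] (PSet 80 y))
                  (seqs [:: PWSet 10 (WLoad (IReg 61)); PSet 73 (INum 1)]
                     (PIf (BWLe WInf (WReg 10)) (PSet 80 y) (PSet 80 x)));
                PWStore (IAdd (IReg 6) (IReg 61)) (WReg 10);
                PStore (IAdd (IAdd (INum 1) (IReg 6)) (IReg 61)) (IReg 80)]
         (PStore (IAdd (IAdd (INum 1) (IMul (INum 2) (IReg 6))) (IReg 61)) (IReg 73))))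
    (PFor 61 LimN2L2 (PWStore (IAdd ent_base (IReg 61)) WInf)).

(** The final loop is [enable]: one degenerate update per vertex, with weight register 0 still
    zero. *)
Definition build_prog : prog :=
  seqs [:: level_code; setup_code; init_code; commit_code; save_code]
    (PFor 90 LimN (seqs [:: PSet 1 (IReg 90); PSet 2 (IReg 90)] update_code)).

Section Programs.
Variables (R : realDomainType) (n V S : nat).
Let l := levels n.
Implicit Types (s t : state R) (M : store R) (Q : state R -> Prop).
Hypotheses (leV : capacity n <= V) (leS : capacity n <= S).
Notation wp := (wp n l V S).
Notation ev := (ev S).

Let lV : 8 * (n * n * l * l) + 8 <= V. Proof. exact: leV. Qed.
Let lS : 8 * (n * n * l * l) + 8 <= S. Proof. exact: leS. Qed.

Let pchain : [/\ n <= n * n, n * n <= n * n * l & n * n * l <= n * n * l * l].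
Proof. exact: prod_chain. Qed.
Let llt : l < 4 * n + 4. Proof. exact: lev_lt. Qed.

Lemma stored_mem s t M : imem t = imem s -> wmem t = wmem s ->
  stored n s M -> stored n t M.
Proof. by move=> e1 e2 [h1 h2 h3 h4]; split; rewrite ?e1 ?e2. Qed.

Lemma wp_setup s : ireg s 0 = n -> ireg s 5 = l ->
  wp setup_code s (fun t => regs n t).
Proof.
move=> s0 s5; have [p1 p2 p3] := pchain.
have e0 t : ireg t 0 = n -> ev t (IReg 0) n by [].
apply: wp_seq; apply: (wp_set (v := n * n)).
- by apply: ev_mul; apply: ev_reg.
- by lia.
apply: wp_seq; apply: (wp_set (v := n * n * l)).
- by apply: ev_mul; apply: ev_reg.
- by lia.
apply: (wp_set (v := n * n * l * l)).
- by apply: ev_mul; apply: ev_reg.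
- by lia.
by split.
Qed.

Lemma wp_save s M : ctx n s M -> wp save_code s (fun t => ctx n t M /\ imem t 0 = l).
Proof.
move=> [[r0 r5 r6 r7 r8] [h1 h2 h3 h4]]; have ll := llt.
have := capacity_ge n => cg.
by apply: (wp_store (a := 0) (v := l)) => //; try lia; split=> //; split; split.
Qed.

(** Also states that weight register 0 keeps [w], which the construction loop needs from one round
    to the next. *)
Lemma wp_update s M a b w : ctx n s M -> bounded n M ->
  bounded n (new_store l M a b w) -> ireg s 1 = a -> ireg s 2 = b ->
  a < n -> b < n -> wreg s 0 = w%:E ->
  wp update_code s (fun t => [/\ ctx n t (new_store l M a b w), imem t 0 = l &
                                 wreg t 0 = w%:E]).
Proof.
move=> c B B' s1 s2 la lb w0.
suff h : wp update_code s (fun t => ctx n t (new_store l M a b w) /\ imem t 0 = l).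
  by apply: (wp_call h) => t f [h1 h2]; split=> //; rewrite (frameW f).
apply: (wp_then (P := fun t => ireg t 60 = (a != b))).
  have cg := capacity_ge n.
  apply: (wp_if (v := a == b)).
  - by rewrite eqn_leq; apply: evb_and; apply: evb_le; apply: ev_reg.
  - by move=> e; apply: (wp_set (v := 0)); rewrite //= ?e //; lia.
  - by move=> /negbTE e; apply: (wp_set (v := 1)); rewrite //= ?e //; lia.
move=> t f t60; have ct : ctx n t M by apply: (ctx_frame f).
have at_ : args a b w t by split; rewrite // ?(frameI f) // (frameW f).
apply: (wp_then (wp_ent leV leS B la lb ct at_)) => u fu [ku eu].
have cu : ctx n u M by apply: (ctx_keeps leV leS la lb ct _ ku); apply: (regs_frame fu) => //; exact: ct.1.
have au : args a b w u by apply: (args_frame fu).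
apply: (wp_then (wp_vert leV leS B la lb cu au)) => v fv [kv wv vv].
have rv : regs n v by apply: (regs_frame fv) => //; exact: cu.1.
have pv : pending n (new_store l M a b w) v.
  split=> k lk; try by have [] := vv k lk.
  by rewrite wv ?eu //; lia.
apply: (wp_then (wp_commit leV leS B' rv pv)) => z fz cz.
exact: wp_save.
Qed.

Lemma wp_load_levels s Q : imem s 0 = l -> wp (PSet 5 (ILoad (INum 0))) s
  (fun t => t = set_ireg 5 l s).
Proof.
move=> s0; have ll := llt; have cg := capacity_ge n.
apply: (wp_set (v := l)) => //; last by lia.
by apply: (ev_load (a := 0)) => //; lia.
Qed.

Lemma wp_insert s M a b w : stored n s M -> imem s 0 = l -> bounded n M ->
  bounded n (new_store l M a b w) -> ireg s 0 = n -> ireg s 1 = a ->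
  ireg s 2 = b -> a < n -> b < n -> wreg s 0 = w%:E ->
  wp insert_prog s (fun t => stored n t (new_store l M a b w) /\ imem t 0 = l).
Proof.
move=> st s0 B B' r0 r1 r2 la lb w0.
apply: (wp_then (wp_load_levels (fun=> True) s0)) => _ _ ->.
apply: (wp_then (wp_setup (s := set_ireg 5 l s) r0 erefl)) => t f rt.
have ct : ctx n t M.
  by split=> //; apply: stored_mem st; rewrite ?(frame_imem f) ?(frame_wmem f).
have h : wp update_code t (fun t => [/\ ctx n t (new_store l M a b w),
    imem t 0 = l & wreg t 0 = w%:E]).
  by apply: wp_update; rewrite ?(frameI f) ?(frameW f).
by apply: wp_mono h => u [[_ h1] h2 _].
Qed.

Lemma wp_bridge s M u v a b va vb : ctx n s M -> bounded n M ->
  ireg s 1 = u -> ireg s 2 = v -> a \in [:: 3; 4] -> b \in [:: 3; 4] ->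
  ireg s a = va -> ireg s b = vb ->
  u < n -> v < n -> va < n -> vb < n ->
  wp (bridge_query a b) s
    (fun t => wreg t 1 = query l M u v (hop M u va) vb (hop M u vb)).
Proof.
move=> c B s1 s2 ha hb sa sb lu lv la lb; have cg := capacity_ge n.
have h1 := B.1 u va; have h2 := B.1 u vb.
have na : [/\ a != 50, a != 51, a != 52 & a != 53].
  by move: ha; rewrite !inE => /orP[]/eqP ->.
have nb : [/\ b != 50, b != 51, b != 52 & b != 53].
  by move: hb; rewrite !inE => /orP[]/eqP ->.
case: na nb => [a0 a1 a2 a3] [b0 b1 b2 b3].
apply: wp_seq; apply: (wp_set (v := u)); [exact: ev_reg|lia|].
apply: wp_seq; apply: (wp_set (v := v)); [exact: ev_reg|lia|].
apply: wp_seq; apply: (wp_set (v := hop M u va)); [|lia|].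
  apply: (ev_hop leV leS) => //; first by do 2 apply: ctx_set => //.
  by apply: ev_reg; rewrite !ireg_set_ne.
apply: wp_seq; apply: (wp_set (v := vb)); [|lia|].
  by apply: ev_reg; rewrite !ireg_set_ne.
apply: wp_seq; apply: (wp_set (v := hop M u vb)); [|lia|].
  apply: (ev_hop leV leS) => //; first by do 4 apply: ctx_set => //.
  by apply: ev_reg; rewrite !ireg_set_ne.
by apply: (wp_query leV leS B) => //; [do 5 apply: ctx_set => //|lia].
Qed.

Lemma wp_if_parent s M u a b va vb p q Q : ctx n s M -> bounded n M ->
  ireg s 1 = u -> ireg s a = va -> ireg s b = vb -> u < n -> vb < n ->
  (par M u vb = va -> wp p s Q) -> (par M u vb <> va -> wp q s Q) ->
  wp (if_parent a b p q) s Q.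
Proof.
move=> c B s1 sa sb lu lb hp hq; apply: (wp_if (v := par M u vb == va)).
- have e : ev s (load_jump (INum 0) (IReg 1) (IReg b)) (par M u vb).
    exact: (ev_jump leV leS c (vi := 0) (ev_num _ _ _) (ev_reg s1) (ev_reg sb)).
  by rewrite eqn_leq; apply: evb_and; apply: evb_le => //; apply: ev_reg.
- by move/eqP.
- by move/eqP.
Qed.

Lemma wp_query_prog s M u v a b : stored n s M -> imem s 0 = l -> bounded n M ->
  ireg s 0 = n -> ireg s 1 = u -> ireg s 2 = v -> ireg s 3 = a ->
  ireg s 4 = b -> u < n -> v < n -> a < n -> b < n ->
  wp query_prog s (fun t => wreg t 0 = answer l M u v a b).
Proof.
move=> st s0 B r0 r1 r2 r3 r4 lu lv la lb.
apply: (wp_then (wp_load_levels (fun=> True) s0)) => _ _ ->.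
apply: (wp_then (wp_setup (s := set_ireg 5 l s) r0 erefl)) => t f rt.
have ct : ctx n t M.
  by split=> //; apply: stored_mem st; rewrite ?(frame_imem f) ?(frame_wmem f).
have [t1 t2] : ireg t 1 = u /\ ireg t 2 = v by split; rewrite (frameI f).
have [t3 t4] : ireg t 3 = a /\ ireg t 4 = b by split; rewrite (frameI f).
apply: (wp_then (P := fun z => wreg z 1 = answer l M u v a b)).
  rewrite /answer.
  apply: (wp_if_parent ct B t1 t3 t4 lu lb) => [->|/eqP/negbTE ->].
    by rewrite eqxx; apply: wp_bridge ct B t1 t2 _ _ t3 t4 lu lv la lb.
  apply: (wp_if_parent ct B t1 t4 t3 lu la) => [->|/eqP/negbTE ->].
    by rewrite eqxx; apply: wp_bridge ct B t1 t2 _ _ t4 t3 lu lv lb la.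
  apply: (wp_wset (v := dst M u v)) => //.
  exact: (evw_dst leV leS ct (ev_reg t1) (ev_reg t2)).
by move=> z _ z1; apply: (wp_wset (v := answer l M u v a b)).
Qed.

Lemma wp_level s : ireg s 0 = n -> wp level_code s (fun t => ireg t 5 = l).
Proof.
move=> s0; have cg := capacity_ge n; have ll := llt.
have pl := pow_levels n.
apply: wp_seq; apply: (wp_set (v := 2)) => //; first by lia.
apply: wp_seq; apply: (wp_set (v := 2)) => //; first by lia.
split=> //; exists (fun i t => ireg t 5 = 2 + minn i (trunc_log 2 n) /\
  ireg t 9 = 2 ^ (minn i (trunc_log 2 n)).+1); split.
- by rewrite /= min0n.
- move=> i t li f ti [t5 t9]; rewrite /= in li.
  have t0 : ireg t 0 = n by rewrite (frameI f).
  have /andP[b1 b2] := trunc_log_bounds (ltnSn 1) (leq_ltn_trans (leq0n i) li).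
  have lt_l : l = (trunc_log 2 n).+2 by [].
  apply: (wp_if (v := ireg t 9 <= n)).
  + by apply: evb_le; apply: ev_reg.
  + rewrite t9 => le; have lti : i < trunc_log 2 n.
      rewrite ltnNge; apply/negP => le_i; move: le; rewrite (minn_idPr le_i).
      by rewrite leqNgt b2.
    have [e1 e2] : minn i (trunc_log 2 n) = i /\ minn i.+1 (trunc_log 2 n) = i.+1 by lia.
    rewrite e1 in t5 t9.
    apply: wp_seq; apply: (wp_set (v := 2 + i + 1)).
    * by apply: ev_add => //; apply: ev_reg.
    * by lia.
    have pi : 2 ^ i.+1 < 4 * n + 4 by apply: pow_lt; rewrite /levels; lia.
    apply: (wp_set (v := 2 ^ i.+1 + 2 ^ i.+1)).
    * by apply: ev_add; apply: ev_reg.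
    * by lia.
    rewrite /= e2; split; first by lia.
  by rewrite [in RHS]expnS; lia.
  + rewrite t9 -ltnNge => gt; have lei : trunc_log 2 n <= i.
      rewrite leqNgt; apply/negP => lt; move: gt; rewrite ltnNge.
      have -> : minn i (trunc_log 2 n) = i by lia.
      by move/negP; apply; apply: leq_trans b1; rewrite leq_exp2l.
    have e1 : minn i.+1 (trunc_log 2 n) = minn i (trunc_log 2 n) by lia.
    by rewrite /= t5 t9 e1.
(* The loop has run long enough, since 2 to the logarithm of [n] is at most [n]. *)
- move=> t _ /= [-> _]; have -> : minn n (trunc_log 2 n) = trunc_log 2 n.
    have [->|n0] := posnP n; first by rewrite trunc_log0.
    have /andP[b1 _] := trunc_log_bounds (ltnSn 1) n0.
    by have := ltn_expl (trunc_log 2 n) (ltnSn 1); lia.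
  by [].
Qed.

Variable G : wgraph R n.

Lemma adj_arc k : k < n * n -> adj_matrix G k = arc G (k %/ n) (k %% n).
Proof.
move=> lk; have n0 : 0 < n by case: (n) lk; rewrite ?mul0n.
have lx : k %/ n < n by rewrite ltn_divLR.
have ly : k %% n < n by rewrite ltn_mod.
by rewrite /adj_matrix /arc !insubT.
Qed.

Lemma wp_init s : regs n s ->
  (forall k, k < n * n -> wmem s k = arc G (k %/ n) (k %% n)) ->
  wp init_code s (fun t => pending n (init_store G) t).
Proof.
move=> rs ws; have [p1 p2 p3] := pchain; have cg := capacity_ge n.
apply: (wp_then (P := fun t => forall k, k < n * n ->
    [/\ wmem t (n * n + k) = dst (init_store G) (k %/ n) (k %% n),
        imem t (1 + n * n + k) = par (init_store G) (k %/ n) (k %% n) &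
        imem t (1 + 2 * (n * n) + k) = hop (init_store G) (k %/ n) (k %% n)])).
  apply: (wp_for (Inv := fun i t => (forall k, k < n * n -> wmem t k = wmem s k) /\
    forall k, k < i ->
    [/\ wmem t (n * n + k) = dst (init_store G) (k %/ n) (k %% n),
        imem t (1 + n * n + k) = par (init_store G) (k %/ n) (k %% n) &
        imem t (1 + 2 * (n * n) + k) = hop (init_store G) (k %/ n) (k %% n)])) => //;
    last by move=> t _ [].
  move=> i t li f ti [kt et]; rewrite /= in li.
  have rt : regs n t by apply: (regs_frame f).
  have [r0 _ _ _ _] := rt.
  have n0 : 0 < n by case: (n) li; rewrite ?mul0n.
  have lx : i %/ n < n by rewrite ltn_divLR.
  have ly : i %% n < n by rewrite ltn_mod.
  apply: wp_seq; apply: (wp_set (v := i %/ n)); [by apply: ev_div; apply: ev_reg|lia|].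
  apply: wp_seq; apply: (wp_set (v := i %% n)); [by apply: ev_mod; apply: ev_reg|lia|].
  set s2 := set_ireg 67 _ _.
  have wi : wmem t i = arc G (i %/ n) (i %% n) by rewrite kt ?ws.
  set x := i %/ n in lx wi s2 *; set y := i %% n in ly wi s2 *.
  have pxy : par (init_store G) x y < n.
    by rewrite /= /init_par; case: ifP => // _; case: ifP.
  have hxy : hop (init_store G) x y <= 1 by rewrite /=; case: (x != y).
  apply: (wp_then (P := fun u => [/\ wreg u 10 = dst (init_store G) x y,
     ireg u 80 = par (init_store G) x y & ireg u 73 = hop (init_store G) x y])).
    apply: (wp_if (v := (x == y))).
    + by rewrite eqn_leq; apply: evb_and; apply: evb_le; apply: ev_reg.
    + move=> e; have [-> -> ->] : [/\ dst (init_store G) x y = 0%E,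
          par (init_store G) x y = y & hop (init_store G) x y = 0].
        by rewrite /= /init_par e.
      apply: wp_seq; apply: (wp_wset (v := 0%E)) => //.
      apply: wp_seq; apply: (wp_set (v := 0)) => //; first by lia.
      by apply: (wp_set (v := y)); [exact: ev_reg|lia|].
    + move=> /negbTE e; have [-> -> ->] : [/\ dst (init_store G) x y = arc G x y,
          par (init_store G) x y = if (+oo <= arc G x y)%E then y else x &
          hop (init_store G) x y = 1].
        by rewrite /= /init_par e.
      apply: wp_seq; apply: (wp_wset (v := arc G x y)).
        by apply: (evw_load (a := i)) => //; first [exact: ev_reg|lia].
      apply: wp_seq; apply: (wp_set (v := 1)) => //; first by lia.
      apply: (wp_if (v := (+oo <= arc G x y)%E)); first by apply: evb_wle.
        by move=> h; rewrite h; apply: (wp_set (v := y)); [exact: ev_reg|lia|].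
      by move=> /negbTE h; rewrite h; apply: (wp_set (v := x)); [exact: ev_reg|lia|].
  move=> u fu [u10 u80 u73].
  have [_ _ u6 _ _] : regs n u.
    by apply: (regs_frame fu) => //; do 2 apply: regs_set => //.
  have u61 : ireg u 61 = i by rewrite (frameI fu).
  have ei : imem u = imem t by rewrite (frame_imem fu).
  have ew : wmem u = wmem t by rewrite (frame_wmem fu).
  have h6 : ev u (IReg 6) (n * n) by [].
  have h61 : ev u (IReg 61) i by [].
  apply: wp_seq; apply: (wp_wstore (a := n * n + i) (v := dst (init_store G) x y)).
  - exact: ev_add.
  - by lia.
  - exact: evw_reg.
  apply: wp_seq; apply: (wp_store (a := 1 + n * n + i) (v := par (init_store G) x y)).
  - by apply: ev_add => //; apply: ev_add.
  - by lia.
  - exact: ev_reg.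
  - by lia.
  apply: (wp_store (a := 1 + 2 * (n * n) + i) (v := hop (init_store G) x y)).
  - by apply: ev_add => //; apply: ev_add => //; apply: ev_mul.
  - by lia.
  - exact: ev_reg.
  - by lia.
  split.
  - by move=> d hd; rewrite [LHS]/= ew; case: eqP => [e|_]; [lia|apply: kt].
  - move=> k lk; have [->|/eqP ne] := eqVneq k i.
      split; rewrite [LHS]/= ?eqxx //.
      by case: eqP => [e|_]; first lia.
    have [q1 q2 q3] := et k (ltac:(lia)).
    split; rewrite -?q1 -?q2 -?q3 [LHS]/= ?ew ?ei.
    + by case: eqP => [e|_]; first lia.
    + by do 2 (case: eqP => [e|_]; first lia).
    + by do 2 (case: eqP => [e|_]; first lia).
move=> t f ht; have rt : regs n t by apply: (regs_frame f).
apply: (wp_for (Inv := fun i u => (forall c, c < 2 * (n * n) -> wmem u c = wmem t c) /\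
    forall k, k < i -> wmem u (2 * (n * n) + n * n * l * l + k) = +oo%E)) => //.
  move=> i u li g ui [hk he]; rewrite /= in li.
  have [_ _ u6 _ u8] : regs n u by apply: (regs_frame g).
  apply: (wp_wstore (a := 2 * (n * n) + n * n * l * l + i) (v := +oo%E)) => //.
  - apply: ev_add; last exact: ev_reg.
    by apply: ev_add; [apply: ev_mul => //|]; apply: ev_reg.
  - by lia.
  split=> [d hd|k lk] /=; first by case: eqP => [e|_]; [lia|apply: hk].
  by case: eqP => [//|ne]; apply: he; lia.
move=> u g [hk he]; have ei : imem u = imem t by rewrite (frame_imem g).
split=> k lk; rewrite ?ei; try by have [] := ht k lk.
- by rewrite hk; [have [] := ht k lk|lia].
- by rewrite he.
Qed.

Lemma wp_build s : wgraph_ok G -> ireg s 0 = n -> wreg s 0 = 0%E ->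
  (forall k, wmem s k = adj_matrix G k) ->
  wp build_prog s (fun t => [/\ stored n t (enable l n (init_store G)),
                                imem t 0 = l &
                                represents G (enable l n (init_store G))]).
Proof.
move=> ok s0 w0 sw; have cg := capacity_ge n.
apply: (wp_then (wp_level s0)) => t1 f1 q5.
have q0 : ireg t1 0 = n by rewrite (frameI f1).
apply: (wp_then (wp_setup q0 q5)) => t2 f2 r2.
apply: (wp_then (wp_init r2 _)) => [k lk|t3 f3 p3].
  by rewrite (frame_wmem f2) // (frame_wmem f1) // sw adj_arc.
have r3 : regs n t3 by apply: (regs_frame f3).
apply: (wp_then (wp_commit leV leS (init_bounded G) r3 p3)) => t4 f4 c4.
apply: (wp_then (wp_save c4)) => t5 f5 [c5 h5].
have w5 : wreg t5 0 = 0%E.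
  by rewrite (frameW f5) // (frameW f4) // (frameW f3) // (frameW f2) // (frameW f1).
apply: (wp_for (Inv := fun k t => [/\ stored n t (enable l k (init_store G)),
   imem t 0 = l & wreg t 0 = 0%E])).
- exact: c5.1.
- by split=> //; apply: stored_mem c5.2.
- move=> k t lk f tk [st t0 wt]; rewrite /= in lk.
  have rt : regs n t by apply: (regs_frame f) => //; exact: c5.1.
  have [B _] := enable_ok ok (ltnW lk); have [B' _] := enable_ok ok lk.
  apply: wp_seq; apply: (wp_set (v := k)); [exact: ev_reg|lia|].
  apply: wp_seq; apply: (wp_set (v := k)); [exact: ev_reg|lia|].
  have h : wp update_code (set_ireg 2 k (set_ireg 1 k t))
     (fun t => [/\ ctx n t (new_store l (enable l k (init_store G)) k k 0%R),
        imem t 0 = l & wreg t 0 = (0%R : R)%:E]).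
    by apply: wp_update => //; do 2 apply: ctx_set => //.
  apply: wp_mono h => u [[_ h1] h2 h3]; split=> //.
    exact: (stored_mem _ _ h1).
- by move=> t _ [h1 h2 _]; split=> //; apply: represents_build.
Qed.

End Programs.

(** * Asymptotic running times and space *)

(** The exponent of [n] contributed by the nesting of loops; loops over levels contribute only
    logarithmic factors. *)
Fixpoint n_degree (p : prog) : nat :=
  match p with
  | PSeq p1 p2 | PIf _ p1 p2 => maxn (n_degree p1) (n_degree p2)
  | PFor _ k q =>
      match k with LimN => 1 | LimL => 0 | _ => 2 end + n_degree q
  | _ => 0
  end.

Lemma time_poly p : exists c k, forall n l, 0 < n -> 0 < l ->
  time n l p <= c * n ^ n_degree p * l ^ k.
Proof.
have up n d e c : 0 < n -> d <= e -> c * n ^ d <= c * n ^ e.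
  by move=> n0 de; rewrite leq_mul2l leq_pexp2l ?orbT.
have const c : exists c' k, forall n l, 0 < n -> 0 < l -> c <= c' * n ^ 0 * l ^ k.
  by exists c, 0 => n l _ _; rewrite !expn0 !muln1.
have add p1 p2 : (exists c k, forall n l, 0 < n -> 0 < l ->
      time n l p1 <= c * n ^ n_degree p1 * l ^ k) ->
    (exists c k, forall n l, 0 < n -> 0 < l ->
      time n l p2 <= c * n ^ n_degree p2 * l ^ k) ->
    exists c k, forall n l, 0 < n -> 0 < l -> time n l p1 + time n l p2 <=
      c * n ^ maxn (n_degree p1) (n_degree p2) * l ^ k.
  move=> [c1 [k1 h1]] [c2 [k2 h2]]; exists (c1 + c2), (maxn k1 k2) => n l n0 l0.
  rewrite !mulnDl; apply: leq_add.
    apply: leq_trans (h1 n l n0 l0) _; apply: leq_mul.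
      by apply: up => //; exact: leq_maxl.
    by rewrite leq_pexp2l // leq_maxl.
  apply: leq_trans (h2 n l n0 l0) _; apply: leq_mul.
    by apply: up => //; exact: leq_maxr.
  by rewrite leq_pexp2l // leq_maxr.
elim: p => [|r e|r e|e1 e2|e1 e2|p1 IH1 p2 IH2|b p1 IH1 p2 IH2|r k q [c [m IH]]];
  try exact: const.
- exact: add.
- have [c [k h]] := add _ _ IH1 IH2; exists (c + (bcost b).+1), k => n l n0 l0 /=.
  have := h n l n0 l0.
  have : 0 < n ^ maxn (n_degree p1) (n_degree p2) * l ^ k.
    by rewrite muln_gt0 !expn_gt0 n0 l0.
  rewrite -!mulnA; nia.
exists (c + 16), (2 + m) => n l n0 l0 /=.
set d := match k with LimN => _ | LimL => _ | _ => _ end.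
have lim : limit_val n l k <= n ^ d * l ^ 2.
  have ll : 0 < l ^ 2 by rewrite expn_gt0 l0.
  rewrite /d /limit_val; case: k {d}; rewrite ?expn0 ?expn1 -?mulnn; nia.
have h := IH n l n0 l0.
have g1 : 0 < n ^ n_degree q * l ^ m by rewrite muln_gt0 !expn_gt0 n0 l0.
have g2 : 0 < n ^ d * l ^ 2 by rewrite muln_gt0 !expn_gt0 n0 l0.
have -> : (c + 16) * n ^ (d + n_degree q) * l ^ (2 + m) =
   (c + 16) * ((n ^ d * l ^ 2) * (n ^ n_degree q * l ^ m)).
  by rewrite !expnD; ring.
rewrite -mulnA in h.
move: (time n l q) (n ^ n_degree q * l ^ m) (n ^ d * l ^ 2) (limit_val n l k)
  h g1 g2 lim => t y x v h g1 g2 lim.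
have h9 : t + 9 <= (c + 9) * y by nia.
have : v * (t + 9) <= x * ((c + 9) * y) by apply: leq_mul.
rewrite (_ : x * ((c + 9) * y) = (c + 9) * (x * y)); last by ring.
have : 0 < x * y by rewrite muln_gt0 g2.
by move: (v * (t + 9)) (x * y) => u z; nia.
Qed.

Lemma levels_le n : 2 <= n -> levels n <= 3 * trunc_log 2 n.
Proof.
move=> n2; have h : 0 < trunc_log 2 n by rewrite trunc_log_gt0.
by rewrite /levels; lia.
Qed.

(** From n = 2 on, [levels n] is at most three times the logarithm, which yields the factor 3^k. *)
Lemma softO_levels (f : nat -> nat) d c k :
  (forall n, 0 < n -> f n <= c * n ^ d * levels n ^ k) ->
  softO (fun n => n ^ d) f.
Proof.
move=> h; exists (c * 3 ^ k), k, 2 => n n2; apply: leq_trans (h n _) _; first lia.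
have : levels n ^ k <= 3 ^ k * trunc_log 2 n ^ k.
  rewrite -expnMn; have := levels_le n2.
  by case: (k) => // m; rewrite leq_exp2r.
move=> le; apply: leq_trans (_ : c * n ^ d * (3 ^ k * trunc_log 2 n ^ k) <= _).
  by rewrite leq_mul2l le orbT.
by apply: eq_leq; ring.
Qed.

Lemma softO_time p d : n_degree p = d ->
  softO (fun n => n ^ d) (fun n => time n (levels n) p).
Proof.
move=> <-; have [c [k h]] := time_poly p.
by apply: (@softO_levels _ _ c k) => n n0; apply: h.
Qed.

Lemma softO_capacity : softO (fun n => n ^ 2) capacity.
Proof.
apply: (@softO_levels _ _ 16 2) => n n0; rewrite /capacity -!mulnn.
have : 0 < n * n * levels n * levels n by rewrite !muln_gt0 n0.
by nia.
Qed.

(** * The oracle on the random access machine *)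

Section Run.
Variables (R : realDomainType) (n : nat).
Let l := levels n.
Let V := 2 ^ (8 * (trunc_log 2 n).+1).
Let B := word_cap 96 n.

Lemma word_capE : V ^ 12 = B.
Proof. by rewrite /V /B /word_cap -expnM; congr (2 ^ _); lia. Qed.

Lemma capacity_V : capacity n <= V.
Proof.
rewrite (_ : V = (2 ^ (trunc_log 2 n).+1) ^ 8); last by rewrite /V mulnC expnM.
rewrite /capacity; set N := 2 ^ _.
have N2 : 2 <= N by rewrite /N expnS; have := expn_gt0 2 (trunc_log 2 n); lia.
have nN : n < N by apply: trunc_log_ltn.
have lN : levels n <= N by apply: ltn_expl.
have h : n * n * levels n * levels n <= N * N * N * N.
  (* Both [n] and [levels n] are at most N, so the capacity is at most 8 N^4 + 8, and N^4 >= 16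
     makes this at most N^8. *)
  by rewrite !leq_mul // ltnW.
have h8 : 16 <= N * N * N * N by rewrite (_ : 16 = 2 * 2 * 2 * 2) // !leq_mul.
have -> : N ^ 8 = (N * N * N * N) * (N * N * N * N) by rewrite !expnS expn0; ring.
by move: (N * N * N * N) (n * n * levels n * levels n) h h8 => u v; nia.
Qed.

Lemma limit_V k : limit_val n l k < V.
Proof.
have := capacity_V; have [p1 p2 p3] := prod_chain n.
by rewrite /capacity /l; case: k => /=; have := levels_gt1 n; have := lev_lt n;
  have := capacity_ge n; rewrite /capacity; lia.
Qed.

Lemma exec_prog S p s Q : well_formed 12 p -> in_range V s -> wp n l V S p s Q ->
  exists (s' : state R) t, [/\ exec B S (compile p) s s' t, t <= time n l p,
    in_range V s' & Q s'].
Proof.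
move=> wf w h; rewrite -word_capE.
apply: (exec_wp _ _ limit_V wf w h) => //.
by apply: leq_trans capacity_V; apply: leq_trans (capacity_ge n); lia.
Qed.

(** The invariant between operations; it concerns memory only, since registers are reset by each
    call. *)
Definition holds (G : wgraph R n) (s : state R) : Prop :=
  exists M, [/\ forall i, imem s i < V, imem s 0 = l, stored n s M & represents G M].

Lemma nth_range (r : seq nat) : (forall x, x \in r -> x <= n) ->
  forall i, nth 0 r i < V.
Proof.
move=> h i; have nV : n < V.
  by apply: leq_trans capacity_V; apply: leq_trans (capacity_ge n); lia.
have [li|li] := ltnP i (size r); first exact: leq_ltn_trans (h _ (mem_nth 0 li)) nV.
by rewrite nth_default // (leq_ltn_trans _ nV).
Qed.

Definition oracle : oracle_code :=
  OracleCode (compile build_prog) (compile insert_prog) (compile query_prog).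

Lemma holds_serves (G : wgraph R n) (s : state R) ops : holds G s ->
  serves oracle B (capacity n) (time n l insert_prog) (time n l query_prog) G s ops.
Proof.
elim: ops G s => [//|[a b w|u v a b] ops IH] G s [M [mem s0 st rep]] /=.
  move=> ne nab w0; have rep' := represents_insert rep ne nab w0.
  set s1 := insert_input s a b w.
  have r1 : in_range V s1.
    split=> //=; apply: nth_range => x; rewrite !inE.
    by case/or3P => /eqP -> //; exact: ltnW.
  have h : wp n l V (capacity n) insert_prog s1
      (fun t => stored n t (new_store l M a b w) /\ imem t 0 = l).
    have st1 : stored n s1 M by apply: stored_mem st.
    by apply: (wp_insert capacity_V (leqnn _) st1 s0 rep.1 rep'.1).
  have [s' [t [x lt [_ w'] [h1 h2]]]] := exec_prog (p := insert_prog) isT r1 h.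
  exists s', t; split=> //; apply: IH.
  by exists (new_store l M a b w).
move=> e; set s1 := query_input s u v a b.
have r1 : in_range V s1.
  split=> //=; apply: nth_range => x; rewrite !inE.
  by do 4 (case/orP => [/eqP -> //|]; try exact: ltnW); move=> /eqP ->; exact: ltnW.
have h : wp n l V (capacity n) query_prog s1
    (fun t => wreg t 0 = answer l M u v a b).
  have st1 : stored n s1 M by apply: stored_mem st.
  by apply: (wp_query_prog capacity_V (leqnn _) st1 s0 rep.1).
(* A query stores nothing, so the invariant survives it by the frame alone. *)
have h' := wp_frame h.
have [s' [t [x lt [_ w'] [f h1]]]] := exec_prog (p := query_prog) isT r1 h'.
exists s', t; split=> //; first by rewrite h1; apply: answer_dist.
apply: IH; exists M; split=> //.
  by rewrite (frame_imem f).
by apply: stored_mem st; rewrite ?(frame_imem f) ?(frame_wmem f).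
Qed.

End Run.

Theorem theorem2 :
  exists (P : oracle_code) (a : nat) (tbuild tins tqry space : nat -> nat),
    [/\ softO (fun n => n ^ 3) tbuild,
        softO (fun n => n ^ 2) tins,
        softO (fun n => n ^ 2) space,
        softO (fun=> 1) tqry &
        forall (R : realDomainType) (n : nat) (G : wgraph R n),
          wgraph_ok G ->
          exists (s : state R) (t : nat),
            [/\ exec (word_cap a n) (word_cap a n) (build_code P)
                  (build_input G) s t,
                t <= tbuild n &
                forall ops : seq (operation R n),
                  serves P (word_cap a n) (space n) (tins n) (tqry n) G s ops]].
Proof.
(* Stored integers fit in words of 8 (1 + log n) bits, and expressions have degree at most 12 in
   that capacity: 96 = 8 times 12. *)
exists oracle, 96, (fun n => time n (levels n) build_prog),
  (fun n => time n (levels n) insert_prog),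
  (fun n => time n (levels n) query_prog), capacity; split.
- exact: softO_time.
- exact: softO_time.
- exact: softO_capacity.
- exact: (@softO_time query_prog 0).
move=> R n G ok; set s := build_input G.
have r : in_range (2 ^ (8 * (trunc_log 2 n).+1)) s.
  split=> [i|i] /=; last by rewrite expn_gt0.
  by apply: nth_range => x; rewrite inE => /eqP ->.
have lS : capacity n <= word_cap 96 n.
  rewrite -word_capE; apply: leq_trans (capacity_V n) _.
  by rewrite -{1}(expn1 (2 ^ _)) leq_pexp2l // expn_gt0.
have h := wp_build (capacity_V n) lS (s := s) ok erefl erefl (fun=> erefl).
have [s' [t [x lt [_ w] [h1 h2 h3]]]] := exec_prog (p := build_prog) isT r h.
exists s', t; split=> // ops; apply: holds_serves.
exists (enable (levels n) n (init_store G)); split=> //; exact: w.1.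
Qed.
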